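(* Let $\Omega\subset\mathbb{R}^N$ be a bounded open set with Lipschitz boundary. Let $\boldsymbol{\Phi}=\boldsymbol{\Phi}(x,u):\bar\Omega\times\mathbb{R}\to\mathbb{R}^N$ and $f^\infty=f^\infty(x,u):\bar\Omega\times\mathbb{R}\to\mathbb{R}$ be such that, for every $R>0$, $\boldsymbol{\Phi}\in\boldsymbol{W}^{2,\infty}(\Omega\times(-R,R))$ and $f^\infty\in W^{1,\infty}(\Omega\times(-R,R))$; there are positive constants $c_1,c_2$ with $$\big|(\nabla\cdot\boldsymbol{\Phi})(x,u)+f^\infty(x,u)\big|\le c_1|u|+c_2\qquad\text{for a.e. }x\in\Omega\text{ and all }u\in\mathbb{R};$$ and $\partial_uf^\infty\le-\mu<0$ for some constant $\mu$. Let $G=G(x)\in L^\infty(\Omega)$ satisfy $0<\lambda\le G(x)\le\Lambda$ for a.e. $x\in\Omega$, for some constants $\lambda,\Lambda$. Then the stationary variational inequality $$\vartheta^\infty\in\mathbb{K}_G,\qquad \int_\Omega\boldsymbol{\Phi}(\vartheta^\infty)\cdot\nabla(v-\vartheta^\infty)\ \ge\ \int_\Omega f^\infty(\vartheta^\infty)(v-\vartheta^\infty),\quad\forall\, v\in\mathbb{K}_G,$$ has a unique solution $\vartheta^\infty$.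
   Context: $\mathbb{K}_G=\{v\in H^1_0(\Omega): |\nabla v|\le G \text{ a.e. in }\Omega\}$. $\boldsymbol{\Phi}(w)$ and $f^\infty(w)$ denote $x\mapsto\boldsymbol{\Phi}(x,w(x))$ and $x\mapsto f^\infty(x,w(x))$. $(\nabla\cdot\boldsymbol{\Phi})(x,u)$ is the divergence of $\boldsymbol\Phi$ in $x$ with $u$ fixed. *)

(* Defs.v *)
From HB Require Import structures.
From mathcomp Require Import all_boot all_order all_algebra.
From mathcomp Require Import all_classical all_reals all_analysis.

Set Implicit Arguments.
Unset Strict Implicit.
Unset Printing Implicit Defensive.
Import Order.TTheory GRing.Theory Num.Theory.
Import numFieldNormedType.Exports.
Local Open Scope classical_set_scope.
Local Open Scope ring_scope.

Definition rV_display : measure_display -> measure_display.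
Proof. exact. Qed.

Definition rV_coord (T : Type) n (i : 'I_n) (x : 'rV[T]_n) : T := x ord0 i.

(* 'rV[R]_n carries the product (= Borel) sigma-algebra, generated by the
   coordinate maps. *)
Section rV_measurable.
Context {R : realType} {n : nat}.

Let coord : 'I_n -> 'rV[R]_n -> R := @rV_coord R n.

Let rV_set0 : g_sigma_preimage coord set0.
Proof. exact: sigma_algebra0. Qed.

Let rV_setC A : g_sigma_preimage coord A -> g_sigma_preimage coord (~` A).
Proof. exact: sigma_algebraC. Qed.

Let rV_bigcup (F : (set 'rV[R]_n)^nat) :
  (forall i, g_sigma_preimage coord (F i)) ->
  g_sigma_preimage coord (\bigcup_i (F i)).
Proof. exact: sigma_algebra_bigcup. Qed.

HB.instance Definition _ := @isMeasurable.Build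
  (rV_display default_measure_display)
  'rV[R]_n (g_sigma_preimage coord) rV_set0 rV_setC rV_bigcup.

End rV_measurable.

Lemma measurable_rV_coord (R : realType) n (i : 'I_n) :
  measurable_fun [set: 'rV[R]_n] (fun x : 'rV[R]_n => x ord0 i).
Proof.
move=> _ Y mY; rewrite setTI; apply: sub_sigma_algebra => /=.
rewrite -bigcup_seq/=; exists i => /=; first by rewrite mem_index_enum.
by exists Y => //; rewrite setTI.
Qed.

Lemma measurable_fun_rVP d (T : measurableType d) (R : realType) n
    (f : T -> 'rV[R]_n) :
  (forall i, measurable_fun [set: T] (fun t => f t ord0 i)) ->
  measurable_fun [set: T] f.
Proof.
move=> mf _ A mA; rewrite setTI.
have : g_sigma_preimage (fun i => @rV_coord R n i \o f) `<=` measurable.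
  apply: smallest_sub; first exact: sigma_algebra_measurable.
  rewrite -bigcup_seq => B [i _ [C mC <-]].
  exact: mf.
rewrite g_sigma_preimage_comp; apply.
by exists A => //; rewrite setTI.
Qed.

Section rV_cons.
Context {R : realType} {n : nat}.

Definition rV_cons (z : R * 'rV[R]_n) : 'rV[R]_n.+1 :=
  row_mx (const_mx z.1 : 'rV[R]_1) z.2.

Definition rV_uncons (z : 'rV[R]_n.+1) : R * 'rV[R]_n :=
  (z ord0 ord0, rsubmx (z : 'rV[R]_(1 + n))).

Lemma rV_consK : cancel rV_cons rV_uncons.
Proof.
move=> [t x]; rewrite /rV_uncons /rV_cons row_mxKr; congr pair.
have -> : (ord0 : 'I_n.+1) = lshift n (ord0 : 'I_1) by exact/val_inj.
exact: (etrans (row_mxEl _ _ _ _) (mxE _ _ _ _)).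
Qed.

Lemma measurable_rV_cons : measurable_fun [set: R * 'rV[R]_n] rV_cons.
Proof.
apply: measurable_fun_rVP => i; rewrite /rV_cons.
case: (@splitP 1 n i) => [j ij|j ij].
  have -> : i = lshift n j by apply/val_inj.
  apply: eq_measurable_fun measurable_fst => z _.
  exact/esym/(etrans (row_mxEl _ _ _ _) (mxE _ _ _ _)).
have -> : i = rshift 1 j by apply/val_inj.
apply: eq_measurable_fun (measurableT_comp (measurable_rV_coord j)
  measurable_snd) => z _.
exact/esym/row_mxEr.
Qed.

Lemma measurable_rV_uncons : measurable_fun [set: 'rV[R]_n.+1] rV_uncons.
Proof.
apply/measurable_fun_pair; first exact: measurable_rV_coord.
apply: measurable_fun_rVP => i.
under eq_fun do rewrite mxE.
exact: measurable_rV_coord.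
Qed.

Section measure.
Variable m : {sigma_finite_measure set 'rV[R]_n -> \bar R}.

Definition rV_cons_measure : set 'rV[R]_n.+1 -> \bar R :=
  pushforward (@lebesgue_measure R \x m)%E rV_cons.

HB.instance Definition _ := Measure.copy rV_cons_measure
  (measure_function_pushforward__canonical__measure_function_Measure
    (@lebesgue_measure R \x m)%E measurable_rV_cons).

Let rV_cons_sigma_finite : sigma_finite setT rV_cons_measure.
Proof.
have /sigma_finiteP[F [TF ndF Foo]] := sigma_finiteT (@lebesgue_measure R).
have /sigma_finiteP[G [TG ndG Goo]] := sigma_finiteT m.
exists (fun k => rV_uncons @^-1` (F k `*` G k)).
  rewrite -preimage_bigcup (_ : \bigcup_k _ = setT) ?preimage_setT//.
  rewrite -setXTT TF TG predeqE => -[x y]; split.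
    by move=> [k _ []/= ? ?]; split; exists k.
  move=> [/= [p _ Fpx] [k _ Gky]]; exists (maxn p k) => //; split.
  - by move: x Fpx; exact/subsetPset/ndF/leq_maxl.
  - by move: y Gky; exact/subsetPset/ndG/leq_maxr.
move=> k; have [mFk Fkoo] := Foo k; have [mGk Gkoo] := Goo k; split.
  by rewrite -[_ @^-1` _]setTI; apply: measurable_rV_uncons => //;
    exact: measurableX.
rewrite /rV_cons_measure /pushforward -comp_preimage.
rewrite (_ : rV_uncons \o rV_cons = id); last first.
  by apply/funext => z /=; rewrite rV_consK.
by rewrite preimage_id product_measure1E// lte_mul_pinfty// ge0_fin_numE.
Qed.

HB.instance Definition _ := Measure_isSigmaFinite.Build _ _ _
  rV_cons_measure rV_cons_sigma_finite.

End measure.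
End rV_cons.

(* n-fold product of the one-dimensional Lebesgue measure *)
Fixpoint rV_lebesgue (R : realType) n :
    {sigma_finite_measure set 'rV[R]_n -> \bar R} :=
  match n with
  | 0 => \d_(0 : 'rV[R]_0)
  | n'.+1 => rV_cons_measure (rV_lebesgue R n')
  end.

Local Notation leb := (rV_lebesgue _ _).

Definition dot (R : realType) n (u v : 'rV[R]_n) : R :=
  \sum_(i < n) u ord0 i * v ord0 i.

(* The library norm on matrices is the sup norm. *)
Definition enorm (R : realType) n (u : 'rV[R]_n) : R := Num.sqrt (dot u u).

(* Near each boundary point, in suitable orthonormal coordinates (given by the
   orthogonal matrix Q, with the j-th coordinate playing the role of the
   "vertical" one), U is the strict epigraph of a Lipschitz function of the
   other n - 1 coordinates. *)
Definition Lipschitz_boundary (R : realType) n (U : set 'rV[R]_n) :=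
  forall x0, (closure U `&` closure (~` U)) x0 ->
  exists (Q : 'M[R]_n) (j : 'I_n) (gamma : 'rV[R]_n.-1 -> R),
    [/\ Q *m Q^T = 1%:M,
        lipschitz gamma &
        \forall x \near x0,
          U x <-> gamma (col' j (x *m Q)) < (x *m Q) ord0 j].

Section sobolev.
Context {R : realType} {n : nat}.
Implicit Types (U : set 'rV[R]_n) (u v g phi : 'rV[R]_n -> R) (i : 'I_n).

Definition evec i : 'rV[R]_n := delta_mx ord0 i.

Fixpoint Ck (k : nat) (phi : 'rV[R]_n -> R) : Prop :=
  continuous phi /\
  if k is k'.+1 then
    forall i, (forall x, derivable phi x (evec i)) /\ Ck k' ('D_(evec i) phi)
  else True.

(* C_c^infty(U), as functions on the whole space *)
Definition test_function U phi :=
  (forall k, Ck k phi) /\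
  exists K, [/\ compact K, K `<=` U & forall x, ~ K x -> phi x = 0].

Definition loc_integrable U u :=
  measurable_fun U u /\
  forall K, compact K -> K `<=` U -> leb.-integrable K (EFin \o u).

Definition is_weak_partial U i u g :=
  [/\ loc_integrable U u, loc_integrable U g &
      forall phi, test_function U phi ->
        \int[leb]_(x in U) (u x * 'D_(evec i) phi x) =
        - \int[leb]_(x in U) (g x * phi x)].

(* A chosen version of the i-th weak partial derivative, which is unique up to
   a null set of U (and the zero function when there is none). *)
Definition weak_partial U i u : 'rV[R]_n -> R :=
  xget (fun=> 0) [set g | is_weak_partial U i u g].

Definition weakly_derivable U i u := exists g, is_weak_partial U i u g.

Definition weak_grad U u (x : 'rV[R]_n) : 'rV[R]_n :=
  \row_i weak_partial U i u x.

(* L^p(U) : only the values on U matter *)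
Definition Lp (p : \bar R) U u : Prop := u \_ U \in Lfun leb p.

Fixpoint Woo (k : nat) U u : Prop :=
  Lp +oo%E U u /\
  if k is k'.+1 then
    forall i, weakly_derivable U i u /\ Woo k' U (weak_partial U i u)
  else True.

Definition L2_dist U u v : \bar R :=
  ('N[leb]_(2%:E) [EFin \o ((u \- v)%R \_ U)])%E.

(* H^1_0(U) : the closure of C_c^infty(U) in H^1(U) *)
Definition H10 U u : Prop :=
  [/\ Lp 2%:E U u,
      forall i, weakly_derivable U i u /\ Lp 2%:E U (weak_partial U i u) &
      exists phi : nat -> 'rV[R]_n -> R,
        [/\ forall k, test_function U (phi k),
            L2_dist U u (phi k) @[k --> \oo] --> 0%E &
            forall i, L2_dist U (weak_partial U i u) ('D_(evec i) (phi k))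
              @[k --> \oo] --> 0%E]].

End sobolev.

Section problem.
Context {R : realType} {N : nat}.
Implicit Types (Omega : set 'rV[R]_N) (G v theta : 'rV[R]_N -> R).

(* Omega x (-r, r) in R^(N+1), the last coordinate being u *)
Definition cylinder Omega (r : R) : set 'rV[R]_(N + 1) :=
  [set z | Omega (lsubmx z) /\ - r < rsubmx z ord0 ord0 < r].

Definition joint (h : 'rV[R]_N -> R -> R) : 'rV[R]_(N + 1) -> R :=
  fun z => h (lsubmx z) (rsubmx z ord0 ord0).

Definition u_index : 'I_(N + 1) := rshift N ord0.

(* Divergence in x with u fixed.  Used for the continuous representative of
   some Phi whose components are in Woo 2 of every cylinder; such a Phi is C^1,
   so that the classical partial derivatives exist and represent the weak
   ones. *)
Definition divx (Phi : 'rV[R]_N -> R -> 'rV[R]_N) (x : 'rV[R]_N) (u : R) : R :=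
  \sum_(i < N) 'D_(evec i) (fun y => Phi y u ord0 i) x.

Definition KG Omega G v : Prop :=
  H10 Omega v /\
  {ae leb, forall x, Omega x -> enorm (weak_grad Omega v x) <= G x}.

Definition stationary_VI Omega (Phi : 'rV[R]_N -> R -> 'rV[R]_N)
    (f : 'rV[R]_N -> R -> R) G theta : Prop :=
  KG Omega G theta /\
  forall v, KG Omega G v ->
    \int[leb]_(x in Omega)
      dot (Phi x (theta x)) (weak_grad Omega (v \- theta) x) >=
    \int[leb]_(x in Omega) (f x (theta x) * (v x - theta x)).

End problem.

(* Main.v *)
Require Import Defs.
From HB Require Import structures.
From mathcomp Require Import all_boot all_order all_algebra.
From mathcomp Require Import all_classical all_reals all_analysis.
From mathcomp Require Import measurable_realfun.
From mathcomp Require Import ring lra.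

(** A function u of K_G and its weak gradient form a family indexed by
    option 'I_N, and these families form a closed convex set K of L2, on which
    every component is bounded a.e.: the gradient by Lambda, and u by comparison
    with exp(x_1 + c).  On such bounded values the coefficients (- f, Phi) are
    bounded and Lipschitz continuous in u, and - f is strongly increasing.

    Uniqueness is a comparison principle in L1: testing the two inequalities
    with u - e tanh((u - u') / e) and u' + e tanh((u - u') / e) and letting e
    tend to 0, the terms with Phi disappear and mu |u - u'|_1 <= 0 is left.

    For the existence, add a term M (u - g) and a viscosity e.  For large M the
    coefficients are a small perturbation of a strictly convex minimization
    problem, which is solved by a contraction.  By the comparison principle
    g |-> u is a contraction of ratio M / (M + mu) in L1, which removes the term
    in M.  Finally e tends to 0: K is compact in L1 for the component u, and
    weak limits of the gradients are obtained from near-minimizers of the norm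
    over decreasing sequences of convex sets. *)

Set Implicit Arguments.
Unset Strict Implicit.
Unset Printing Implicit Defensive.
Import Order.TTheory GRing.Theory Num.Theory.
Import numFieldNormedType.Exports.
Local Open Scope classical_set_scope.
Local Open Scope ring_scope.

(** * Square integrable functions *)

(** No term of the inequality is coercive in the gradient, and Phi(u) - Phi(u') paired with grad (u
    - u') has no sign. Gradients are controlled by the constraint alone, and the only useful test
    direction is a smooth sign of u - u'. The test functions must stay in [KG], which dictates their
    shape: u - e tanh((u - u') / e) has the gradient (1 - b) grad u + b grad u' with b = 1 - tanh^2
    in [0, 1]. This is a convex combination at each point, so the bound by a variable G survives;
    and since tanh is smooth with tanh 0 = 0, it sends test functions to test functions and the
    chain rule follows by approximation. The barrier exp(x_1 + c) is its own derivative in x_1, and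
    c makes it exceed Lambda: where u is above it, D_1 u is below u. One direction suffices and no
    Sobolev inequality enters. The viscosity supplies the missing strict convexity in the gradient.
    Freezing the coefficients costs L^2 / c_j in component j by Young's inequality, which fixes the
    size of M. The coefficients have weak derivatives in N + 1 variables, known only a.e., while u
    occupies a null graph there; continuity is what turns these bounds into slopes in u at every
    x. *)

Section integral_toolbox.
Context d (T : measurableType d) (R : realType).
Variables (mu : {measure set T -> \bar R}) (D : set T).
Hypotheses (mD : measurable D) (fD : (mu D < +oo)%E).
Implicit Types f g h : T -> R.

Definition intg f := mu.-integrable D (EFin \o f).
Notation I f := (\int[mu]_(x in D) f x).

Lemma intg_meas f : intg f -> measurable_fun D f.
Proof. by move=> /integrableP[/measurable_EFinP]. Qed.

Lemma ae_all (J : finType) (P : J -> T -> Prop) :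
  (forall j, {ae mu, forall x, D x -> P j x}) ->
  {ae mu, forall x, D x -> forall j, P j x}.
Proof.
move=> h.
have : \forall x \near almost_everywhere mu, forall j, D x -> P j x.
  by apply: filter_forall => j; exact: h.
by apply: filterS => x {}h Dx j; exact: h.
Qed.

Lemma intgD f g : intg f -> intg g -> intg (fun x => f x + g x).
Proof.
move=> hf hg; have := integrableD mD hf hg.
by apply: eq_integrable => // x _ /=; rewrite EFinD.
Qed.

Lemma intgZ (a : R) f : intg f -> intg (fun x => a * f x).
Proof.
move=> hf; have := integrableZl mD a hf.
by apply: eq_integrable => // x _ /=; rewrite EFinM.
Qed.

Lemma eq_intg f g : (forall x, D x -> f x = g x) -> intg f -> intg g.
Proof.
move=> fg; apply: eq_integrable => // x; rewrite inE => Dx /=; by rewrite fg.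
Qed.

Lemma intgB f g : intg f -> intg g -> intg (fun x => f x - g x).
Proof.
move=> hf /(intgZ (-1)) hg; have := intgD hf hg.
by apply: eq_intg => x _; rewrite mulN1r.
Qed.

Lemma intg_cst (a : R) : intg (fun=> a).
Proof. apply/integrableP; split; [exact: measurable_cst|rewrite integral_cst//= lte_mul_pinfty//].   Qed.

Lemma intg_sum (J : Type) (s : seq J) (F : J -> T -> R) :
  (forall j, intg (F j)) -> intg (fun x => \sum_(j <- s) F j x).
Proof.
move=> h; elim: s => [|a s ih].
  by apply: eq_intg (intg_cst 0) => x _; rewrite big_nil.
by apply: eq_intg (intgD (h a) ih) => x _; rewrite big_cons.
Qed.

Lemma intg_le_ae f g : measurable_fun D f -> intg g ->
  {ae mu, forall x, D x -> `|f x| <= g x} -> intg f.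
Proof.
move=> mf ig h; apply/integrableP; split; first exact/measurable_EFinP.
move/integrableP : (ig) => [_]; apply: le_lt_trans.
apply: ae_ge0_le_integral => //.
- by apply: measurableT_comp => //; exact/measurable_EFinP.
- by apply: measurableT_comp => //; apply/measurable_EFinP; exact: intg_meas.
apply: filterS h => x h Dx /=; rewrite lee_fin.
by apply: le_trans (h Dx) _; exact: ler_norm.
Qed.

Lemma intg_le f g : measurable_fun D f -> intg g ->
  (forall x, D x -> `|f x| <= g x) -> intg f.
Proof. by move=> mf ig h; apply: (intg_le_ae mf ig); apply: aeW. Qed.

Lemma intg_norm f : intg f -> intg (fun x => `|f x|).
Proof.
move=> hf; apply: (@intg_le _ (fun x => `|f x|)) => //.
- by apply: measurableT_comp => //; exact: intg_meas.
- have := integrable_abse hf; by apply: eq_integrable => // x _ /=.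
- by move=> x _; rewrite normr_id.
Qed.

Lemma intg_bnd f (C : R) : measurable_fun D f ->
  {ae mu, forall x, D x -> `|f x| <= C} -> intg f.
Proof. by move=> mf; exact: intg_le_ae (intg_cst C). Qed.

Lemma RID f g : intg f -> intg g -> I (fun x => f x + g x) = I f + I g.
Proof. by move=> *; rewrite RintegralD. Qed.
Lemma RIB f g : intg f -> intg g -> I (fun x => f x - g x) = I f - I g.
Proof. by move=> *; rewrite RintegralB. Qed.
Lemma RIZ a f : intg f -> I (fun x => a * f x) = a * I f.
Proof. by move=> *; rewrite RintegralZl. Qed.
Lemma RIsum (J : Type) (s : seq J) (F : J -> T -> R) :
  (forall j, intg (F j)) ->
  I (fun x => \sum_(j <- s) F j x) = \sum_(j <- s) I (F j).
Proof.
move=> h; elim: s => [|a s ih].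
  rewrite big_nil (_ : (fun _ => _) = fun=> 0).
    by rewrite Rintegral_cst// mul0r.
  by apply/funext => x; rewrite big_nil.
rewrite big_cons -ih -RID//; last exact: intg_sum.
by apply: eq_Rintegral => x _; rewrite big_cons.
Qed.

Lemma RI_ge0_ae f : measurable_fun D f ->
  {ae mu, forall x, D x -> 0 <= f x} -> 0 <= I f.
Proof.
move=> mf h; rewrite (_ : I f = I (fun x => `|f x|)); first exact: Rintegral_ge0.
rewrite /Rintegral; congr fine; apply: ae_eq_integral => //.
- exact/measurable_EFinP.
- by apply/measurable_EFinP; apply: measurableT_comp.
- by apply: filterS h => x h Dx /=; rewrite ger0_norm// h.
Qed.

Lemma RI_eq_ae f g : measurable_fun D f -> measurable_fun D g ->
  {ae mu, forall x, D x -> f x = g x} -> I f = I g.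
Proof.
move=> mf mg h; rewrite /Rintegral; congr fine; apply: ae_eq_integral => //.
- exact/measurable_EFinP.
- exact/measurable_EFinP.
- by apply: filterS h => x h Dx /=; rewrite h.
Qed.

Lemma RI_le_ae f g : intg f -> intg g ->
  {ae mu, forall x, D x -> f x <= g x} -> I f <= I g.
Proof.
move=> hf hg h; rewrite -subr_ge0 -RIB//; apply: RI_ge0_ae.
  exact/intg_meas/intgB.
by apply: filterS h => x h Dx; rewrite subr_ge0 h.
Qed.

Lemma RI_le f g : intg f -> intg g ->
  (forall x, D x -> f x <= g x) -> I f <= I g.
Proof. by move=> hf hg h; apply: RI_le_ae => //; apply: aeW. Qed.

Lemma RI_norm_le f g : measurable_fun D f -> intg g ->
  {ae mu, forall x, D x -> `|f x| <= g x} -> `|I f| <= I g.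
Proof.
move=> mf ig h; have hf := intg_le_ae mf ig h.
apply: le_trans (le_normr_Rintegral mD hf) _.
by apply: RI_le_ae => //; exact: intg_norm.
Qed.

Lemma EFin_RI f : intg f -> (I f)%:E = (\int[mu]_(x in D) (f x)%:E)%E.
Proof. by move=> hf; rewrite /Rintegral fineK//; exact: integrable_fin_num. Qed.

Lemma RI_eq0 f : intg f -> {ae mu, forall x, D x -> 0 <= f x} -> I f <= 0 ->
  {ae mu, forall x, D x -> f x = 0}.
Proof.
move=> hf f0 If; have mf := intg_meas hf.
have : (\int[mu]_(x in D) `|(f x)%:E| = 0)%E.
  have -> : (\int[mu]_(x in D) `|(f x)%:E| = (I (fun x => `|f x|))%:E)%E.
    by rewrite EFin_RI//; exact: intg_norm.
  congr EFin; apply/eqP; rewrite eq_le Rintegral_ge0// andbT.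
  rewrite (@RI_eq_ae _ f)//; first exact: measurableT_comp.
  by apply: filterS f0 => x h Dx /=; rewrite ger0_norm// h.
move/(ae_eq_integral_abs mu mD) => /(_ _)/[!measurable_EFinP]/(_ mf).
by apply: filterS => x h Dx; have [] := h Dx.
Qed.

Definition L2 f := measurable_fun D f /\ intg (fun x => f x ^+ 2).

Lemma L2_meas f : L2 f -> measurable_fun D f. Proof. by case. Qed.
Lemma L2_sqr f : L2 f -> intg (fun x => f x ^+ 2). Proof. by case. Qed.

Lemma L2mul f g : L2 f -> L2 g -> intg (fun x => f x * g x).
Proof.
move=> [mf hf] [mg hg].
apply: (@intg_le _ (fun x => f x ^+ 2 + g x ^+ 2)).
- exact: measurable_funM.
- exact: intgD.
move=> x _; rewrite normrM; rewrite -(real_normK (num_real (f x))) -(real_normK (num_real (g x))).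
by have := sqr_ge0 (`|f x| - `|g x|); have := sqr_ge0 (`|f x| + `|g x|); nra.
Qed.

Lemma L2D f g : L2 f -> L2 g -> L2 (fun x => f x + g x).
Proof.
move=> hf hg; split; first by apply: measurable_funD; exact: L2_meas.
apply: eq_intg (intgD (intgD (L2_sqr hf) (L2_sqr hg)) (intgZ 2 (L2mul hf hg))).
by move=> x _; ring.
Qed.

Lemma L2Z a f : L2 f -> L2 (fun x => a * f x).
Proof.
move=> hf; split.
  by apply: measurable_funM; [exact: measurable_cst|exact: L2_meas].
apply: eq_intg (intgZ (a ^+ 2) (L2_sqr hf)) => x _; by rewrite exprMn.
Qed.

Lemma eq_L2 f g : (forall x, D x -> f x = g x) -> L2 f -> L2 g.
Proof.
move=> fg [mf hf]; split.
  by apply: eq_measurable_fun mf => x; rewrite inE => Dx; rewrite fg.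
by apply: eq_intg hf => x Dx; rewrite fg.
Qed.

Lemma L2B f g : L2 f -> L2 g -> L2 (fun x => f x - g x).
Proof.
move=> hf /(L2Z (-1)) hg; apply: eq_L2 (L2D hf hg) => x _.
by rewrite mulN1r.
Qed.

Lemma L2_bnd f (C : R) : measurable_fun D f ->
  {ae mu, forall x, D x -> `|f x| <= C} -> L2 f.
Proof.
move=> mf h; split => //; apply: (@intg_bnd _ (C ^+ 2)).
  exact: measurable_funX.
apply: filterS h => x h Dx; rewrite normrX lerXn2r// ?nnegrE// ?h//.
by apply: le_trans (h Dx).
Qed.

Lemma L2_cst (a : R) : L2 (fun=> a).
Proof. by split; [exact: measurable_cst|exact: intg_cst]. Qed.

Lemma L2_intg f : L2 f -> intg f.
Proof.
move=> hf; apply: eq_intg (L2mul hf (L2_cst 1)) => x _; by rewrite mulr1.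
Qed.

Ltac igr := repeat first [assumption | apply: intgB | apply: intgD | apply: intgZ | apply: L2mul | apply: L2_sqr].

Definition nm2 f := Num.sqrt (I (fun x => f x ^+ 2)).

Lemma nm2_ge0 f : 0 <= nm2 f. Proof. exact: sqrtr_ge0. Qed.

Lemma I2_ge0 f : 0 <= I (fun x => f x ^+ 2).
Proof. by apply: Rintegral_ge0 => x _; exact: sqr_ge0. Qed.

Lemma nm2K f : nm2 f ^+ 2 = I (fun x => f x ^+ 2).
Proof. by rewrite sqr_sqrtr// I2_ge0. Qed.

(** The polynomial t -> |f + t g|^2 is nonnegative; its value at a suitable t gives the bound. *)
Lemma cauchy_schwarz f g : L2 f -> L2 g ->
  `|I (fun x => f x * g x)| <= nm2 f * nm2 g.
Proof.
move=> hf hg; set b := I _.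
set a := nm2 f; set c := nm2 g.
have a0 : 0 <= a := nm2_ge0 _.
have c0 : 0 <= c := nm2_ge0 _.
have key t : 0 <= a ^+ 2 + 2 * t * b + t ^+ 2 * c ^+ 2.
  rewrite /a /c !nm2K.
  rewrite (_ : _ + _ = I (fun x => (f x + t * g x) ^+ 2)); first exact: I2_ge0.
  rewrite -!RIZ; [|by igr..].
  rewrite -!RID; [|by igr..]; by apply: eq_Rintegral => x _; ring.
rewrite -(@ler_pXn2r _ 2)// ?nnegrE ?mulr_ge0// real_normK ?num_real//.
have [c00|c00] := eqVneq c 0.
  have [->|b0] := eqVneq b 0; first by rewrite expr0n/= sqr_ge0.
  (* When g has norm 0 the polynomial is affine in t, and at this t it would equal - 1. *)
  have := key (- (a ^+ 2 + 1) / (2 * b)).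
  rewrite c00 expr0n/= mulr0 addr0 (_ : 2 * _ * b = - (a ^+ 2 + 1)).
    lra.
  by field.
have c20 : 0 < c ^+ 2 by rewrite exprn_gt0// lt_def c00.
(* The minimum of the quadratic polynomial. *)
have := key (- b / c ^+ 2).
rewrite (_ : a ^+ 2 + _ + _ = a ^+ 2 - b ^+ 2 / c ^+ 2); last by field.
by rewrite subr_ge0 ler_pdivrMr// exprMn.
Qed.

Lemma nm2D f g : L2 f -> L2 g -> nm2 (fun x => f x + g x) <= nm2 f + nm2 g.
Proof.
move=> hf hg.
rewrite -(@ler_pXn2r _ 2)// ?nnegrE ?nm2_ge0 ?addr_ge0 ?nm2_ge0//.
rewrite nm2K sqrrD !nm2K.
rewrite (_ : I (fun x => (f x + g x) ^+ 2) = I (fun x => f x ^+ 2) + 2 * I (fun x => f x * g x) + I (fun x => g x ^+ 2)).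
  have := cauchy_schwarz hf hg; have := ler_norm (I (fun x => f x * g x)); lra.
rewrite -RIZ; [|by igr..].
by rewrite -!RID; [|by igr..]; apply: eq_Rintegral => x _; ring.
Qed.

Lemma nm2_le_ae f g : L2 f -> L2 g ->
  {ae mu, forall x, D x -> `|f x| <= `|g x|} -> nm2 f <= nm2 g.
Proof.
move=> hf hg h; rewrite ler_sqrt// ?I2_ge0//.
apply: RI_le_ae; [exact: L2_sqr|exact: L2_sqr|].
by apply: filterS h => x h Dx; rewrite -(real_normK (num_real (f x))) -(real_normK (num_real (g x))) lerXn2r// ?nnegrE// h.
Qed.

Lemma L1_nm2 f : L2 f -> I (fun x => `|f x|) <= nm2 f * nm2 (fun=> 1).
Proof.
move=> hf; have hnf : L2 (fun x => `|f x|).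
  split; first by apply: measurableT_comp => //; exact: L2_meas.
  by apply: eq_intg (L2_sqr hf) => x _; rewrite real_normK// num_real.
have := cauchy_schwarz hnf (L2_cst 1).
rewrite (_ : nm2 (fun x => `|f x|) = nm2 f); last first.
  by congr Num.sqrt; apply: eq_Rintegral => x _; rewrite real_normK// num_real.
apply: le_trans; apply: le_trans (ler_norm _).
by apply: RI_le; [exact: intg_norm (L2_intg hf)|exact: L2mul hnf (L2_cst 1)|move=> x _; rewrite mulr1].
Qed.

Lemma eq_nm2 f g : (forall x, D x -> f x = g x) -> nm2 f = nm2 g.
Proof. by move=> h; congr Num.sqrt; apply: eq_Rintegral => x /[!inE] Dx; rewrite h. Qed.

Lemma nm2Z a f : L2 f -> nm2 (fun x => a * f x) = `|a| * nm2 f.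
Proof.
move=> hf; rewrite /nm2 -[`|a|]sqrtr_sqr.
rewrite -sqrtrM ?sqr_ge0// -RIZ; last exact: L2_sqr.
congr Num.sqrt; apply: eq_Rintegral => x _; by rewrite exprMn.
Qed.

Lemma nm2C f g : nm2 (fun x => f x - g x) = nm2 (fun x => g x - f x).
Proof. by congr Num.sqrt; apply: eq_Rintegral => x _; ring. Qed.

End integral_toolbox.

Ltac igr := repeat first [assumption | apply: intgB | apply: intgD | apply: intg_cst | apply: intgZ | apply: L2mul | apply: L2_sqr].

(** * Completeness of L2 and limits of integrals *)

Section completeness.
Context d (T : measurableType d) (R : realType).
Variables (mu : {measure set T -> \bar R}) (D : set T).
Hypotheses (mD : measurable D) (fD : (mu D < +oo)%E).
Implicit Types f g h : T -> R.
Local Notation I f := (\int[mu]_(x in D) f x).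
Local Notation intg := (intg mu D).
Local Notation L2 := (L2 mu D).
Local Notation nm2 := (nm2 mu D).

Lemma limn_einf_le (u : (\bar R)^nat) (c : \bar R) :
  (forall k, (u k <= c)%E) -> (limn_einf u <= c)%E.
Proof.
move=> h; apply: le_trans (limn_einf_sup u) _; rewrite limn_esup_lim.
apply: lime_le; first exact: is_cvg_esups.
by near=> n; apply: ge_ereal_sup => _ [m _ <-].
Unshelve. all: by end_near.
Qed.

Lemma fatou_L2 (g_ : nat -> T -> R) g (C : R) :
  (forall k, L2 (g_ k)) -> measurable_fun D g ->
  {ae mu, forall x, D x -> g_ k x @[k --> \oo] --> g x} ->
  (forall k, I (fun x => g_ k x ^+ 2) <= C) ->
  L2 g /\ I (fun x => g x ^+ 2) <= C.
Proof.
move=> hg mg cv hC.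
have mgk k : measurable_fun D (fun x => (g_ k x ^+ 2)%:E).
  by apply/measurable_EFinP; exact: intg_meas (L2_sqr (hg k)).
have mg2 : measurable_fun D (fun x => (g x ^+ 2)%:E).
  by apply/measurable_EFinP; exact: measurable_funX.
have F : (\int[mu]_(x in D) (g x ^+ 2)%:E <= C%:E)%E.
  have -> : (\int[mu]_(x in D) (g x ^+ 2)%:E =
      \int[mu]_(x in D) limn_einf (fun k => (g_ k x ^+ 2)%:E))%E.
    apply: ge0_ae_eq_integral => //.
    - apply: measurableT_comp => //; apply: measurable_fun_limn_esup => k.
      by apply: measurableT_comp.
    - by move=> x _; rewrite lee_fin sqr_ge0.
    - move=> x _; rewrite limn_einf_lim; apply: lime_ge.
        exact: is_cvg_einfs.
      near=> n; apply: le_ereal_inf_tmp => _ [m _ <-].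
      by rewrite lee_fin sqr_ge0.
    - apply: filterS cv => x cv Dx.
      have : (g_ k x ^+ 2)%:E @[k --> \oo] --> (g x ^+ 2)%:E.
        apply: cvg_EFin; first exact: nearW.
        exact: (cvgM (cv Dx) (cv Dx)).
      by move/cvg_limn_einf_sup => [-> _].
  apply: le_trans (fatou mu mD mgk _) _; first by move=> k x _; rewrite lee_fin sqr_ge0.
  by apply: limn_einf_le => k; rewrite -EFin_RI ?lee_fin//; exact: L2_sqr.
have ig : intg (fun x => g x ^+ 2).
  apply/integrableP; split => //; apply: le_lt_trans (ltry C).
  rewrite (eq_integral (fun x => (g x ^+ 2)%:E))// => x _ /=.
  by rewrite ger0_norm// sqr_ge0.
by split => //; rewrite -lee_fin EFin_RI.
Unshelve. all: by end_near.
Qed.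

Lemma RI_dct (g_ : nat -> T -> R) g h :
  (forall n, measurable_fun D (g_ n)) -> measurable_fun D g -> intg h ->
  {ae mu, forall x, D x -> g_ n x @[n --> \oo] --> g x} ->
  (forall n x, D x -> `|g_ n x| <= h x) ->
  I (g_ n) @[n --> \oo] --> I g.
Proof.
move=> mg_ mg ih cv bd.
have [||||i1 _ i3] := @dominated_convergence _ _ _ mu D mD (fun n => EFin \o g_ n)
   (EFin \o g) (EFin \o h) _ _ _ ih _.
- by move=> n; apply/measurable_EFinP.
- exact/measurable_EFinP.
- by apply: filterS cv => x cv Dx; apply: cvg_EFin; [exact: nearW|exact: cv].
- by apply: aeW => x n Dx /=; rewrite lee_fin; exact: bd.
have ign n : intg (g_ n) by apply: (@intg_le _ _ _ _ _ mD _ h) => //; exact: bd.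
apply: fine_cvg; rewrite fineK; last exact: integrable_fin_num.
exact: i3.
Qed.

(** Riesz-Fischer: along a subsequence with increments at most 2^-k the sum of the absolute
    increments is integrable, so the subsequence converges a.e.; [fatou_L2] then bounds its distance
    to the limit. *)
Lemma L2_complete (f_ : nat -> T -> R) : (forall k, L2 (f_ k)) ->
  (forall e : R, 0 < e -> exists n, forall p q, (n <= p)%N -> (n <= q)%N ->
     nm2 (fun x => f_ p x - f_ q x) <= e) ->
  exists2 f, L2 f & forall e : R, 0 < e -> exists n, forall p, (n <= p)%N ->
     nm2 (fun x => f_ p x - f x) <= e.
Proof.
move=> hf cf.
have cf' k : exists n, forall p q, (n <= p)%N -> (n <= q)%N ->
    nm2 (fun x => f_ p x - f_ q x) <= (2^-1) ^+ k.
  by apply: cf; rewrite exprn_gt0.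
have [s hs] := choice cf'.
(* Partial sums make the extraction nondecreasing while keeping it above [s]. *)
pose t k := (\sum_(i < k.+1) s i)%N.
have st k : (s k <= t k)%N by rewrite /t big_ord_recr leq_addl.
have tS k : (t k <= t k.+1)%N by rewrite {2}/t big_ord_recr leq_addr.
pose dd k x := f_ (t k.+1) x - f_ (t k) x.
have hd k : L2 (dd k) by exact: L2B.
have dle k : nm2 (dd k) <= (2^-1) ^+ k.
  by apply: hs => //; exact: leq_trans (tS k).
have mdk k : measurable_fun D (fun x => `|dd k x|%:E).
  by apply/measurable_EFinP; apply: measurableT_comp => //; exact: L2_meas (hd k).
pose c := nm2 (fun=> 1).
have sumfin : (\int[mu]_(x in D) (\sum_(0 <= k <oo) `|dd k x|%:E) < +oo)%E.
  rewrite integral_nneseries//.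
  (* The bound c 2^-k is rewritten in the shape of the geometric series summed below. *)
  apply: (@le_lt_trans _ _ (\sum_(0 <= k <oo) (2 * c / (2 ^ (k + 1))%:R)%:E)%E).
    apply: lee_nneseries => [k _ _|k _]; first by apply: integral_ge0 => x _; rewrite lee_fin.
    rewrite -EFin_RI//; last exact: intg_norm (L2_intg mD fD (hd k)).
    rewrite lee_fin; apply: le_trans (L1_nm2 mD fD (hd k)) _.
    rewrite (_ : 2 * c / _ = (2^-1) ^+ k * c); first by rewrite ler_wpM2r// nm2_ge0.
    rewrite natrX addn1 exprS exprVn; field.
      by rewrite expf_neq0//= pnatr_eq0.
  rewrite [X in (X < _)%E](_ : _ = (2 * c / 2 ^+ 0)%:E); first exact: ltry.
  by apply: cvg_lim => //; exact: (@cvg_geometric_eseries_half R (2 * c) 0).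
have aefin : {ae mu, forall x, D x -> cvgn (fun k => f_ (t k) x)}.
  have ise : mu.-integrable D (fun x => \sum_(0 <= k <oo) `|dd k x|%:E)%E.
    apply/integrableP; split.
      apply: ge0_emeasurable_sum => //= k x _ _; by rewrite lee_fin.
    rewrite (eq_integral (fun x => \sum_(0 <= k <oo) `|dd k x|%:E)%E)// => x _.
    by rewrite gee0_abs//; apply: nneseries_ge0.
  have := integrable_ae mD ise; apply: filterS => x hx Dx.
  have {}hx := hx Dx.
  have cs : cvgn [normed series (fun k => dd k x)].
    apply: nondecreasing_is_cvgn.
      by apply/nondecreasing_seqP => n; rewrite /normed_series_of/= !seriesEnat/= big_nat_recr//= lerDl.
    exists (fine (\sum_(0 <= k <oo) `|dd k x|%:E)%E) => _ [n _ <-].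
    rewrite -lee_fin fineK// /normed_series_of /= seriesEnat /= -sumEFin.
    exact: nneseries_lim_ge.
  have := normed_cvg cs.
  have -> : (fun k => f_ (t k) x) = (fun k => f_ (t 0%N) x + series (fun k => dd k x) k).
    apply/funext => k; rewrite [LHS](eq_sum_telescope (fun k => f_ (t k) x)).
    by congr (_ + series _ _).
  by move=> h; apply: is_cvgD => //; exact: is_cvg_cst.
(* A limsup is measurable everywhere, including the null set where the subsequence diverges. *)
pose f x := fine (limn_esup (fun k => (f_ (t k) x)%:E)).
have mf : measurable_fun D f.
  apply: (measurableT_comp (fine_measurable measurableT)) => //.
  apply: measurable_fun_limn_esup => k.
  by apply/measurable_EFinP; exact: L2_meas.
have fcv : {ae mu, forall x, D x -> f_ (t k) x @[k --> \oo] --> f x}.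
  apply: filterS aefin => x h Dx; have {}h := h Dx.
  have /cvg_limn_einf_sup[_ h2] : (f_ (t k) x)%:E @[k --> \oo] -->
     (limn (fun k => f_ (t k) x))%:E.
    by apply: cvg_EFin => //; exact: nearW.
  by rewrite /f h2.
have key m : L2 (fun x => f x - f_ (t m) x) /\
   I (fun x => (f x - f_ (t m) x) ^+ 2) <= ((2^-1) ^+ m) ^+ 2.
  have := @fatou_L2 (fun k x => f_ (t (k + m)%N) x - f_ (t m) x)
     (fun x => f x - f_ (t m) x) (((2^-1) ^+ m) ^+ 2); apply.
  - by move=> k; exact: L2B.
  - by apply: measurable_funB => //; exact: L2_meas.
  - apply: filterS fcv => x h Dx; apply: cvgB; last exact: cvg_cst.
    by have := h Dx; rewrite -(cvg_shiftn m).
  - move=> k; rewrite -nm2K; apply: lerXn2r; rewrite ?nnegrE ?nm2_ge0 ?exprn_ge0//.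
    apply: hs => //.
    have tm : (t m <= t (k + m))%N.
      by elim: k => // k ih; rewrite addSn; exact: leq_trans (tS _).
    exact: leq_trans tm.
exists f.
  have [h _] := key 0%N.
  by apply: eq_L2 (L2D mD h (hf (t 0%N))) => // x _; rewrite subrK.
move=> e e0.
have [m hm] : exists m, (2^-1 : R) ^+ m <= e / 2.
  have e20 : 0 < e / 2 by rewrite divr_gt0.
  have h : (2^-1 : R) ^+ n @[n --> \oo] --> 0 by apply: cvg_expr; rewrite ger0_norm// invf_lt1// ltr1n.
  have [m _ /(_ m (leqnn m))] := (cvgrPdist_le _ _).1 h _ e20.
  by rewrite /= sub0r normrN ger0_norm ?exprn_ge0//; exists m.
exists (t m) => p hp; have [hl hb] := key m.
have -> : nm2 (fun x => f_ p x - f x) = nm2 (fun x => (f_ p x - f_ (t m) x) + (f_ (t m) x - f x)).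
  by apply: eq_nm2 => // x _; ring.
apply: le_trans (nm2D mD _ _) _; [exact: L2B| |].
  by apply: eq_L2 (L2Z mD (-1) hl) => // x _; ring.
have h1 : nm2 (fun x => f_ p x - f_ (t m) x) <= e / 2.
  by apply: le_trans hm; apply: hs => //; exact: leq_trans hp.
have h2 : nm2 (fun x => f_ (t m) x - f x) <= e / 2.
  apply: le_trans hm; rewrite nm2C /nm2 -[leRHS]ger0_norm ?exprn_ge0// -sqrtr_sqr.
  by rewrite ler_sqrt// sqr_ge0.
lra.
Qed.

End completeness.

(** * Minimization over convex sets of L2 *)

Section convex_sets.
Context d (T : measurableType d) (R : realType).
Variables (mu : {measure set T -> \bar R}) (D : set T).
Hypotheses (mD : measurable D) (fD : (mu D < +oo)%E).
Local Notation I f := (\int[mu]_(x in D) f x).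
Local Notation intg := (intg mu D).
Local Notation L2 := (L2 mu D).
Local Notation nm2 := (nm2 mu D).

Variables (J : finType) (K : set (J -> T -> R)) (Bd : R).
Hypothesis Bd_gt0 : 0 < Bd.
Hypothesis K_meas : forall U, K U -> forall j, measurable_fun D (U j).
Hypothesis K_bnd : forall U, K U -> forall j,
  {ae mu, forall x, D x -> `|U j x| <= Bd}.
Hypothesis K_conv : forall U V t, K U -> K V -> 0 <= t -> t <= 1 ->
  K (fun j x => (1 - t) * U j x + t * V j x).

Definition to2 (W : nat -> J -> T -> R) (Z : J -> T -> R) :=
  forall e : R, 0 < e -> exists n, forall k, (n <= k)%N -> forall j,
    nm2 (fun x => W k j x - Z j x) <= e.

Hypothesis K_closed : forall (W : nat -> J -> T -> R) Z,
  (forall n, K (W n)) -> (forall j, L2 (Z j)) -> to2 W Z -> K Z.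

Lemma KL2 U : K U -> forall j, L2 (U j).
Proof. by move=> KU j; apply: (L2_bnd mD fD (K_meas KU j)); exact: K_bnd. Qed.

Definition NQ (U : J -> T -> R) := \sum_j I (fun x => U j x ^+ 2).

Lemma NQ_ge0 U : 0 <= NQ U.
Proof. by apply: sumr_ge0 => j _; exact: I2_ge0. Qed.

Lemma nm2_NQ U j : nm2 (U j) ^+ 2 <= NQ U.
Proof.
rewrite nm2K /NQ (bigD1 j)//= lerDl; apply: sumr_ge0 => i _; exact: I2_ge0.
Qed.

Lemma K_I2 U j : K U -> I (fun x => U j x ^+ 2) <= Bd ^+ 2 * I (fun=> 1).
Proof.
move=> KU; rewrite -RIZ//; last exact: intg_cst.
apply: RI_le_ae => //; [exact: L2_sqr (KL2 KU j)|exact/intgZ/intg_cst|].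
apply: filterS (K_bnd KU j) => x h Dx; rewrite mulr1.
by rewrite -(real_normK (num_real (U j x))) lerXn2r ?nnegrE ?h// ltW.
Qed.

Lemma K_NQ U : K U -> NQ U <= #|J|%:R * (Bd ^+ 2 * I (fun=> 1)).
Proof.
move=> KU; rewrite /NQ; apply: le_trans (ler_sum _ (fun j _ => K_I2 j KU)) _.
by rewrite sumr_const mulr_natl.
Qed.

Definition mid (U V : J -> T -> R) j x := (1 - 2^-1) * U j x + 2^-1 * V j x.

Lemma mid_K U V : K U -> K V -> K (mid U V).
Proof. by move=> KU KV; apply: K_conv => //; rewrite ?invr_ge0// invf_le1// ler1n. Qed.

Lemma parallelogram U V : K U -> K V ->
  NQ (fun j x => U j x - V j x) = 2 * NQ U + 2 * NQ V - 4 * NQ (mid U V).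
Proof.
move=> KU KV; rewrite /NQ !mulr_sumr -big_split/= -sumrB; apply: eq_bigr => j _.
have hU := KL2 KU j; have hV := KL2 KV j; have hM := KL2 (mid_K KU KV) j.
rewrite -!RIZ//; [|exact: L2_sqr..].
rewrite -RID//; [|by igr..].
rewrite -RIB//; [|by igr..].
by apply: eq_Rintegral => x _; rewrite /mid; field.
Qed.

(* Weak compactness of K without weak topologies: near-minimizers of the norm
   over a decreasing sequence of convex sets form a Cauchy sequence. *)
Lemma nested_convex (U : nat -> J -> T -> R) (G : nat -> R -> set (J -> T -> R)) :
  (forall n, K (U n)) ->
  (forall n e V W, K V -> K W -> G n e V -> G n e W -> G n e (mid V W)) ->
  (forall n e W Z, (forall k, K (W k)) -> K Z -> to2 W Z ->
     (forall k, (n <= k)%N -> G n e (W k)) -> G n e Z) ->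
  exists2 Z, K Z & forall n e, (forall m, (n <= m)%N -> G n e (U m)) -> G n e Z.
Proof.
move=> KU Gmid Gcl.
(* [C n] stands in for the closed convex hull of the tail of [U]: it keeps the properties of rank n0
   at most n that hold for all [U m] with m at least n0. It contains the tail, decreases with n and
   is stable under midpoints. *)
pose C n := [set W | K W /\ forall n0 e, (n0 <= n)%N ->
  (forall m, (n0 <= m)%N -> G n0 e (U m)) -> G n0 e W].
have CU n m : (n <= m)%N -> C n (U m).
  by move=> nm; split => // n0 e n0n; apply; exact: leq_trans nm.
have Cdec n m : (n <= m)%N -> C m `<=` C n.
  by move=> nm W [KW h]; split => // n0 e n0n; apply: h; exact: leq_trans nm.
have Cmid n V W : C n V -> C n W -> C n (mid V W).
  move=> [KV hV] [KW hW]; split; first exact: mid_K.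
  by move=> n0 e n0n h; apply: Gmid => //; [exact: hV|exact: hW].
pose q n := inf (NQ @` C n).
have hinf n : has_inf (NQ @` C n).
  split; first by exists (NQ (U n)), (U n) => //; exact: CU.
  by exists 0 => _ [W _ <-]; exact: NQ_ge0.
have qle n W : C n W -> q n <= NQ W.
  by move=> CW; apply: ge_inf; [case: (hinf n)|exists W].
have qmono n m : (n <= m)%N -> q n <= q m.
  move=> nm; apply: lb_le_inf; first by case: (hinf m).
  by move=> _ [W CW <-]; apply: qle; exact: Cdec CW.
have hB n : q n <= #|J|%:R * (Bd ^+ 2 * I (fun=> 1)).
  by apply: le_trans (qle n _ (CU n n (leqnn n))) _; exact: K_NQ.
have hsup : has_sup (range q).
  split; first by exists (q 0%N), 0%N.
  by exists (#|J|%:R * (Bd ^+ 2 * I (fun=> 1))) => _ [n _ <-].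
pose l := sup (range q).
have ql n : q n <= l by apply: ub_le_sup; [case: hsup|exists n].
have exW n : exists W, C n W /\ NQ W <= q n + n.+1%:R^-1.
  have n0 : 0 < n.+1%:R^-1 :> R by rewrite invr_gt0.
  have [_ [W CW <-] hW] := inf_adherent n0 (hinf n); exists W; split => //; exact: ltW.
have [W hW] := choice exW.
have WC n : C n (W n) by case: (hW n).
have KW n : K (W n) by case: (WC n).
have cau (e : R) : 0 < e -> exists n, forall p r, (n <= p)%N -> (n <= r)%N ->
    NQ (fun j x => W p j x - W r j x) <= e.
  (* The squared norms of the two near-minimizers are at most l + e / 8 and that of their midpoint
     is at least l - e / 8, so the parallelogram identity leaves eight times e / 8. *)
  move=> e0; have e4 : 0 < e / 8 by rewrite divr_gt0.
  have [_ [n1 _ <-] hn1] := sup_adherent e4 hsup.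
  have [n2 hn2] : exists n2, n2.+1%:R^-1 <= e / 8.
    have e8 : 0 < e / 8 by rewrite divr_gt0.
    exists (Num.truncn (e / 8)^-1); rewrite invf_ple ?posrE// ltW// truncnS_gt//.
  exists (maxn n1 n2) => p r; rewrite !geq_max => /andP[p1 p2] /andP[r1 r2].
  rewrite parallelogram//.
  have hm : q n1 <= NQ (mid (W p) (W r)).
    by apply: qle; apply: Cmid; [exact: Cdec (WC p)|exact: Cdec (WC r)].
  have [_ hp] := hW p; have [_ hr] := hW r.
  have ql1 := ql p; have ql2 := ql r.
  have ip m : (n2 <= m)%N -> m.+1%:R^-1 <= e / 8.
    move=> nm; apply: le_trans hn2; rewrite lef_pV2 ?posrE//.
    by rewrite ler_nat.
  have ip1 := ip _ p2; have ip2 := ip _ r2.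
  have hn1' : l - e / 8 < q n1 by exact: hn1.
  have := ql n1.
  move: hp hr ip1 ip2; move: (p.+1%:R^-1 : R) (r.+1%:R^-1 : R) => a b.
  move: hm hn1' ql1 ql2; rewrite /=.
  move: (NQ _) (NQ _) (NQ _) (q n1) (q p) (q r) => x y z u v w; lra.
have cauj j (e : R) : 0 < e -> exists n, forall p r, (n <= p)%N -> (n <= r)%N ->
    nm2 (fun x => W p j x - W r j x) <= e.
  move=> e0; have [n hn] := cau (e ^+ 2) (exprn_gt0 2 e0).
  exists n => p r np nr; rewrite -(@ler_pXn2r _ 2)// ?nnegrE ?nm2_ge0 ?(ltW e0)//.
  exact: le_trans (nm2_NQ (fun j x => W p j x - W r j x) j) (hn _ _ np nr).
have exZ j : exists f, L2 f /\ forall e : R, 0 < e -> exists n, forall p, (n <= p)%N ->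
     nm2 (fun x => W p j x - f x) <= e.
  have [||f hf1 hf2] := @L2_complete _ _ _ mu D mD fD (fun k => W k j).
  - by move=> k; exact: KL2.
  - exact: cauj.
  - by exists f.
have [Z hZ] := choice exZ.
have WZ : to2 W Z.
  move=> e e0; have [N hN] := choice (fun j => (hZ j).2 e e0).
  exists (\max_j N j)%N => k hk j; apply: hN; apply: leq_trans hk.
  exact: leq_bigmax.
have KZ : K Z by apply: K_closed WZ => // j; case: (hZ j).
exists Z => // n e h; apply: (Gcl n e W Z KW KZ WZ) => k nk.
by case: (WC k) => _; apply.
Qed.

(** The denominator c + 1 lets a tolerance be divided by a norm that may vanish. *)
Lemma frac_le (c e : R) : 0 <= c -> 0 < e -> c * (e / (c + 1)) <= e.
Proof.
move=> c0 e0; rewrite mulrA ler_pdivrMr ?ltr_wpDl//.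
by rewrite mulrC ler_pM2l// lerDl.
Qed.

Lemma to2_L1 W Z j : (forall k, K (W k)) -> K Z -> to2 W Z ->
  forall e : R, 0 < e -> exists n, forall k, (n <= k)%N ->
    I (fun x => `|W k j x - Z j x|) <= e.
Proof.
move=> KW KZ h e e0; have c0 := nm2_ge0 mu D (fun=> 1 : R).
have [n hn] := h (e / (nm2 (fun=> 1) + 1)) (divr_gt0 e0 (ltr_wpDl c0 ltr01)).
exists n => k nk; apply: le_trans (L1_nm2 mD fD _) _.
  by apply: L2B => //; exact: KL2.
apply: le_trans (ler_wpM2r c0 (hn k nk j)) _.
by rewrite mulrC; exact: frac_le.
Qed.

Lemma to2_I W Z j h : L2 h -> (forall k, K (W k)) -> K Z -> to2 W Z ->
  forall e : R, 0 < e -> exists n, forall k, (n <= k)%N ->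
    `|I (fun x => h x * W k j x) - I (fun x => h x * Z j x)| <= e.
Proof.
move=> hh KW KZ WZ e e0; have c0 := nm2_ge0 mu D h.
have [n hn] := WZ (e / (nm2 h + 1)) (divr_gt0 e0 (ltr_wpDl c0 ltr01)).
exists n => k nk.
have lW := KL2 (KW k) j; have lZ := KL2 KZ j.
rewrite -RIB//; [|by igr..].
rewrite (_ : I (fun x => h x * W k j x - h x * Z j x) = I (fun x => h x * (W k j x - Z j x))); last first.
  by apply: eq_Rintegral => x _; rewrite mulrBr.
apply: le_trans (cauchy_schwarz mD hh _) _; first exact: L2B.
apply: le_trans (ler_wpM2l c0 (hn k nk j)) _.
exact: frac_le.
Qed.

Section minimization.
Variables (c : J -> R) (H : J -> T -> R).
Hypotheses (c_gt0 : forall j, 0 < c j) (H_L2 : forall j, L2 (H j)).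

Let E (U : J -> T -> R) := \sum_j (c j / 2 * I (fun x => U j x ^+ 2) - I (fun x => H j x * U j x)).

(** The direct method, with [nested_convex] in place of weak compactness: the limit lies in every
    sublevel set of [E] that contains a tail of a minimizing sequence. The conclusion is the
    first-order condition along segments of [K]. *)
Lemma minimizer : (exists U, K U) -> exists2 U, K U &
  forall V, K V -> 0 <= \sum_j I (fun x => (c j * U j x - H j x) * (V j x - U j x)).
Proof.
move=> [U0 KU0].
(* Complete the square in each component; the remainder is (c U - H)^2 / (2 c). *)
have Elb U : K U -> - \sum_j I (fun x => H j x ^+ 2) / (2 * c j) <= E U.
  move=> KU; rewrite -sumrN; apply: ler_sum => j _.
  have cj := c_gt0 j; have lU := KL2 KU j; have lH := H_L2 j.
  have -> : - (I (fun x => H j x ^+ 2) / (2 * c j)) = - (2 * c j)^-1 * I (fun x => H j x ^+ 2).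
    by rewrite mulNr mulrC.
  rewrite -!RIZ//; [|by igr..]; rewrite -RIB//; [|by igr..].
  apply: RI_le; [by igr|by igr|by igr|]; move=> x _.
  rewrite -subr_ge0 (_ : _ - _ = (c j * U j x - H j x) ^+ 2 / (2 * c j)).
    by rewrite divr_ge0 ?sqr_ge0// mulr_ge0// ltW.
  by field; rewrite gt_eqF.
have hinf : has_inf (E @` K).
  split; first by exists (E U0), U0.
  by exists (- \sum_j I (fun x => H j x ^+ 2) / (2 * c j)) => _ [U KU <-]; exact: Elb.
pose m := inf (E @` K).
have mle U : K U -> m <= E U by move=> KU; apply: ge_inf; [case: hinf|exists U].
have exU n : exists U, K U /\ E U <= m + n.+1%:R^-1.
  have n0 : 0 < n.+1%:R^-1 :> R by rewrite invr_gt0.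
  have [_ [U KU <-] hU] := inf_adherent n0 hinf; exists U; split => //; exact: ltW.
have [U hU] := choice exU.
have Emid e V W : K V -> K W -> E V <= e -> E W <= e -> E (mid V W) <= e.
  move=> KV KW hV hW; suff h : E (mid V W) <= 2^-1 * E V + 2^-1 * E W by lra.
  rewrite /E !mulr_sumr -big_split/=; apply: ler_sum => j _.
  have cj := c_gt0 j; have lV := KL2 KV j; have lW := KL2 KW j.
  have lH := H_L2 j; have lM := KL2 (mid_K KV KW) j.
  rewrite -!RIZ//; [|by igr..]; rewrite -!RIB//; [|by igr..].
  rewrite -!RIZ//; [|by igr..]; rewrite -!RID//; [|by igr..].
  apply: RI_le; [by igr|by igr|by igr|]; move=> x _.
  rewrite -subr_ge0 /mid (_ : _ - _ = c j / 8 * (V j x - W j x) ^+ 2); last by field.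
  by rewrite mulr_ge0 ?sqr_ge0// divr_ge0// ltW.
(* Lower semicontinuity: [E] lies above its tangent at [Z], and the slope c Z - H paired with W k -
   Z tends to 0. *)
have Ecl e W Z : (forall k, K (W k)) -> K Z -> to2 W Z ->
    (exists n, forall k, (n <= k)%N -> E (W k) <= e) -> E Z <= e.
  move=> KW KZ WZ [n hn].
  have conv (a : J -> T -> R) : (forall j, L2 (a j)) -> forall r : R, 0 < r ->
     exists n, forall k, (n <= k)%N -> `|\sum_j (I (fun x => a j x * W k j x) - I (fun x => a j x * Z j x))| <= r.
    move=> ha r r0.
    have J0 : 0 < r / (#|J|%:R + 1) by rewrite divr_gt0// ltr_wpDl.
    have [N hN] := choice (fun j => to2_I j (ha j) KW KZ WZ J0).
    exists (\max_j N j)%N => k hk; apply: le_trans (ler_norm_sum _ _ _) _.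
    apply: (@le_trans _ _ (\sum_(j : J) r / (#|J|%:R + 1))).
      by apply: ler_sum => j _; apply: hN; apply: leq_trans hk; exact: leq_bigmax.
    by rewrite sumr_const -[leLHS]mulr_natl; exact: frac_le.
  apply/ler_addgt0Pr => r r0.
  have hcZ j : L2 (fun x => c j * Z j x - H j x).
    by apply: L2B => //; apply: L2Z => //; exact: KL2.
  have [n1 hn1] := conv (fun j x => c j * Z j x - H j x) hcZ r r0.
  have := hn (maxn n n1) (leq_maxl _ _); have := hn1 (maxn n n1) (leq_maxr _ _).
  set k := maxn n n1; rewrite ler_norml => /andP[hl _] hE.
  suff : E Z <= E (W k) - \sum_j (I (fun x => (c j * Z j x - H j x) * W k j x) - I (fun x => (c j * Z j x - H j x) * Z j x)) by lra.
  rewrite /E -sumrB; apply: ler_sum => j _.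
  have cj := c_gt0 j; have lW := KL2 (KW k) j; have lZ := KL2 KZ j.
  have lH := H_L2 j; have lcZ : L2 (fun x => c j * Z j x - H j x).
    by apply: L2B => //; exact: L2Z.
  rewrite -!RIZ//; [|by igr..]; rewrite -!RIB//; [|by igr..].
  apply: RI_le; [by igr|by igr|by igr|]; move=> x _.
  rewrite -subr_ge0 (_ : _ - _ = c j / 2 * (W k j x - Z j x) ^+ 2); last by field.
  by rewrite mulr_ge0 ?sqr_ge0// divr_ge0// ltW.
have [Z KZ hZ] := @nested_convex U (fun _ e V => E V <= m + e) (fun n => (hU n).1)
  (fun n e V W KV KW => Emid (m + e) V W KV KW)
  (fun n e W Z KW KZ WZ h => Ecl (m + e) W Z KW KZ WZ (ex_intro _ n h)).
have EZ : E Z <= m.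
  apply/ler_addgt0Pr => r r0; apply: (hZ (Num.truncn r^-1)) => k hk.
  apply: le_trans (hU k).2 _; rewrite lerD2l invf_ple ?posrE//.
  by apply: le_trans (ltW (truncnS_gt _)) _; rewrite ler_nat.
exists Z => // V KV; set A := \sum_j _.
(* [E] is quadratic, so its increment from [Z] at parameter t towards [V] is exactly t (A + t B). *)
pose B := \sum_j c j / 2 * I (fun x => (V j x - Z j x) ^+ 2).
have B0 : 0 <= B.
  by apply: sumr_ge0 => j _; rewrite mulr_ge0 ?I2_ge0// divr_ge0// ltW.
have key t : 0 < t -> t <= 1 -> 0 <= A + t * B.
  move=> t0 t1; have KT := K_conv KZ KV (ltW t0) t1.
  rewrite -(pmulr_rge0 _ t0).
  suff -> : t * (A + t * B) = E (fun j x => (1 - t) * Z j x + t * V j x) - E Z.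
    by rewrite subr_ge0; exact: le_trans EZ (mle _ KT).
  rewrite /A /B mulr_sumr -big_split/= mulr_sumr /E -sumrB; apply: eq_bigr => j _.
  have cj := c_gt0 j; have lV := KL2 KV j; have lZ := KL2 KZ j.
  have lH := H_L2 j; have lcZ : L2 (fun x => c j * Z j x - H j x).
    by apply: L2B => //; exact: L2Z.
  have lT := KL2 KT j; have lVZ : L2 (fun x => V j x - Z j x) by exact: L2B.
  do 3 (rewrite -?RIZ//; [|by igr..]; rewrite -?RIB//; [|by igr..]; rewrite -?RID//; [|by igr..]).
  by apply: eq_Rintegral => x _; field.
rewrite leNgt; apply/negP => A0.
(* For this t the product t B is smaller than - A / 2, so A + t B would be negative. *)
have t0 : 0 < - A / (2 * (B + 1 - A)) by rewrite divr_gt0; lra.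
have t1 : - A / (2 * (B + 1 - A)) <= 1 by rewrite ler_pdivrMr; lra.
have := key _ t0 t1; set t := _ / _.
have tE : t * (2 * (B + 1 - A)) = - A by rewrite /t; field; lra.
nra.
Qed.

End minimization.
End convex_sets.

(** * The hyperbolic tangent and the decay of its derivative *)

Section tanh.
Context {R : realType}.
Implicit Types s t : R.

Definition tanh s : R := 1 - 2 / (expR (2 * s) + 1).

Let den_gt0 s : 0 < expR (2 * s) + 1.
Proof. by rewrite addr_gt0// expR_gt0. Qed.

Lemma tanh_lt1 s : tanh s < 1.
Proof. by rewrite /tanh ltrBlDr ltrDl divr_gt0. Qed.

Lemma tanhN s : tanh (- s) = - tanh s.
Proof.
rewrite /tanh mulrN expRN; have := expR_gt0 (2 * s); set e := expR _ => e0.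
by field; rewrite !gt_eqF// ?addr_gt0.
Qed.

Lemma tanh0 : tanh 0 = 0.
Proof. by have := tanhN 0; rewrite oppr0; lra. Qed.

Lemma tanh_norm s : `|tanh s| <= 1.
Proof.
rewrite ler_norml (ltW (tanh_lt1 s)) andbT lerNl -tanhN; exact/ltW/tanh_lt1.
Qed.

Lemma dtanh_ge0 s : 0 <= 1 - tanh s ^+ 2.
Proof. by have := tanh_norm s; rewrite ler_norml => /andP[]; nra. Qed.

Lemma dtanh_le1 s : 1 - tanh s ^+ 2 <= 1.
Proof. by rewrite gerBl sqr_ge0. Qed.

(** Everything follows from (1 + s)^2 <= exp (2 s): with q = 2 / (exp (2 s) + 1) it gives s q <= 1
    and s^2 q <= 2, while tanh s = 1 - q and 1 - tanh^2 = q (2 - q) <= 2 q. *)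
Let tanh_pos s : 0 <= s ->
  [/\ 0 <= tanh s, s - 1 <= s * tanh s, s * (1 - tanh s ^+ 2) <= 4 & s ^+ 2 * (1 - tanh s ^+ 2) <= 4].
Proof.
move=> s0; have h1 := expR_ge1Dx s.
have h2 : (1 + s) ^+ 2 <= expR (2 * s).
  rewrite (_ : 2 * s = s + s); last by ring.
  by rewrite expRD expr2; nra.
set e := expR (2 * s) in h2 *.
have e0 : 0 < e + 1 by exact: den_gt0.
have -> : tanh s = 1 - 2 / (e + 1) by [].
have q0 : 0 < 2 / (e + 1) by rewrite divr_gt0.
have q1 : 2 / (e + 1) <= 1 by rewrite ler_pdivrMr//; nra.
have qs : s * (2 / (e + 1)) <= 1 by rewrite mulrA ler_pdivrMr//; nra.
have qs2 : s ^+ 2 * (2 / (e + 1)) <= 2 by rewrite mulrA ler_pdivrMr//; nra.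
set q := 2 / (e + 1) in q0 q1 qs qs2 *.
have -> : 1 - (1 - q) ^+ 2 = q * (2 - q) by ring.
have sq0 : 0 <= s * q by rewrite mulr_ge0// ltW.
have s2q0 : 0 <= s ^+ 2 * q by rewrite mulr_ge0 ?sqr_ge0// ltW.
split; [lra|nra| |]; rewrite mulrA; nra.
Qed.

Lemma tanh_sign s : 0 <= s * tanh s.
Proof.
have [s0|/ltW s0] := leP 0 s; first by have [h _ _ _] := tanh_pos s0; rewrite mulr_ge0.
by rewrite -mulrNN -tanhN mulr_ge0 ?oppr_ge0//; have [] := @tanh_pos (- s); rewrite ?oppr_ge0.
Qed.

(** At s = w / e it reads |w| - e <= w tanh(w / e): the smooth sign recovers |w| up to e. *)
Lemma tanh_abs s : `|s| - 1 <= s * tanh s.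
Proof.
have [s0|/ltW s0] := leP 0 s; first by have [_ h _ _] := tanh_pos s0; rewrite ger0_norm.
have := @tanh_pos (- s); rewrite oppr_ge0 => /(_ s0)[_ h _ _]; rewrite ler0_norm// -mulrNN -tanhN; exact: h.
Qed.

Lemma dtanh_decay1 s : `|s| * (1 - tanh s ^+ 2) <= 4.
Proof.
have [s0|/ltW s0] := leP 0 s; first by have [_ _ h _] := tanh_pos s0; rewrite ger0_norm.
have := @tanh_pos (- s); rewrite oppr_ge0 => /(_ s0)[_ _ h _]; rewrite ler0_norm// -(sqrrN (tanh s)) -tanhN; exact: h.
Qed.

Lemma dtanh_decay2 s : s ^+ 2 * (1 - tanh s ^+ 2) <= 4.
Proof.
have [s0|/ltW s0] := leP 0 s; first by have [_ _ _ h] := tanh_pos s0.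
have := @tanh_pos (- s); rewrite oppr_ge0 => /(_ s0)[_ _ _ h]; rewrite -(sqrrN (tanh s)) -tanhN -(sqrrN s); exact: h.
Qed.

Lemma continuous_tanh : continuous tanh.
Proof.
move=> s; apply: cvgB; first exact: cvg_cst.
apply: cvgM; first exact: cvg_cst.
apply: cvgV; first by rewrite gt_eqF// den_gt0.
apply: cvgD; last exact: cvg_cst.
apply: continuous_comp; last exact: continuous_expR.
by apply: cvgM; [exact: cvg_cst|exact: cvg_id].
Qed.

End tanh.

(** * The abstract variational inequality *)

Section variational_inequality.
Context d (T : measurableType d) (R : realType).
Variables (mu : {measure set T -> \bar R}) (D : set T).
Hypotheses (mD : measurable D) (fD : (mu D < +oo)%E).
Local Notation I f := (\int[mu]_(x in D) f x).
Local Notation intg := (intg mu D).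
Local Notation L2 := (L2 mu D).
Local Notation nm2 := (nm2 mu D).

Variables (J : finType) (j0 : J) (K : set (J -> T -> R)) (Bd : R).
Hypothesis Bd_gt0 : 0 < Bd.
Hypothesis K_neq0 : exists U, K U.
Hypothesis K_meas : forall U, K U -> forall j, measurable_fun D (U j).
Hypothesis K_bnd : forall U, K U -> forall j,
  {ae mu, forall x, D x -> `|U j x| <= Bd}.
Hypothesis K_conv : forall U V t, K U -> K V -> 0 <= t -> t <= 1 ->
  K (fun j x => (1 - t) * U j x + t * V j x).
Hypothesis K_closed : forall (W : nat -> J -> T -> R) Z,
  (forall n, K (W n)) -> (forall j, L2 (Z j)) -> to2 mu D W Z -> K Z.
Hypothesis K_trunc : forall U V e, K U -> K V -> 0 < e -> exists2 Z, K Z &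
  {ae mu, forall x, D x -> Z j0 x = U j0 x - e * tanh ((U j0 x - V j0 x) / e) /\
    forall j, j != j0 -> Z j x =
      U j x - (1 - tanh ((U j0 x - V j0 x) / e) ^+ 2) * (U j x - V j x)}.

Variables (F : J -> T -> R -> R) (C L m0 : R).
Hypotheses (C_gt0 : 0 < C) (L_gt0 : 0 < L) (m0_gt0 : 0 < m0).
Hypothesis F_meas : forall U, K U -> forall j, measurable_fun D (fun x => F j x (U j0 x)).
Hypothesis F_bnd : forall j x t, D x -> `|t| <= Bd -> `|F j x t| <= C.
Hypothesis F_lip : forall j x s t, D x -> `|s| <= Bd -> `|t| <= Bd ->
  `|F j x s - F j x t| <= L * `|s - t|.
Hypothesis F_mono : forall x s t, D x -> `|s| <= Bd -> `|t| <= Bd ->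
  m0 * (s - t) ^+ 2 <= (F j0 x s - F j0 x t) * (s - t).

Let KL2 U (KU : K U) j := @KL2 _ _ _ _ _ mD fD _ _ _ K_meas K_bnd U KU j.

Let FL2 U j : K U -> L2 (fun x => F j x (U j0 x)).
Proof.
move=> KU; apply: (L2_bnd mD fD (F_meas KU j)).
by apply: filterS (K_bnd KU j0) => x h Dx; exact: F_bnd Dx (h Dx).
Qed.

(** The field [A] is passed already evaluated; a nonlinear problem is obtained by letting [A] depend
    on [U], as in [oper c H U]. *)
Definition VI (A U : J -> T -> R) :=
  forall V, K V -> 0 <= \sum_j I (fun x => A j x * (V j x - U j x)).

(* The regularized operator: c j0 is the zeroth order coefficient, the other
   c j are viscosities. *)
Definition oper (c : J -> R) (H U : J -> T -> R) j x :=
  c j * U j x + F j x (U j0 x) - H j x.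

Let operL2 c H U j : (forall j, L2 (H j)) -> K U -> L2 (oper c H U j).
Proof.
move=> hH KU; apply: L2B => //; apply: L2D => //; last exact: FL2.
by apply: L2Z => //; exact: KL2.
Qed.

Let ip c H U V W j : (forall j, L2 (H j)) -> K U -> K V -> K W ->
  intg (fun x => oper c H U j x * (V j x - W j x)).
Proof.
move=> hH KU KV KW; apply: L2mul => //; [exact: operL2|apply: L2B => //; exact: KL2].
Qed.

(* Test with U - e tanh((U - U') / e) and U' + e tanh((U - U') / e).  For
   e -> 0 the terms with j <> j0 vanish, since s (1 - tanh(s)^2) is bounded and
   tends to 0 at infinity. *)
Lemma comparison c H H' U U' : (forall j, 0 <= c j) ->
  (forall j, L2 (H j)) -> (forall j, L2 (H' j)) ->
  (forall j, j != j0 -> H j = H' j) ->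
  K U -> K U' -> VI (oper c H U) U -> VI (oper c H' U') U' ->
  (c j0 + m0) * I (fun x => `|U j0 x - U' j0 x|) <= I (fun x => `|H j0 x - H' j0 x|).
Proof.
move=> c0 hH hH' HH KU KU' vU vU'.
pose w x := U j0 x - U' j0 x.
have lw : L2 w by apply: L2B => //; exact: KL2.
have mw : measurable_fun D w := L2_meas lw.
pose b e x := 1 - tanh (w x / e) ^+ 2.
pose err e x := `|w x / e| * b e x.
have mt e : measurable_fun D (fun x => tanh (w x / e)).
  apply: (measurableT_comp (continuous_measurable_fun continuous_tanh)).
  by apply: measurable_funM => //; exact: measurable_cst.
have merr e : measurable_fun D (err e).
  apply: measurable_funM.
    by apply: measurableT_comp => //; apply: measurable_funM => //; exact: measurable_cst.
  by apply: measurable_funB; [exact: measurable_cst|exact: measurable_funX].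
have ierr e : intg (err e).
  apply: (@intg_le _ _ _ _ _ mD _ (fun=> 4)) => //; first exact: intg_cst.
  by move=> x Dx; rewrite /err ger0_norm ?mulr_ge0 ?dtanh_ge0// dtanh_decay1.
have m1 : 0 <= I (fun=> 1) by apply: Rintegral_ge0.
(* Lipschitz constant times the bound 2 Bd for the difference of two components, once for each
   index. *)
pose Q := #|J|%:R * (L * (2 * Bd)).
have Q0 : 0 <= Q by rewrite /Q !mulr_ge0// ltW.
have ibw := intg_norm mD (L2_intg mD fD lw).
have iH := intg_norm mD (L2_intg mD fD (L2B mD (hH j0) (hH' j0))).
have key e : 0 < e -> (c j0 + m0) * (I (fun x => `|w x|) - e * I (fun=> 1)) <=
    I (fun x => `|H j0 x - H' j0 x|) + Q * I (err e).
  move=> e0.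
  have [Z KZ hZ] := K_trunc KU KU' e0.
  have [Z' KZ' hZ'] := K_trunc KU' KU e0.
  have ie := ierr e; have h1 := vU Z KZ; have h2 := vU' Z' KZ'.
  (* The inequality is multiplied by e, the size of the perturbations of the component [j0], so that
     the integrands can be compared pointwise. *)
  rewrite -(ler_pM2l e0).
  have {h1 h2} : 0 <= I (fun x => \sum_j (oper c H U j x * (Z j x - U j x) + oper c H' U' j x * (Z' j x - U' j x))).
    rewrite RIsum//; last by move=> j; apply: intgD => //; exact: ip.
    rewrite (eq_bigr _ (fun j _ => RID mD (@ip c H U Z U j hH KU KZ KU) (@ip c H' U' Z' U' j hH' KU' KZ' KU'))).
    by rewrite big_split/= addr_ge0.
  set X := I _ => X0; rewrite -subr_ge0; apply: (le_trans X0); rewrite {X0}/X.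
  rewrite -!RIZ//; [|by igr..]; rewrite -RIB//; [|by igr..].
  rewrite -RID//; [|by igr..]; rewrite -!RIZ//; [|by igr..].
  rewrite -RIB//; [|by igr..].
  apply: RI_le_ae => //.
  - by apply: intg_sum => // j; apply: intgD => //; exact: ip.
  - by igr.
  have aeB U1 : K U1 -> {ae mu, forall x, D x -> forall j, `|U1 j x| <= Bd}.
    by move=> KU1; apply: ae_all => j; exact: K_bnd.
  near=> x => Dx.
  have [hz0 hz] : Z j0 x = U j0 x - e * tanh ((U j0 x - U' j0 x) / e) /\
    forall j, j != j0 -> Z j x = U j x - (1 - tanh ((U j0 x - U' j0 x) / e) ^+ 2) * (U j x - U' j x).
    by move: Dx; near: x.
  have [hz0' hz'] : Z' j0 x = U' j0 x - e * tanh ((U' j0 x - U j0 x) / e) /\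
    forall j, j != j0 -> Z' j x = U' j x - (1 - tanh ((U' j0 x - U j0 x) / e) ^+ 2) * (U' j x - U j x).
    by move: Dx; near: x.
  have bU : forall j, `|U j x| <= Bd by move: Dx; near: x; exact: aeB.
  have bU' : forall j, `|U' j x| <= Bd by move: Dx; near: x; exact: aeB.
  have tN : tanh ((U' j0 x - U j0 x) / e) = - tanh (w x / e).
    by rewrite -tanhN /w -mulNr opprB.
  rewrite tN in hz0' hz'; rewrite -/(w x) in hz0 hz.
  rewrite (bigD1 j0)//= hz0 hz0' /oper.
  have t1 := tanh_abs (w x / e); have t2 := tanh_norm (w x / e).
  have Fm := F_mono Dx (bU j0) (bU' j0).
  have b0 : 0 <= b e x := dtanh_ge0 _.
  set th := tanh (w x / e) in t1 t2 hz hz' tN *.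
  have ew : e * (w x / e) = w x by field; rewrite gt_eqF.
  (* For j <> j0 the two inequalities add up to - c j b wj^2 - df b wj. The viscosity has the good
     sign, and |df| <= L |w| with |w| b = e [err]. *)
  have sum_le : \sum_(j | j != j0) ((c j * U j x + F j x (U j0 x) - H j x) * (Z j x - U j x) +
      (c j * U' j x + F j x (U' j0 x) - H' j x) * (Z' j x - U' j x)) <= e * (Q * err e x).
    apply: (@le_trans _ _ (\sum_(j : J | j != j0) L * (2 * Bd) * (e * err e x))).
      apply: ler_sum => j jj0; rewrite hz// hz'// sqrrN -/th HH//.
      have -> : 1 - th ^+ 2 = b e x by [].
      set wj := U j x - U' j x; have wjE : U' j x - U j x = - wj by rewrite /wj opprB.
      rewrite wjE.
      set df := F j x (U j0 x) - F j x (U' j0 x).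
      rewrite (_ : _ + _ = - c j * (b e x * wj ^+ 2) - df * (b e x * wj)); last by rewrite /df /wj; ring.
      have p1 : 0 <= c j * (b e x * wj ^+ 2) := mulr_ge0 (c0 j) (mulr_ge0 b0 (sqr_ge0 _)).
      have hdf : `|df| <= L * `|w x| := F_lip j Dx (bU j0) (bU' j0).
      have hwj : `|wj| <= 2 * Bd.
        by rewrite /wj; apply: le_trans (ler_normB _ _) _; have := bU j; have := bU' j; lra.
      have p2 : - (df * (b e x * wj)) <= L * `|w x| * (b e x * (2 * Bd)).
        apply: le_trans (ler_norm _) _; rewrite normrN !normrM (ger0_norm b0).
        by apply: ler_pM => //; [rewrite mulr_ge0|apply: ler_wpM2l].
      have -> : e * err e x = `|w x| * b e x.
        rewrite /err normrM (gtr0_norm (_ : 0 < e^-1)) ?invr_gt0//; by field; rewrite gt_eqF.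
      nra.
    rewrite (_ : e * (Q * err e x) = #|J|%:R * (L * (2 * Bd) * (e * err e x))); last by rewrite /Q; ring.
    have y0 : 0 <= L * (2 * Bd) * (e * err e x).
      by rewrite /err !mulr_ge0// ltW.
    rewrite sumr_const -[leLHS]mulr_natl ler_wpM2r// ler_nat; exact: max_card.
  have hth : `|(H j0 x - H' j0 x) * th| <= `|H j0 x - H' j0 x| by rewrite normrM ler_piMr.
  have main : (c j0 + m0) * (`|w x| - e) <= (c j0 * w x + (F j0 x (U j0 x) - F j0 x (U' j0 x))) * th.
    have a1 : (c j0 + m0) * (`|w x| - e) <= (c j0 + m0) * (w x * th).
      apply: ler_wpM2l; first by rewrite addr_ge0// ltW.
      have : e * (`|w x / e| - 1) <= e * (w x / e * th) by rewrite ler_pM2l.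
      rewrite [leRHS]mulrA ew mulrBr mulr1 normrM (gtr0_norm (_ : 0 < e^-1)) ?invr_gt0//.
      by rewrite mulrCA divff ?gt_eqF// mulr1.
    apply: (le_trans a1).
    have s0 : 0 <= w x * th.
      have := mulr_ge0 (ltW e0) (tanh_sign (w x / e)); by rewrite mulrA ew.
    (* [F_mono] controls the product with w rather than with th. Since w th >= 0, multiplying by w^2
       converts one into the other. *)
    have a2 : m0 * (w x * th) <= (F j0 x (U j0 x) - F j0 x (U' j0 x)) * th.
      have [w0|w0] := eqVneq (w x) 0.
        by rewrite /th w0 !mul0r tanh0 !mulr0.
      have w20 : 0 < w x ^+ 2 by rewrite lt_def sqr_ge0 sqrf_eq0 w0.
      rewrite -(ler_pM2l w20).
      have : (w x * th) * (m0 * w x ^+ 2) <= (w x * th) * ((F j0 x (U j0 x) - F j0 x (U' j0 x)) * w x).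
        exact: ler_wpM2l.
      rewrite /w; lra.
    lra.
  have hth2 := ler_norm ((H j0 x - H' j0 x) * th).
  have hth3 := ler_wpM2l (ltW e0) (le_trans hth2 hth).
  move: sum_le; set SS := \sum_(j | _) _ => sum_le.
  have := ler_wpM2l (ltW e0) main; rewrite /w in hth3 sum_le *.
  move: hth3 sum_le; lra.
have lim : I (err n.+1%:R^-1) @[n --> \oo] --> 0.
  have -> : 0 = I (fun=> 0) :> R by rewrite Rintegral_cst// mul0r.
  apply: (RI_dct mD (fun n => merr n.+1%:R^-1) (measurable_cst _) (intg_cst mD fD 4)).
    apply: aeW => x Dx; have [w0|w0] := eqVneq (w x) 0.
      rewrite (_ : (fun n => _) = fun=> 0); first exact: cvg_cst.
      by apply/funext => n; rewrite /err w0 mul0r normr0 mul0r.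
    have aw : 0 < `|w x| by rewrite normr_gt0.
    apply: (@squeeze_cvgr _ _ _ _ (fun=> 0) (fun n => 4 / `|w x| * n.+1%:R^-1)).
    (* [dtanh_decay2] at s = (n + 1) w bounds [err] by 4 / ((n + 1) |w|). *)
    - apply: nearW => n; rewrite /err mulr_ge0 ?dtanh_ge0//= mulrAC ler_pdivlMr//.
      rewrite -mulrA mulrCA.
      have := dtanh_decay2 (w x / n.+1%:R^-1); rewrite -/(b _ x).
      rewrite -(real_normK (num_real (w x / _))) normrM.
      have n0 : 0 < n.+1%:R :> R by [].
      rewrite !invrK (gtr0_norm n0) => h.
      rewrite ler_pdivlMr//; apply: le_trans h; rewrite le_eqVlt; apply/orP; left; apply/eqP; ring.
    - exact: cvg_cst.
    - rewrite -[X in _ --> X](mulr0 (4 / `|w x|)); apply: cvgM; [exact: cvg_cst|exact: cvg_harmonic].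
  move=> n x Dx; rewrite /err ger0_norm ?mulr_ge0 ?dtanh_ge0// dtanh_decay1//.
have n0 n : 0 < n.+1%:R^-1 :> R by rewrite invr_gt0.
have lim1 : (c j0 + m0) * (I (fun x => `|w x|) - n.+1%:R^-1 * I (fun=> 1)) @[n --> \oo] -->
    (c j0 + m0) * (I (fun x => `|w x|) - 0 * I (fun=> 1)).
  apply: cvgM; first exact: cvg_cst.
  apply: cvgB; first exact: cvg_cst.
  by apply: cvgM; [exact: cvg_harmonic|exact: cvg_cst].
have lim2 : I (fun x => `|H j0 x - H' j0 x|) + Q * I (err n.+1%:R^-1) @[n --> \oo] -->
    I (fun x => `|H j0 x - H' j0 x|) + Q * 0.
  apply: cvgD; first exact: cvg_cst.
  by apply: cvgM; [exact: cvg_cst|exact: lim].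
have := ler_cvg_to lim1 lim2 (nearW _ (fun n => key _ (n0 n))).
by rewrite mul0r subr0 mulr0 addr0; apply; exact: _.
Unshelve. all: by end_near.
Qed.


Definition dL1 (U V : J -> T -> R) := I (fun x => `|U j0 x - V j0 x|).

Let idL1 U V : K U -> K V -> intg (fun x => `|U j0 x - V j0 x|).
Proof.
by move=> KU KV; apply: intg_norm => //; apply: L2_intg => //; apply: L2B => //; exact: KL2.
Qed.

Lemma dL1_ge0 U V : 0 <= dL1 U V.
Proof. exact: Rintegral_ge0. Qed.

Lemma dL1C U V : dL1 U V = dL1 V U.
Proof. by apply: eq_Rintegral => x _; rewrite distrC. Qed.

Lemma dL1_triangle V U W : K U -> K V -> K W -> dL1 U W <= dL1 U V + dL1 V W.
Proof.
move=> KU KV KW; have i1 := idL1 KU KV; have i2 := idL1 KV KW; have i3 := idL1 KU KW.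
rewrite /dL1 -RID//; apply: RI_le => //; first exact: intgD.
by move=> x _; exact: ler_distD.
Qed.

Lemma dL1_mid Z U V : K U -> K V -> K Z -> dL1 (mid U V) Z <= 2^-1 * dL1 U Z + 2^-1 * dL1 V Z.
Proof.
move=> KU KV KZ; have i1 := idL1 KU KZ; have i2 := idL1 KV KZ.
have i3 := idL1 (mid_K K_conv KU KV) KZ.
rewrite /dL1 -!RIZ//; rewrite -RID//; [|by igr..]; apply: RI_le => //; first by igr.
move=> x _; rewrite /mid (_ : _ - _ = 2^-1 * (U j0 x - Z j0 x) + 2^-1 * (V j0 x - Z j0 x)); last by field.
by apply: le_trans (ler_normD _ _) _; rewrite !normrM ger0_norm.
Qed.

Lemma to2_dL1 W Z : (forall k, K (W k)) -> K Z -> to2 mu D W Z ->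
  forall e : R, 0 < e -> exists n, forall k, (n <= k)%N -> dL1 (W k) Z <= e.
Proof. by move=> KW KZ WZ e e0; exact: (to2_L1 mD fD K_meas K_bnd j0 KW KZ WZ). Qed.

(** The balls of [dL1] around the [U m] are convex and closed in L2, so [nested_convex] yields a
    limit in [K]. Its components other than [j0] carry no information on the sequence. *)
Lemma L1_complete (U : nat -> J -> T -> R) : (forall n, K (U n)) ->
  (forall e : R, 0 < e -> exists n, forall p q, (n <= p)%N -> (n <= q)%N -> dL1 (U p) (U q) <= e) ->
  exists2 Z, K Z & forall e : R, 0 < e -> exists n, forall m, (n <= m)%N -> dL1 Z (U m) <= e.
Proof.
move=> KU cU.
have [||Z KZ hZ] := nested_convex mD fD Bd_gt0 K_meas K_bnd K_conv K_closed
  (G := fun n e W => forall m, (n <= m)%N -> dL1 W (U m) <= e) KU.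
- move=> n e V W KV KW hV hW m nm; apply: le_trans (dL1_mid KV KW (KU m)) _.
  by have := hV _ nm; have := hW _ nm; lra.
- move=> n e W Z KW KZ WZ h m nm; apply/ler_addgt0Pr => r r0.
  have [n1 hn1] := to2_dL1 KW KZ WZ r0.
  have := hn1 (maxn n n1) (leq_maxr _ _); have := h (maxn n n1) (leq_maxl _ _) m nm.
  have := dL1_triangle KZ (KW (maxn n n1)) (KU m); rewrite (dL1C Z (W _)); lra.
exists Z => // e e0; have [n hn] := cU e e0; exists n; apply: hZ => m nm p np.
exact: hn.
Qed.

(** Banach's fixed point theorem for a pseudometric that is uniformly equivalent to [dL1] on [K],
    since completeness is known for [dL1]. The conclusion is a vanishing distance and not an
    equality: [rho] may see only the component [j0], and only a.e. *)
Lemma fixpoint (rho : (J -> T -> R) -> (J -> T -> R) -> R) (r : R) S :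
  0 <= r -> r < 1 ->
  (forall U V, K U -> K V -> 0 <= rho U V) ->
  (forall U V, K U -> K V -> rho U V = rho V U) ->
  (forall U V W, K U -> K V -> K W -> rho U W <= rho U V + rho V W) ->
  (forall U, K U -> K (S U)) ->
  (forall U V, K U -> K V -> rho (S U) (S V) <= r * rho U V) ->
  (forall e : R, 0 < e -> exists2 d : R, 0 < d & forall U V, K U -> K V -> rho U V <= d -> dL1 U V <= e) ->
  (forall e : R, 0 < e -> exists2 d : R, 0 < d & forall U V, K U -> K V -> dL1 U V <= d -> rho U V <= e) ->
  exists2 Z, K Z & rho Z (S Z) <= 0.
Proof.
move=> r0 r1 rho0 rhoC rho3 KS Sr toL1 fromL1.
have [U0 KU0] := K_neq0.
pose U n := iter n S U0.
have KU n : K (U n) by elim: n => //= n; exact: KS.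
have r10 : 0 < 1 - r by rewrite subr_gt0.
(* The geometric sum, in a form that is its own induction hypothesis: a + r a / (1 - r) = a / (1 -
   r). *)
have step V k : K V -> rho V (iter k.+1 S V) <= rho V (S V) / (1 - r).
  move=> KV; have KI m : K (iter m S V) by elim: m => //= m; exact: KS.
  have a0 := rho0 _ _ KV (KS _ KV).
  elim: k => [|k ih].
    rewrite /= ler_pdivlMr// -[leRHS]mulr1; apply: ler_wpM2l => //; lra.
  apply: le_trans (rho3 _ _ _ KV (KS _ KV) (KI k.+2)) _.
  have h : rho (S V) (iter k.+2 S V) <= r * (rho V (S V) / (1 - r)).
    by apply: le_trans (Sr _ _ KV (KI k.+1)) _; exact: ler_wpM2l.
  apply: le_trans (lerD (lexx _) h) _.
  by rewrite le_eqVlt; apply/orP; left; apply/eqP; field; rewrite gt_eqF.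
have geo n : rho (U n) (U n.+1) <= r ^+ n * rho (U 0%N) (U 1%N).
  elim: n => [|n ih]; first by rewrite expr0 mul1r.
  apply: le_trans (Sr _ _ (KU n) (KU n.+1)) _.
  by rewrite exprS -mulrA; exact: ler_wpM2l.
have a0 := rho0 _ _ (KU 0%N) (KU 1%N).
have rn : r ^+ n @[n --> \oo] --> 0 by apply: cvg_expr; rewrite ger0_norm.
have small (e : R) : 0 < e -> exists n, forall m, (n <= m)%N -> r ^+ m * (rho (U 0%N) (U 1%N) / (1 - r)) <= e.
  move=> e0; set a := _ / _; have aa0 : 0 <= a by rewrite divr_ge0// ltW.
  have d0 : 0 < e / (a + 1) by rewrite divr_gt0// ltr_wpDl.
  have [n _ hn] := (cvgrPdist_le _ _).1 rn _ d0.
  exists n => m nm; have := hn m nm; rewrite /= sub0r normrN ger0_norm ?exprn_ge0// => h.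
  by apply: le_trans (ler_wpM2r aa0 h) _; rewrite mulrC; exact: frac_le.
have [Z KZ hZ] : exists2 Z, K Z & forall e : R, 0 < e -> exists n, forall m, (n <= m)%N -> dL1 Z (U m) <= e.
  apply: L1_complete => // e e0; have [r2 d0 hd] := toL1 e e0.
  have [n hn] := small r2 d0; exists n.
  have aux p q : (n <= p)%N -> (p < q)%N -> dL1 (U p) (U q) <= e.
    move=> np pq; apply: hd => //; apply: le_trans (hn p np).
    have -> : U q = iter (q - p).-1.+1 S (U p).
      by rewrite /U prednK ?subn_gt0// -iterD subnK// ltnW.
    apply: le_trans (step _ _ (KU p)) _; rewrite mulrA ler_wpM2r ?invr_ge0 ?(ltW r10)//.
  move=> p q np nq; have [pq|pq|->] := ltngtP p q; first exact: aux.
    by rewrite dL1C; exact: aux.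
  rewrite /dL1 (_ : (fun x => _) = fun=> 0); first by rewrite Rintegral_cst// mul0r ltW.
  by apply/funext => x; rewrite subrr normr0.
exists Z => //; apply/ler_addgt0Pr => e e0; rewrite add0r.
have e20 : 0 < e / 2 by rewrite divr_gt0.
have [r2 d0 hd] := fromL1 _ e20; have [n hn] := hZ r2 d0.
have h1 := hd _ _ KZ (KU n) (hn n (leqnn n)).
have h2 := hd _ _ KZ (KU n.+1) (hn n.+1 (leqnSn n)).
have := rho3 _ _ _ KZ (KU n.+1) (KS _ KZ).
have h3 := Sr _ _ (KU n) KZ; rewrite -/(U n.+1) in h3.
have := rho0 _ _ (KU n) KZ; rewrite (rhoC _ _ KZ (KU n)) in h1; nra.
Qed.

Lemma ae_of_I0 f : L2 f -> I (fun x => f x ^+ 2) <= 0 -> {ae mu, forall x, D x -> f x = 0}.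
Proof.
move=> lf h; have : {ae mu, forall x, D x -> f x ^+ 2 = 0}.
  by apply: RI_eq0 h => //; [exact: L2_sqr|apply: aeW => x _; exact: sqr_ge0].
by apply: filterS => x {}h Dx; apply/eqP; rewrite -sqrf_eq0 h.
Qed.

Lemma ae_of_dL1 U V : K U -> K V -> dL1 U V <= 0 -> {ae mu, forall x, D x -> U j0 x = V j0 x}.
Proof.
move=> KU KV h; have : {ae mu, forall x, D x -> `|U j0 x - V j0 x| = 0}.
  by apply: RI_eq0 h => //; [exact: idL1|apply: aeW].
apply: filterS => x {}h Dx; apply/eqP; by rewrite -subr_eq0 -normr_eq0 h.
Qed.

(* Freeze F at V and minimize the remaining quadratic functional; the last
   hypothesis makes V |-> U a contraction of ratio 1/2 for the L2 norm of the
   component j0. *)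
Lemma regularized_solution c H : (forall j, 0 < c j) -> (forall j, L2 (H j)) ->
  \sum_j L ^+ 2 / c j <= c j0 / 4 -> exists2 U, K U & VI (oper c H U) U.
Proof.
move=> c0 hH hc.
(* Outside [K] the witness is arbitrary; it only makes the solution map total. *)
have exS V : exists U, K V -> K U /\ forall W, K W ->
    0 <= \sum_j I (fun x => (c j * U j x - (H j x - F j x (V j0 x))) * (W j x - U j x)).
  have [KV|nKV] := pselect (K V); last by exists V.
  have hHF j : L2 (fun x => H j x - F j x (V j0 x)) by apply: L2B => //; exact: FL2.
  have [U KU hU] := minimizer mD fD Bd_gt0 K_meas K_bnd K_conv K_closed c0 hHF K_neq0.
  by exists U.
have [S hS] := choice exS.
pose rho (U V : J -> T -> R) := nm2 (fun x => U j0 x - V j0 x).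
have l0 U V : K U -> K V -> L2 (fun x => U j0 x - V j0 x) by move=> *; apply: L2B => //; exact: KL2.
have [|||||||||Z KZ hZ] := @fixpoint rho 2^-1 S.
- by [].
- by rewrite invf_lt1// ltr1n.
- by move=> *; exact: nm2_ge0.
- by move=> *; exact: nm2C.
- move=> U V W KU KV KW; rewrite /rho; apply: le_trans (nm2D mD (l0 _ _ KU KV) (l0 _ _ KV KW)).
  by rewrite le_eqVlt; apply/orP; left; apply/eqP; apply: eq_nm2 => x _; ring.
- by move=> U KU; have [] := hS U KU.
- move=> V V' KV KV'; rewrite /rho.
  have [KU hU] := hS _ KV; have [KU' hU'] := hS _ KV'.
  have := hU _ KU'; have := hU' _ KU => {hU hU'}.
  have lw j : L2 (fun x => S V j x - S V' j x) by apply: L2B => //; exact: KL2.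
  have lw' j : L2 (fun x => S V' j x - S V j x) by apply: L2B => //; exact: KL2.
  have ld := l0 _ _ KV KV'.
  have lA j : L2 (fun x => c j * S V j x - (H j x - F j x (V j0 x))).
    by apply: L2B => //; [apply: L2Z => //; exact: KL2|apply: L2B => //; exact: FL2].
  have lA' j : L2 (fun x => c j * S V' j x - (H j x - F j x (V' j0 x))).
    by apply: L2B => //; [apply: L2Z => //; exact: KL2|apply: L2B => //; exact: FL2].
  set s1 := \sum_j _ => h1; set s2 := \sum_j _ => h2.
  (* Each solution is tested with the other, and Young's inequality absorbs half of the quadratic
     term. By [hc] the coefficients L^2 / (2 c j) sum up to at most c j0 / 8, so the squared
     distance is divided by 4. *)
  have : s2 + s1 <= \sum_j (L ^+ 2 / (2 * c j) * I (fun x => (V j0 x - V' j0 x) ^+ 2) -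
      c j / 2 * I (fun x => (S V j x - S V' j x) ^+ 2)).
    rewrite /s1 /s2 -big_split/=; apply: ler_sum => j _.
    have lwj := lw j; have lwj' := lw' j; have lAj := lA j; have lAj' := lA' j.
    rewrite -!RIZ//; [|by igr..]; rewrite -RIB//; [|by igr..]; rewrite -RID//; [|by igr..].
    apply: RI_le_ae => //; [by igr|by igr|].
    apply: filterS2 (K_bnd KV j0) (K_bnd KV' j0) => x b1 b2 Dx.
    have := F_lip j Dx (b1 Dx) (b2 Dx); have cj := c0 j.
    set dv := V j0 x - V' j0 x; set df := F j x _ - _ => hdf.
    set w := S V j x - S V' j x.
    have -> : (c j * S V j x - (H j x - F j x (V j0 x))) * (S V' j x - S V j x) +
      (c j * S V' j x - (H j x - F j x (V' j0 x))) * w = - c j * w ^+ 2 - df * w.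
      by rewrite /w /df; ring.
    have h3 : - (df * w) <= L * `|dv| * `|w|.
      apply: le_trans (ler_norm _) _; rewrite normrN normrM; exact: ler_wpM2r.
    have h4 : L * `|dv| * `|w| <= c j / 2 * w ^+ 2 + L ^+ 2 / (2 * c j) * dv ^+ 2.
      rewrite -(real_normK (num_real w)) -(real_normK (num_real dv)) -subr_ge0.
      rewrite (_ : _ - _ = (c j * `|w| - L * `|dv|) ^+ 2 / (2 * c j)); last by field; rewrite gt_eqF.
      by rewrite divr_ge0 ?sqr_ge0// mulr_ge0// ltW.
    lra.
  have := addr_ge0 h2 h1; set s := s2 + s1 => s0 {}h1; have {s0 h1} := le_trans s0 h1.
  rewrite sumrB -mulr_suml subr_ge0 => h5.
  have h6 : c j0 / 2 * I (fun x => (S V j0 x - S V' j0 x) ^+ 2) <= (\sum_j L ^+ 2 / (2 * c j)) *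
     I (fun x => (V j0 x - V' j0 x) ^+ 2).
    apply: le_trans h5; rewrite (bigD1 j0)//= lerDl; apply: sumr_ge0 => j _.
    by rewrite mulr_ge0 ?I2_ge0// divr_ge0// ltW.
  rewrite -(@ler_pXn2r _ 2)// ?nnegrE ?nm2_ge0 ?mulr_ge0 ?nm2_ge0//.
  rewrite exprMn !nm2K.
  have h7 : \sum_j L ^+ 2 / (2 * c j) = 2^-1 * \sum_j L ^+ 2 / c j.
    by rewrite mulr_sumr; apply: eq_bigr => j _; field; rewrite gt_eqF.
  rewrite h7 in h6.
  have p1 := I2_ge0 mu D (fun x => V j0 x - V' j0 x).
  have p2 := I2_ge0 mu D (fun x => S V j0 x - S V' j0 x).
  have cj := c0 j0.
  rewrite -(ler_pM2l cj); have h8 := ler_wpM2r p1 hc; lra.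
- move=> e e0; exists (e / (nm2 (fun=> 1) + 1)); first by rewrite divr_gt0// ltr_wpDl// nm2_ge0.
  move=> U V KU KV h; apply: le_trans (L1_nm2 mD fD (l0 _ _ KU KV)) _.
  apply: le_trans (ler_wpM2r (nm2_ge0 _ _ _) h) _; rewrite mulrC; apply: frac_le => //; exact: nm2_ge0.
(* On [K] differences are at most 2 Bd, so the squared L2 norm is at most 2 Bd times the L1 norm. *)
- move=> e e0; exists (e ^+ 2 / (2 * Bd)); first by rewrite divr_gt0 ?exprn_gt0// mulr_gt0.
  move=> U V KU KV h; rewrite -(@ler_pXn2r _ 2)// ?nnegrE ?nm2_ge0 ?(ltW e0)// nm2K.
  have i1 := idL1 KU KV; have i2 := L2_sqr (l0 _ _ KU KV).
  apply: (@le_trans _ _ (2 * Bd * dL1 U V)); last first.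
    by rewrite mulrC -ler_pdivlMr// mulr_gt0.
  rewrite /dL1 -RIZ//; apply: RI_le_ae => //; first exact: intgZ.
  apply: filterS2 (K_bnd KU j0) (K_bnd KV j0) => x b1 b2 Dx.
  rewrite -(real_normK (num_real (_ - _))) expr2 ler_wpM2r//.
  by apply: le_trans (ler_normB _ _) _; have := b1 Dx; have := b2 Dx; lra.
(* The solution is [S Z] and not [Z]: the two agree a.e. in the component [j0], which is all that
   [F] reads. *)
have [KSZ hSZ] := hS _ KZ; exists (S Z) => // V KV.
have aeZ : {ae mu, forall x, D x -> Z j0 x - S Z j0 x = 0}.
  apply: ae_of_I0; first exact: l0.
  rewrite -nm2K; have := nm2_ge0 mu D (fun x => Z j0 x - S Z j0 x); move: hZ; rewrite /rho; nra.
apply: le_trans (hSZ V KV) _; apply: ler_sum => j _.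
rewrite le_eqVlt; apply/orP; left; apply/eqP; apply: RI_eq_ae => //.
- apply: intg_meas; apply: L2mul => //; last by apply: L2B => //; exact: KL2.
  by apply: L2B => //; [apply: L2Z => //; exact: KL2|apply: L2B => //; exact: FL2].
- exact/intg_meas/ip.
apply: filterS aeZ => x hx Dx; have /eqP := hx Dx; rewrite subr_eq0 => /eqP E.
by rewrite /oper E; ring.
Qed.

Definition visc (M e : R) j := if j == j0 then M else e.

(* The zeroth order term M (U - V) is removed by iterating V |-> U, which by
   the comparison lemma is a contraction of ratio M / (M + m0) in L1. *)
Lemma viscous_solution e : 0 < e -> exists2 U, K U & VI (oper (visc 0 e) (fun _ _ => 0) U) U.
Proof.
(* Chosen so that M / 4 dominates the sum of the L^2 / c j: as M >= 1 the index [j0] contributes at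
   most L^2, and each other index contributes L^2 / e. *)
move=> e0; pose M := 4 * (L ^+ 2 + #|J|%:R * (L ^+ 2 / e)) + 1.
have q0 : 0 <= #|J|%:R * (L ^+ 2 / e) by rewrite mulr_ge0// divr_ge0 ?sqr_ge0// ltW.
have M1 : 1 <= M by rewrite /M lerDr mulr_ge0// addr_ge0// sqr_ge0.
have M0 : 0 < M by exact: lt_le_trans M1.
have c0 j : 0 < visc M e j by rewrite /visc; case: ifP.
have hc : \sum_j L ^+ 2 / visc M e j <= visc M e j0 / 4.
  rewrite (bigD1 j0)//= {1 3}/visc eqxx.
  have h1 : L ^+ 2 / M <= L ^+ 2 by rewrite ler_pdivrMr// ler_peMr// sqr_ge0.
  have h2 : \sum_(j | j != j0) L ^+ 2 / visc M e j <= #|J|%:R * (L ^+ 2 / e).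
    rewrite (eq_bigr (fun=> L ^+ 2 / e)); last by move=> j /negPf h; rewrite /visc h.
    rewrite sumr_const -[leLHS]mulr_natl ler_wpM2r ?ler_nat ?max_card// divr_ge0 ?sqr_ge0// ltW//.
  have : M / 4 = L ^+ 2 + #|J|%:R * (L ^+ 2 / e) + 4^-1 by rewrite /M; field; rewrite gt_eqF.
  move: h1 h2; lra.
pose Hg (g : J -> T -> R) j x := if j == j0 then M * g j0 x else 0.
have lHg g : K g -> forall j, L2 (Hg g j).
  move=> Kg j; rewrite /Hg; case: (j == j0); last exact: L2_cst.
  by apply: L2Z => //; exact: KL2.
have exS g : exists U, K g -> K U /\ VI (oper (visc M e) (Hg g) U) U.
  have [Kg|nKg] := pselect (K g); last by exists g.
  by have [U KU hU] := regularized_solution c0 (lHg g Kg) hc; exists U.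
have [S hS] := choice exS.
have Mm : 0 < M + m0 by exact: addr_gt0.
have [|||||||||Z KZ hZ] := @fixpoint dL1 (M / (M + m0)) S.
- by rewrite divr_ge0// ltW.
- by rewrite ltr_pdivrMr// mul1r ltrDl.
- by move=> *; exact: dL1_ge0.
- by move=> *; exact: dL1C.
- by move=> U V W KU KV KW; exact: dL1_triangle.
- by move=> g Kg; have [] := hS g Kg.
- move=> g g' Kg Kg'; have [KU hU] := hS _ Kg; have [KU' hU'] := hS _ Kg'.
  rewrite mulrAC ler_pdivlMr// mulrC.
  have := comparison (fun j => ltW (c0 j)) (lHg _ Kg) (lHg _ Kg') _ KU KU' hU hU'.
  rewrite {1}/visc eqxx => /(_ _)/le_trans; apply.
    by move=> j /negPf h; rewrite /Hg h.
  rewrite -RIZ; [|exact: mD|exact: idL1]; rewrite le_eqVlt; apply/orP; left; apply/eqP.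
  by apply: eq_Rintegral => x _; rewrite /Hg eqxx -mulrBr normrM gtr0_norm.
- by move=> r r0; exists r.
- by move=> r r0; exists r.
have [KSZ hSZ] := hS _ KZ; exists (S Z) => // V KV.
have aeZ := ae_of_dL1 KZ KSZ hZ.
apply: le_trans (hSZ V KV) _; apply: ler_sum => j _.
rewrite le_eqVlt; apply/orP; left; apply/eqP; apply: RI_eq_ae => //.
- by apply/intg_meas/ip => //; exact: lHg.
- by apply/intg_meas/ip => // i; exact: L2_cst.
apply: filterS aeZ => x hx Dx; have E := hx Dx.
rewrite /oper /Hg /visc; case: ifPn => [/eqP->|_ //]; by rewrite E mul0r; ring.
Qed.

Hypothesis K_compact : forall U : nat -> J -> T -> R, (forall n, K (U n)) ->
  exists2 s : nat -> nat, (forall k, (k <= s k)%N) &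
    forall e : R, 0 < e -> exists n, forall p q, (n <= p)%N -> (n <= q)%N ->
      dL1 (U (s p)) (U (s q)) <= e.

(** Only the component [j0] of the viscous solutions converges strongly, to that of some [Z]. With
    [F] frozen at [Z] the inequality is affine in the remaining unknown, so [nested_convex] passes
    to the limit; the resulting [W] agrees with [Z] in the component [j0], which closes the loop.
    The extraction needs only k <= s k, for then the viscosity at rank s k is at most 1 / (k +
    1). *)
Theorem VI_exists : exists2 U, K U & VI (fun j x => F j x (U j0 x)) U.
Proof.
have n0 n : 0 < n.+1%:R^-1 :> R by rewrite invr_gt0.
have exU n : exists U, K U /\ VI (oper (visc 0 n.+1%:R^-1) (fun _ _ => 0) U) U.
  by have [U KU hU] := viscous_solution (n0 n); exists U.
have [U hU] := choice exU.
have KU n : K (U n) by have [] := hU n.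
have [s sk cs] := K_compact KU.
pose V k := U (s k); have KV k : K (V k) by exact: KU.
have [Z KZ hZ] := L1_complete KV cs.
(* Convex and closed in [W], because [F] is evaluated at [Z]; the first part ties [W] to [Z] in the
   component [j0]. *)
pose good e W := dL1 Z W <= e /\ forall Y, K Y ->
  - e <= \sum_j I (fun x => F j x (Z j0 x) * (Y j x - W j x)).
have iF Y W j : K Y -> K W -> intg (fun x => F j x (Z j0 x) * (Y j x - W j x)).
  by move=> *; apply: L2mul => //; [exact: FL2|apply: L2B => //; exact: KL2].
have m1 : 0 <= I (fun=> 1) by apply: Rintegral_ge0.
(* [Q] bounds the viscous term apart from its coefficient, and [P] the cost of replacing [V k] by
   [Z] inside [F]. *)
pose Q := #|J|%:R * (2 * Bd * Bd * I (fun=> 1)).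
have Q0 : 0 <= Q by rewrite /Q !mulr_ge0// ltW.
pose P := #|J|%:R * (2 * Bd * L).
have P0 : 0 <= P by rewrite /P !mulr_ge0// ltW.
have est k Y : K Y -> - (k.+1%:R^-1 * Q + P * dL1 Z (V k)) <= \sum_j I (fun x => F j x (Z j0 x) * (Y j x - V k j x)).
  move=> KY; have [_ hk] := hU (s k); have {hk} := hk Y KY; rewrite -/(V k) => hk.
  have Vk := KV k; have lYV j : L2 (fun x => Y j x - V k j x) by apply: L2B => //; exact: KL2.
  have lO j : L2 (oper (visc 0 (s k).+1%:R^-1) (fun _ _ => 0) (V k) j).
    by apply: operL2 => // i; exact: L2_cst.
  suff : \sum_j I (fun x => oper (visc 0 (s k).+1%:R^-1) (fun _ _ => 0) (V k) j x * (Y j x - V k j x)) -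
     \sum_j I (fun x => F j x (Z j0 x) * (Y j x - V k j x)) <= k.+1%:R^-1 * Q + P * dL1 Z (V k).
    by move=> h; rewrite lerNl; apply: le_trans h; rewrite lerBrDr addNr.
  rewrite -sumrB.
  apply: (@le_trans _ _ (\sum_(j : J) (k.+1%:R^-1 * (2 * Bd * Bd * I (fun=> 1)) + 2 * Bd * L * dL1 Z (V k)))); last first.
    rewrite sumr_const -[leLHS]mulr_natl /Q /P le_eqVlt; apply/orP; left; apply/eqP.
    rewrite -[#|_|]/#|J|; ring.
  apply: ler_sum => j _; have lYj := lYV j; have lOj := lO j; have lFZ := FL2 j KZ.
  have i1 := idL1 KZ Vk.
  rewrite /dL1 -!RIZ//; [|by igr..].
  rewrite -RIB//; [|by igr..]; rewrite -RID//; [|by igr..].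
  apply: RI_le_ae => //; [by igr|by igr|].
  have aeB U1 : K U1 -> {ae mu, forall x, D x -> forall j, `|U1 j x| <= Bd}.
    by move=> KU1; apply: ae_all => i; exact: K_bnd.
  near=> x => Dx.
  have bZ : forall j, `|Z j x| <= Bd by move: Dx; near: x; exact: aeB.
  have bV : forall j, `|V k j x| <= Bd by move: Dx; near: x; exact: aeB.
  have bY : forall j, `|Y j x| <= Bd by move: Dx; near: x; exact: aeB.
  have hl := F_lip j Dx (bZ j0) (bV j0).
  have hyv : `|Y j x - V k j x| <= 2 * Bd.
    by apply: le_trans (ler_normB _ _) _; have := bY j; have := bV j; lra.
  rewrite /oper -mulrBl subr0.
  have hv : `|visc 0 (s k).+1%:R^-1 j * V k j x| <= k.+1%:R^-1 * Bd.
    rewrite normrM; apply: ler_pM => //.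
    rewrite /visc; case: ifP => _; first by rewrite normr0 ltW.
    by rewrite gtr0_norm// lef_pV2 ?posrE// ler_nat ltnS.
  apply: le_trans (ler_norm _) _; rewrite normrM -addrA.
  have h1 : `|visc 0 (s k).+1%:R^-1 j * V k j x + (F j x (V k j0 x) - F j x (Z j0 x))| <=
     k.+1%:R^-1 * Bd + L * `|Z j0 x - V k j0 x|.
    by apply: le_trans (ler_normD _ _) _; apply: lerD => //; rewrite distrC.
  apply: le_trans (ler_pM _ _ h1 hyv) _ => //.
  rewrite le_eqVlt; apply/orP; left; apply/eqP; ring.
have mgood (n : nat) e X W : K X -> K W -> good e X -> good e W -> good e (mid X W).
  move=> KX KW [hX1 hX2] [hW1 hW2]; split.
    have := dL1_mid KX KW KZ; rewrite (dL1C _ Z) (dL1C X) (dL1C W); lra.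
  move=> Y KY; have h1 := hX2 _ KY; have h2 := hW2 _ KY.
  have -> : \sum_j I (fun x => F j x (Z j0 x) * (Y j x - mid X W j x)) =
    2^-1 * \sum_j I (fun x => F j x (Z j0 x) * (Y j x - X j x)) +
    2^-1 * \sum_j I (fun x => F j x (Z j0 x) * (Y j x - W j x)).
    rewrite !mulr_sumr -big_split/=; apply: eq_bigr => j _.
    have i1 := iF _ _ j KY KX; have i2 := iF _ _ j KY KW.
    rewrite -!RIZ//; rewrite -RID//; [|by igr..].
    by apply: eq_Rintegral => x _; rewrite /mid; field.
  lra.
have cgood (n : nat) e (W : nat -> J -> T -> R) X : (forall k, K (W k)) -> K X -> to2 mu D W X ->
     (forall k, (n <= k)%N -> good e (W k)) -> good e X.
  move=> KW KX WX h; split.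
    apply/ler_addgt0Pr => r r0; have [n1 hn1] := to2_dL1 KW KX WX r0.
    have := hn1 (maxn n n1) (leq_maxr _ _); have [h1 _] := h (maxn n n1) (leq_maxl _ _).
    have := dL1_triangle KZ (KW (maxn n n1)) KX; lra.
  move=> Y KY; rewrite lerNl; apply/ler_addgt0Pr => r r0.
  have J0 : 0 < r / (#|J|%:R + 1) by rewrite divr_gt0// ltr_wpDl.
  have [N hN] := choice (fun j => to2_I mD fD K_meas K_bnd j (FL2 j KZ) KW KX WX J0).
  pose k := maxn n (\max_j N j).
  have [_ h1] := h k (leq_maxl _ _).
  have h2 := h1 _ KY.
  suff : \sum_j I (fun x => F j x (Z j0 x) * (Y j x - W k j x)) -
    \sum_j I (fun x => F j x (Z j0 x) * (Y j x - X j x)) <= r by lra.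
  rewrite -sumrB; apply: le_trans (ler_norm _) _; apply: le_trans (ler_norm_sum _ _ _) _.
  apply: (@le_trans _ _ (\sum_(j : J) r / (#|J|%:R + 1))); last first.
    by rewrite sumr_const -[leLHS]mulr_natl; exact: frac_le.
  apply: ler_sum => j _.
  have := hN j k (leq_trans (leq_bigmax j) (leq_maxr _ _)).
  have lF := FL2 j KZ; have lWj := KL2 (KW k) j; have lX := KL2 KX j; have lY := KL2 KY j.
  have lYW : L2 (fun x => Y j x - W k j x) by exact: L2B.
  have lYX : L2 (fun x => Y j x - X j x) by exact: L2B.
  rewrite -normrN opprB; congr (`| _ | <= _).
  by rewrite -!RIB//; [|by igr..]; apply: eq_Rintegral => x _; ring.
have [W KW hW] := nested_convex mD fD Bd_gt0 K_meas K_bnd K_conv K_closed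
  (G := fun _ => good) KV mgood cgood.
have hW0 e : 0 < e -> good e W.
  move=> e0.
  have d0 : 0 < e / 2 / (P + 1) by rewrite !divr_gt0// ltr_wpDl.
  have q0 : 0 < e / 2 / (Q + 1) by rewrite !divr_gt0// ltr_wpDl.
  have [n1 hn1] := hZ _ e0; have [n2 hn2] := hZ _ d0.
  pose n3 := Num.truncn (e / 2 / (Q + 1))^-1.
  apply: (hW (maxn n1 (maxn n2 n3))) => m; rewrite !geq_max => /and3P[a1 a2 a3].
  split; first exact: hn1.
  move=> Y KY; apply: le_trans (est m _ KY); rewrite lerN2.
  have h1 : P * dL1 Z (V m) <= e / 2.
    by apply: le_trans (ler_wpM2l P0 (hn2 m a2)) _; apply: frac_le => //; rewrite divr_gt0.
  have h2 : m.+1%:R^-1 * Q <= e / 2.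
    have h3 : m.+1%:R^-1 <= e / 2 / (Q + 1).
      rewrite invf_ple ?posrE//; apply: le_trans (ltW (truncnS_gt _)) _.
      by rewrite ler_nat.
    by rewrite mulrC; apply: le_trans (ler_wpM2l Q0 h3) _; apply: frac_le => //; rewrite divr_gt0.
  by rewrite [leRHS]splitr; exact: lerD.
have ZW : {ae mu, forall x, D x -> Z j0 x = W j0 x}.
  by apply: ae_of_dL1 => //; apply/ler_addgt0Pr => e e0; rewrite add0r; have [] := hW0 e e0.
exists W => // Y KY; apply/ler_addgt0Pr => e e0.
have [_ h] := hW0 e e0; have := h Y KY.
rewrite (eq_bigr (fun j => I (fun x => F j x (W j0 x) * (Y j x - W j x)))); first lra.
move=> j _; apply: RI_eq_ae => //; first exact/intg_meas/iF.
  by apply: intg_meas; apply: L2mul => //; [exact: FL2|apply: L2B => //; exact: KL2].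
by apply: filterS ZW => x hx Dx; rewrite hx.
Unshelve. all: by end_near.
Qed.

Theorem VI_unique U U' : K U -> K U' ->
  VI (fun j x => F j x (U j0 x)) U -> VI (fun j x => F j x (U' j0 x)) U' ->
  {ae mu, forall x, D x -> U j0 x = U' j0 x}.
Proof.
move=> KU KU' vU vU'; apply: ae_of_dL1 => //.
have l0 (j : J) : L2 (fun=> 0 : R) by exact: L2_cst.
have E W : oper (fun=> 0) (fun _ _ => 0) W = (fun j x => F j x (W j0 x)).
  by apply/funext => j; apply/funext => x; rewrite /oper mul0r add0r subr0.
have := @comparison (fun=> 0) (fun _ _ => 0) (fun _ _ => 0) U U' (fun=> lexx 0) l0 l0 (fun _ _ => erefl) KU KU'.
rewrite !E => /(_ vU vU'); rewrite add0r.
rewrite (_ : (fun x => `|0 - 0|) = fun=> 0); last by apply/funext => x; rewrite subr0 normr0.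
by rewrite Rintegral_cst// mul0r pmulr_rle0.
Qed.

End variational_inequality.

(** * Smooth functions *)

Section directional_derivative.
Context {R : realType} {V : normedModType R}.
Implicit Types (f g : V -> R) (x v : V).

Lemma is_derive_congr f g x v (l m : R) :
  is_derive x v f l -> f = g -> l = m -> is_derive x v g m.
Proof. by move=> h <- <-. Qed.

(** Restriction to the line s -> s v + x brings the rules of one real variable to functions that
    have only directional derivatives; [is_derive_line0] is the way back. *)
Lemma is_derive_line f x v (l t : R) :
  is_derive (t *: v + x) v f l -> is_derive t 1 (fun s : R => f (s *: v + x)) l.
Proof.
move=> [h1 h2].
have E : (fun h : R => h^-1 *: (((fun s : R => f (s *: v + x)) \o shift t) (h *: 1) - f (t *: v + x))) =
  (fun h : R => h^-1 *: ((f \o shift (t *: v + x)) (h *: v) - f (t *: v + x))).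
  by apply/funext => h /=; rewrite [h *: 1]mulr1 scalerDl addrA.
by split; [rewrite /derivable E|rewrite /derive E].
Qed.

Lemma is_derive_line0 f x v (l : R) :
  is_derive (0 : R) 1 (fun s : R => f (s *: v + x)) l -> is_derive x v f l.
Proof.
move=> [h1 h2].
have E : (fun h : R => h^-1 *: ((f \o shift x) (h *: v) - f x)) =
  (fun h : R => h^-1 *: (((fun s : R => f (s *: v + x)) \o shift 0) (h *: 1) - f (0 *: v + x))).
  by apply/funext => h /=; rewrite [h *: 1]mulr1 addr0 scale0r add0r.
by split; [rewrite /derivable E|rewrite /derive E].
Qed.

Lemma is_derive_comp f x v (l a : R) (b : R -> R) :
  is_derive x v f l -> is_derive (f x) 1 b a -> is_derive x v (b \o f) (a * l).
Proof.
move=> hf hb; apply: is_derive_line0.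
have h0 : is_derive (0 : R) 1 (fun s : R => f (s *: v + x)) l.
  by apply: is_derive_line; rewrite scale0r add0r.
have hb' : is_derive (f (0 *: v + x)) 1 b a by rewrite scale0r add0r.
exact: (is_derive1_comp hb' h0).
Qed.

Lemma is_derive_prod f g x v (l m : R) :
  is_derive x v f l -> is_derive x v g m ->
  is_derive x v (fun y => f y * g y) (l * g x + f x * m).
Proof.
move=> hf hg; have := is_deriveM hf hg.
by move=> h; apply: is_derive_congr h _ _ => //; rewrite -![_ *: _]/(_ * _); ring.
Qed.

Lemma is_derive_add f g x v (l m : R) :
  is_derive x v f l -> is_derive x v g m -> is_derive x v (fun y => f y + g y) (l + m).
Proof. by move=> hf hg; exact: is_deriveD. Qed.

Lemma is_derive_sub f g x v (l m : R) :
  is_derive x v f l -> is_derive x v g m -> is_derive x v (fun y => f y - g y) (l - m).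
Proof. by move=> hf hg; exact: is_deriveB. Qed.

Lemma is_derive_inv f x v (l : R) : f x != 0 -> is_derive x v f l ->
  is_derive x v (fun y => (f y)^-1) (- (f x) ^- 2 * l).
Proof.
move=> f0 [df <-]; split; first exact: derivableV.
by rewrite (deriveV f0 df).
Qed.

Lemma lip_line f v (C : R) : (forall x, derivable f x v) ->
  (forall x, `|'D_v f x| <= C) -> forall x (t : R), `|f (t *: v + x) - f x| <= C * `|t|.
Proof.
move=> df hC x.
have hpos y (t : R) : 0 < t -> `|f (t *: v + y) - f y| <= C * t.
  move=> t0.
  have hd (s : R) : is_derive s 1 (fun s : R => f (s *: v + y)) ('D_v f (s *: v + y)).
    by apply: is_derive_line; exact: derivableP.
  have [|c _] := @MVT R (fun s : R => f (s *: v + y)) (fun s => 'D_v f (s *: v + y)) 0 t t0 (fun s _ => hd s).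
    apply: derivable_within_continuous => s _; by case: (hd s).
  rewrite scale0r add0r subr0 => ->; rewrite normrM (gtr0_norm t0).
  by apply: ler_wpM2r (hC _); exact: ltW.
move=> t; have [t0|t0|->] := ltgtP t 0.
- have := hpos (t *: v + x) (- t); rewrite oppr_gt0 => /(_ t0).
  by rewrite addrA -scalerDl addNr scale0r add0r distrC (ltr0_norm t0).
- by rewrite (gtr0_norm t0); exact: hpos.
- by rewrite scale0r add0r subrr !normr0 mulr0.
Qed.

End directional_derivative.

(** * Stability properties of functions of class Ck *)

Section Ck_algebra.
Context {R : realType} {n : nat}.
Implicit Types (f g : 'rV[R]_n -> R) (k : nat).

Lemma Ck_continuous k f : Ck k f -> continuous f.
Proof. by case: k => [|k] []. Qed.

Lemma Ck_cvg k f (x : 'rV[R]_n) : Ck k f -> f y @[y --> x] --> f x.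
Proof. by move=> /Ck_continuous; exact. Qed.

Lemma CkS_derivable k f i : Ck k.+1 f -> forall x, derivable f x (evec i).
Proof. by move=> [_ /(_ i)[]]. Qed.

Lemma CkSD k f i : Ck k.+1 f -> Ck k ('D_(evec i) f).
Proof. by move=> [_ /(_ i)[]]. Qed.

Lemma CkS_le k f : Ck k.+1 f -> Ck k f.
Proof.
elim: k f => [|k ih] f [cf hf]; split => // i.
by have [df Df] := hf i; split => //; exact: ih.
Qed.

Lemma CkSI k f (df : 'I_n -> 'rV[R]_n -> R) : continuous f ->
  (forall i x, is_derive x (evec i) f (df i x)) -> (forall i, Ck k (df i)) -> Ck k.+1 f.
Proof.
move=> cf hd hk; split => // i; split; first by move=> x; case: (hd i x).
rewrite (_ : 'D_(evec i) f = df i)//; apply/funext => x; by case: (hd i x).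
Qed.

Lemma CkS_is_derive k f i x : Ck k.+1 f -> is_derive x (evec i) f ('D_(evec i) f x).
Proof. by move=> h; apply: derivableP; exact: CkS_derivable h x. Qed.

Lemma Ck_cst k (a : R) : Ck k (fun _ : 'rV[R]_n => a).
Proof.
elim: k a => [|k ih] a; first by split => //; exact: cst_continuous.
apply: (@CkSI _ _ (fun _ _ => 0)) => //; first exact: cst_continuous.
Qed.

Lemma Ck_add k f g : Ck k f -> Ck k g -> Ck k (fun x => f x + g x).
Proof.
elim: k f g => [|k ih] f g hf hg.
  by split => //; move=> x; exact: (cvgD (@Ck_cvg _ f x hf) (@Ck_cvg _ g x hg)).
apply: (@CkSI _ _ (fun i x => 'D_(evec i) f x + 'D_(evec i) g x)).
- by move=> x; exact: (cvgD (@Ck_cvg _ f x hf) (@Ck_cvg _ g x hg)).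
- by move=> i x; exact: (is_derive_add (CkS_is_derive i x hf) (CkS_is_derive i x hg)).
- by move=> i; apply: ih; exact: CkSD.
Qed.

Lemma Ck_mul k f g : Ck k f -> Ck k g -> Ck k (fun x => f x * g x).
Proof.
elim: k f g => [|k ih] f g hf hg.
  by split => //; move=> x; exact: (cvgM (@Ck_cvg _ f x hf) (@Ck_cvg _ g x hg)).
apply: (@CkSI _ _ (fun i x => 'D_(evec i) f x * g x + f x * 'D_(evec i) g x)).
- by move=> x; exact: (cvgM (@Ck_cvg _ f x hf) (@Ck_cvg _ g x hg)).
- by move=> i x; exact: (is_derive_prod (CkS_is_derive i x hf) (CkS_is_derive i x hg)).
- by move=> i; apply: Ck_add; apply: ih; [exact: CkSD|exact: CkS_le|exact: CkS_le|exact: CkSD].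
Qed.

Lemma Ck_opp k f : Ck k f -> Ck k (fun x => - f x).
Proof.
move=> hf; rewrite (_ : (fun x => _) = (fun x => -1 * f x)).
  by apply: Ck_mul => //; exact: Ck_cst.
by apply/funext => x; rewrite mulN1r.
Qed.

Lemma Ck_sub k f g : Ck k f -> Ck k g -> Ck k (fun x => f x - g x).
Proof. by move=> hf /Ck_opp hg; exact: Ck_add. Qed.

Lemma Ck_prod k (I : Type) (s : seq I) (P : pred I) (F : I -> 'rV[R]_n -> R) :
  (forall i, Ck k (F i)) -> Ck k (fun x => \prod_(i <- s | P i) F i x).
Proof.
move=> h; elim: s => [|a s ih].
  rewrite (_ : (fun x => _) = (fun=> 1)); first exact: Ck_cst.
  by apply/funext => x; rewrite big_nil.
have [Pa|Pa] := boolP (P a).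
  rewrite (_ : (fun x => _) = (fun x => F a x * \prod_(i <- s | P i) F i x)); first exact: Ck_mul.
  by apply/funext => x; rewrite big_cons Pa.
rewrite (_ : (fun x => _) = (fun x => \prod_(i <- s | P i) F i x))//.
by apply/funext => x; rewrite big_cons (negPf Pa).
Qed.

Lemma is_derive_coord (i j : 'I_n) (x : 'rV[R]_n) :
  is_derive x (evec i) (fun y : 'rV[R]_n => y ord0 j) ((i == j)%:R).
Proof.
apply: is_derive_line0.
rewrite (_ : (fun s : R => _) = (fun s : R => s * (i == j)%:R + x ord0 j)); last first.
  by apply/funext => s; rewrite !mxE eqxx andTb eq_sym.
have := is_deriveD (is_deriveM (is_derive_id (0 : R) 1) (is_derive_cst ((i == j)%:R : R) (0 : R) 1))
   (is_derive_cst (x ord0 j) (0 : R) 1).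
move=> h; apply: is_derive_congr h _ _ => //.
by rewrite scaler0 add0r addr0 -[_ *: _]/(_ * _) mulr1.
Qed.

Lemma continuous_coord (j : 'I_n) : continuous (fun y : 'rV[R]_n => y ord0 j).
Proof. exact: coord_continuous. Qed.

Lemma Ck_coord k (j : 'I_n) : Ck k (fun y : 'rV[R]_n => y ord0 j).
Proof.
case: k => [|k]; first by split => //; exact: continuous_coord.
apply: (@CkSI _ _ (fun i _ => (i == j)%:R)); first exact: continuous_coord.
  by move=> i x; exact: is_derive_coord.
by move=> i; exact: Ck_cst.
Qed.

(** The outer function varies over a class stable under differentiation, so the induction on k can
    replace b by b'. It is applied to the exponential alone and to the family of all [flat p]. *)
Lemma Ck_comp (S : set (R -> R)) :
  (forall b, S b -> exists2 b', S b' & forall t : R, is_derive t 1 b (b' t)) ->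
  forall k b f, S b -> Ck k f -> Ck k (b \o f).
Proof.
move=> hS; elim => [|k ih] b f Sb hf.
  have [b' _ hb] := hS b Sb; split => // x; apply: continuous_comp.
    exact: (@Ck_cvg _ f x hf).
  by apply: differentiable_continuous; apply/derivable1_diffP; case: (hb (f x)).
have [b' Sb' hb] := hS b Sb.
apply: (@CkSI _ _ (fun i x => (b' \o f) x * 'D_(evec i) f x)).
- move=> x; apply: continuous_comp; first exact: (@Ck_cvg _ f x hf).
  by apply: differentiable_continuous; apply/derivable1_diffP; case: (hb (f x)).
- by move=> i x; apply: is_derive_comp => //; exact: CkS_is_derive hf.
- by move=> i; apply: Ck_mul; [apply: ih => //; exact: CkS_le|exact: CkSD].
Qed.

Lemma Ck_exp k f : Ck k f -> Ck k (fun x => expR (f x)).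
Proof.
apply: (@Ck_comp [set expR]) => // b ->; exists expR => // t.
exact: is_derive_expR.
Qed.

Lemma Ck_inv k f : (forall x, f x != 0) -> Ck k f -> Ck k (fun x => (f x)^-1).
Proof.
move=> f0; elim: k f f0 => [|k ih] f f0 hf.
  by split => // x; exact: (cvgV (f0 x) (@Ck_cvg _ f x hf)).
apply: (@CkSI _ _ (fun i x => - ((f x)^-1 * (f x)^-1) * 'D_(evec i) f x)).
- by move=> x; exact: (cvgV (f0 x) (@Ck_cvg _ f x hf)).
- move=> i x; have := is_derive_inv (f0 x) (CkS_is_derive i x hf).
  by move=> h; apply: is_derive_congr h _ _ => //; rewrite expr2 invfM.
- move=> i; have hi := ih f f0 (CkS_le hf).
  by apply: Ck_mul (CkSD i hf); apply: Ck_opp; exact: Ck_mul.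
Qed.

Lemma Ck_tanh k f : Ck k f -> Ck k (fun x => tanh (f x)).
Proof.
move=> hf; apply: Ck_sub; first exact: Ck_cst.
apply: Ck_mul; first exact: Ck_cst.
apply: Ck_inv.
  by move=> x; rewrite gt_eqF// addr_gt0// expR_gt0.
apply: Ck_add; last exact: Ck_cst.
by apply: Ck_exp; apply: Ck_mul => //; exact: Ck_cst.
Qed.

End Ck_algebra.

(** * Flat functions and smooth steps *)

Section flat.
Context {R : realType}.
Implicit Types (p : {poly R}) (t : R).

(* p(1/t) exp(-1/t), extended by 0 to t <= 0 *)
Definition flat p t : R := if 0 < t then p.[t^-1] * expR (- t^-1) else 0.

(** Induction on p: each factor X is paid for with half of the exponent, by y <= (2 / a) exp (a y /
    2). *)
Lemma poly_le_exp p (a : R) : 0 < a -> exists2 C : R, 0 < C &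
  forall y : R, 0 <= y -> `|p.[y]| <= C * expR (a * y).
Proof.
elim/poly_ind: p a => [|p c ih] a a0.
  by exists 1 => // y _; rewrite horner0 normr0 mul1r expR_ge0.
have a20 : 0 < a / 2 by rewrite divr_gt0.
have [C C0 hC] := ih _ a20.
exists (C * (2 / a) + `|c|); first by rewrite ltr_wpDr// mulr_gt0// divr_gt0.
move=> y y0; rewrite hornerMXaddC; apply: le_trans (ler_normD _ _) _.
rewrite mulrDl; apply: lerD.
  rewrite normrM (ger0_norm y0) -mulrA; apply: (@le_trans _ _ (C * expR (a / 2 * y) * y)).
    by rewrite ler_wpM2r// hC.
  rewrite -mulrA ler_pM2l// (_ : a * y = a / 2 * y + a / 2 * y); last by field.
  rewrite expRD [leRHS]mulrCA ler_pM2l ?expR_gt0//.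
  rewrite -ler_pdivrMl ?divr_gt0// invf_div mulrC mulrA.
  apply: le_trans (expR_ge1Dx _); rewrite (_ : y * a / 2 = a / 2 * y); last by field.
  by rewrite lerDr.
by rewrite ler_peMr//; apply: le_trans (expR_ge1Dx _); rewrite lerDl mulr_ge0// (ltW a0).
Qed.

Lemma flat_pos p t : 0 < t -> flat p t = p.[t^-1] * expR (- t^-1).
Proof. by rewrite /flat => ->. Qed.

Lemma flat_npos p t : t <= 0 -> flat p t = 0.
Proof. by rewrite /flat ltNge => ->. Qed.

(** From [poly_le_exp] for p X^2 at 1 / t. Quadratic vanishing makes the difference quotient of
    [flat p] at 0 tend to 0. *)
Lemma flat_sqr p : exists2 C : R, 0 < C & forall t, `|flat p t| <= C * t ^+ 2.
Proof.
have [C C0 hC] := poly_le_exp (p * 'X^2) (@ltr01 R).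
exists C => // t; have [t0|t0] := ltP 0 t; last first.
  by rewrite flat_npos// normr0 mulr_ge0 ?sqr_ge0// ltW.
have y0 : 0 < t^-1 by rewrite invr_gt0.
have := hC _ (ltW y0); rewrite mul1r hornerM hornerXn normrM [X in _ * X]ger0_norm ?sqr_ge0//.
rewrite flat_pos// normrM (ger0_norm (expR_ge0 _)) expRN.
rewrite ler_pdivrMr ?expR_gt0// mulrAC => h.
rewrite -[leLHS]mulr1 (_ : 1 = t^-1 ^+ 2 * t ^+ 2); last first.
  by rewrite -exprMn mulVf ?expr1n// gt_eqF.
by rewrite mulrA ler_wpM2r// sqr_ge0.
Qed.

(** For t > 0 differentiating p(1/t) exp(-1/t) multiplies by 1/t^2 and replaces p by p - p'. The
    family is thus stable under differentiation, whence smoothness. *)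
Lemma is_derive_flat p t : is_derive t 1 (flat p) (flat ('X^2 * (p - p^`())) t).
Proof.
have [t0|t0|->] := ltgtP t 0.
- rewrite (flat_npos _ (ltW t0)).
  have E : {near t, cst 0 =1 flat p}.
    by near=> s; rewrite flat_npos//= ltW//; near: s; exact: lt_nbhsl.
  exact: near_eq_is_derive E (is_derive_cst _ _ _).
- rewrite (flat_pos _ t0).
  have E : {near t, (fun s => p.[s^-1] * expR (- s^-1)) =1 flat p}.
    by near=> s; rewrite flat_pos//; near: s; exact: lt_nbhsr.
  apply: near_eq_is_derive E _.
  have t1 : t != 0 by rewrite gt_eqF.
  have hi := is_derive_inv t1 (is_derive_id t 1).
  have h1 := is_derive_comp hi (is_derive_poly p t^-1).
  have h2 := is_derive_comp (is_derive_sub (is_derive_cst (0 : R) t 1) hi) (is_derive_expR (0 - t^-1)).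
  apply: is_derive_congr (is_derive_prod h1 h2) _ _.
    by apply/funext => s /=; rewrite /cst sub0r.
  rewrite /= /cst sub0r hornerM hornerXn hornerD hornerN -exprVn; ring.
- rewrite flat_npos//; have [C C0 hC] := flat_sqr p.
  have E : (fun h => h^-1 *: ((flat p \o shift 0) (h *: 1) - flat p 0)) = (fun h => h^-1 * flat p h).
    by apply/funext => h /=; rewrite [h *: 1]mulr1 addr0 (flat_npos _ (lexx 0)) subr0.
  have c : (fun h => h^-1 * flat p h) h @[h --> 0^'] --> (0 : R).
    have h1 : C * `|h| @[h --> (0 : R)^'] --> 0.
      rewrite -[X in _ --> X](mulr0 C); apply: cvgM; first exact: cvg_cst.
      rewrite -[X in _ --> X](@normr0 _ R); apply: cvg_norm; exact: cvg_within.
    have h2 : - (C * `|h|) @[h --> (0 : R)^'] --> 0 by rewrite -[X in _ --> X]oppr0; exact: cvgN.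
    apply: (squeeze_cvgr _ h2 h1); apply: nearW => h; rewrite -ler_norml normrM normfV.
    have [->|h0] := eqVneq h 0; first by rewrite normr0 invr0 mul0r mulr0.
    rewrite ler_pdivrMl ?normr_gt0// mulrCA -expr2 real_normK ?num_real//; exact: hC.
  split; first by rewrite /derivable E; apply/cvg_ex; exists 0.
  by rewrite /derive E; exact/cvg_lim.
Unshelve. all: by end_near.
Qed.

Lemma Ck_flat n k (f : 'rV[R]_n -> R) p : Ck k f -> Ck k (fun x => flat p (f x)).
Proof.
move=> hf; apply: (@Ck_comp _ _ [set b | exists q, b = flat q]) => //; last by exists p.
by move=> _ [q ->]; exists (flat ('X^2 * (q - q^`()))); [eexists|exact: is_derive_flat].
Qed.

Definition flat1 : R -> R := flat 1.

Lemma flat1_gt0 t : 0 < t -> 0 < flat1 t.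
Proof. by move=> t0; rewrite /flat1 flat_pos// hornerC mul1r expR_gt0. Qed.

Lemma flat1_0 t : t <= 0 -> flat1 t = 0.
Proof. exact: flat_npos. Qed.

Lemma flat1_ge0 t : 0 <= flat1 t.
Proof. by have [/flat1_gt0/ltW//|/flat1_0 ->] := ltP 0 t. Qed.

Lemma is_derive_flat1 t : is_derive t 1 flat1 (flat 'X^2 t).
Proof. by have := is_derive_flat 1 t; rewrite derivC subr0 mulr1. Qed.

Lemma flatX2_ge0 t : 0 <= flat 'X^2 t.
Proof.
have [t0|t0] := ltP 0 t; last by rewrite flat_npos.
by rewrite flat_pos// hornerXn mulr_ge0 ?sqr_ge0// expR_ge0.
Qed.

Definition smooth_step t := flat1 t / (flat1 t + flat1 (1 - t)).

Lemma step_den_gt0 t : 0 < flat1 t + flat1 (1 - t).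
Proof.
have [t0|t0] := ltP 0 t; first by rewrite ltr_pwDl ?flat1_gt0// flat1_ge0.
rewrite ltr_wpDl ?flat1_ge0// flat1_gt0//; lra.
Qed.

Lemma smooth_step0 t : t <= 0 -> smooth_step t = 0.
Proof. by move=> t0; rewrite /smooth_step flat1_0// mul0r. Qed.

Lemma smooth_step1 t : 1 <= t -> smooth_step t = 1.
Proof.
move=> t1; have := step_den_gt0 t; rewrite /smooth_step (@flat1_0 (1 - t)) ?subr_le0// addr0 => h.
by rewrite divff// gt_eqF.
Qed.

Definition dstep t := (flat 'X^2 t * flat1 (1 - t) + flat1 t * flat 'X^2 (1 - t)) /
  (flat1 t + flat1 (1 - t)) ^+ 2.

Lemma dstep_ge0 t : 0 <= dstep t.
Proof.
by rewrite /dstep divr_ge0 ?sqr_ge0// addr_ge0// mulr_ge0 ?flat1_ge0 ?flatX2_ge0.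
Qed.

Lemma is_derive_step t : is_derive t 1 smooth_step (dstep t).
Proof.
have h1 := is_derive_flat1 t.
have hs := is_derive_sub (is_derive_cst (1 : R) t 1) (is_derive_id t 1).
have h2 := is_derive_comp hs (is_derive_flat1 (1 - t)).
have dt := lt0r_neq0 (step_den_gt0 t).
have h3 := is_derive_inv (f := fun t => flat1 t + (flat1 \o (fun s => cst 1 s - id s)) t) dt (is_derive_add h1 h2).
have h4 := is_derive_prod h1 h3; apply: is_derive_congr h4 _ _ => //.
rewrite /dstep /=; set a := flat1 t in dt *; set b := flat1 (1 - t) in dt *.
by field.
Qed.

Lemma Ck_step n k (f : 'rV[R]_n -> R) : Ck k f -> Ck k (fun x => smooth_step (f x)).
Proof.
move=> hf; apply: Ck_mul; first exact: Ck_flat.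
apply: Ck_inv; first by move=> x; rewrite gt_eqF// step_den_gt0.
apply: Ck_add; first exact: Ck_flat.
by apply: Ck_flat; apply: Ck_sub => //; exact: Ck_cst.
Qed.

End flat.

(** * Lebesgue measure on row vectors *)

Section box_measure.
Context {R : realType}.
Local Notation leb n := (rV_lebesgue R n).

Definition box n (a b : 'I_n -> R) : set 'rV[R]_n :=
  [set x | forall i, a i < x ord0 i /\ x ord0 i < b i].
Definition cbox n (a b : 'I_n -> R) : set 'rV[R]_n :=
  [set x | forall i, a i <= x ord0 i /\ x ord0 i <= b i].

Lemma boxE n (a b : 'I_n -> R) :
  box a b = \bigcap_(i in [set: 'I_n]) ((fun x : 'rV[R]_n => x ord0 i) @^-1` `]a i, b i[).
Proof.
apply/seteqP; split => x /= h i; first by move=> _ /=; rewrite in_itv/=; apply/andP; exact: h.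
by have /= := h i I; rewrite in_itv/= => /andP.
Qed.

Lemma cboxE n (a b : 'I_n -> R) :
  cbox a b = \bigcap_(i in [set: 'I_n]) ((fun x : 'rV[R]_n => x ord0 i) @^-1` `[a i, b i]).
Proof.
apply/seteqP; split => x /= h i; first by move=> _ /=; rewrite in_itv/=; apply/andP; exact: h.
by have /= := h i I; rewrite in_itv/= => /andP.
Qed.

Lemma box_cbox n (a b : 'I_n -> R) : box a b `<=` cbox a b.
Proof. by move=> x h i; have [h1 h2] := h i; rewrite !ltW. Qed.

Lemma measurable_box n (a b : 'I_n -> R) : measurable (box a b).
Proof.
rewrite boxE; apply: fin_bigcap_measurable; first exact: finite_finset.
move=> i _; rewrite -[X in measurable X]setTI; apply: measurable_rV_coord => //.
Qed.

Lemma measurable_cbox n (a b : 'I_n -> R) : measurable (cbox a b).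
Proof.
rewrite cboxE; apply: fin_bigcap_measurable; first exact: finite_finset.
move=> i _; rewrite -[X in measurable X]setTI; apply: measurable_rV_coord => //.
Qed.

Lemma ball_box n (x : 'rV[R]_n) (r : R) : 0 < r ->
  ball x r = box (fun i => x ord0 i - r) (fun i => x ord0 i + r).
Proof.
move=> r0; apply/seteqP; split => y.
  by move=> [_ h] i; have := h ord0 i; rewrite /ball/= ltr_distlC => /andP[].
move=> h; split => // i j; rewrite (ord1 i) /ball/= ltr_distlC.
by have [-> ->] := h j.
Qed.

Lemma open_box n (a b : 'I_n -> R) : open (box a b).
Proof.
rewrite openE => x h; rewrite /interior /=.
have : \forall y \near x, forall i, a i < (y : 'rV[R]_n) ord0 i /\ y ord0 i < b i.
  apply: (@filter_forall _ 'I_n (fun i => [set y : 'rV[R]_n | a i < y ord0 i /\ y ord0 i < b i]) (nbhs x) _) => i.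
  have : open ((fun x : 'rV[R]_n => x ord0 i) @^-1` `]a i, b i[).
    apply: open_comp; last exact: itv_open.
    by move=> y _; exact: coord_continuous.
  rewrite openE => /(_ x); rewrite /= in_itv/=; have [-> ->] := h i => /(_ isT).
  by apply: filterS => y /=; rewrite in_itv/= => /andP.
by apply: filterS.
Qed.

Lemma compact_cbox n (a b : 'I_n -> R) : compact (cbox a b).
Proof.
have := @rV_compact R n (fun i => `[a i, b i]%classic) (fun i => @segment_compact R (a i) (b i)).
congr compact; apply/seteqP; split => x /= h i.
  by have := h i; rewrite in_itv/= => /andP.
by rewrite in_itv/=; apply/andP; exact: h.
Qed.

(** Rational corners make these boxes a countable basis; the closed companion [rcbox] supplies
    compact sets inside a given open set. *)
Definition rbox n (p : 'rV[rat]_n * 'rV[rat]_n) : set 'rV[R]_n :=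
  box (fun i => ratr (p.1 ord0 i)) (fun i => ratr (p.2 ord0 i)).
Definition rcbox n (p : 'rV[rat]_n * 'rV[rat]_n) : set 'rV[R]_n :=
  cbox (fun i => ratr (p.1 ord0 i)) (fun i => ratr (p.2 ord0 i)).

Lemma rbox_basis n (U : set 'rV[R]_n) (x : 'rV[R]_n) : open U -> U x ->
  exists2 p, rbox p x & rcbox p `<=` U.
Proof.
move=> oU Ux; have [e /= e0 he] := (nbhs_ballP x U).1 (open_nbhs_nbhs (conj oU Ux)).
have hq j : exists q : rat * rat, x ord0 j - e < ratr q.1 /\ ratr q.1 < x ord0 j /\
    x ord0 j < ratr q.2 /\ ratr q.2 < x ord0 j + e.
  have /rat_in_itvoo[q1] : x ord0 j - e < x ord0 j by lra.
  have /rat_in_itvoo[q2] : x ord0 j < x ord0 j + e by lra.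
  by rewrite !in_itv/= => /andP[? ?] /andP[? ?]; exists (q1, q2).
have [q hq'] := choice hq.
exists (\row_j (q j).1, \row_j (q j).2).
  by move=> i; rewrite !mxE; have [? [? [? ?]]] := hq' i.
move=> y hy; apply: he; rewrite (ball_box _ e0) => i; have [h1 [h2 [h3 h4]]] := hq' i.
have [] := hy i; rewrite !mxE => h5 h6; split; [exact: lt_le_trans h5|exact: le_lt_trans h4].
Qed.

Lemma open_bigcup_rbox n (U : set 'rV[R]_n) : open U ->
  U = \bigcup_(p in [set p | rcbox p `<=` U]) rbox p.
Proof.
move=> oU; apply/seteqP; split => [x Ux|x [p /= pU xp]].
  by have [p px pU] := rbox_basis oU Ux; exists p.
by apply: pU; exact: box_cbox.
Qed.

Lemma open_measurable_rV n (U : set 'rV[R]_n) : open U -> measurable U.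
Proof.
move=> oU; rewrite (open_bigcup_rbox oU).
rewrite (_ : \bigcup_(p in _) _ = \bigcup_p (if `[< rcbox p `<=` U >] then rbox p else set0)).
  apply: countable_bigcupT_measurable; first exact: countableP.
  by move=> p; case: ifP => _ //; exact: measurable_box.
apply/seteqP; split => x [p].
  by move=> /= pU xp; exists p => //; case: asboolP.
by move=> _; case: asboolP => // pU xp; exists p.
Qed.

Lemma continuous_measurable_rV n (U : set 'rV[R]_n) (f : 'rV[R]_n -> R) : open U ->
  (forall x, U x -> {for x, continuous f}) -> measurable_fun U f.
Proof.
move=> oU cf; apply: (measurability _ (RGenOpens.measurableE R)) => //.
move=> _ [_ [a [b ->]] <-].
apply: open_measurable_rV; rewrite openE => x [Ux Bx].
apply: filterI; first exact: open_nbhs_nbhs.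
by apply: cf => //; apply: open_nbhs_nbhs; split => //; exact: interval_open.
Qed.

Lemma rbox_cover n (x : 'rV[R]_n) : exists k : nat, box (fun=> - k.+1%:R) (fun=> k.+1%:R) x.
Proof.
exists (\max_i Num.truncn `|x ord0 i|)%N => i.
suff : `|x ord0 i| < (\max_i Num.truncn `|x ord0 i|).+1%:R :> R by rewrite ltr_norml => /andP.
apply: lt_le_trans (truncnS_gt _) _; rewrite ler_nat ltnS.
exact: (leq_bigmax (F := fun i => Num.truncn `|x ord0 i|) i).
Qed.

Definition boxes n : set (set 'rV[R]_n) := [set A | exists a b, A = box a b].

Lemma measurable_boxes n : @measurable _ 'rV[R]_n = <<s @boxes n >>.
Proof.
apply/seteqP; split; last first.
  apply: smallest_sub; first exact: sigma_algebra_measurable.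
  by move=> _ [a [b ->]]; exact: measurable_box.
apply: smallest_sub; first exact: smallest_sigma_algebra.
move=> A; rewrite -bigcup_seq => -[i _ [B mB <-]]; rewrite setTI.
have mi : measurable_fun [set: g_sigma_algebraType (@boxes n)] (@rV_coord R n i : g_sigma_algebraType (@boxes n) -> R).
  apply: (measurability _ (RGenOpens.measurableE R)) => //.
  move=> _ [_ [c [e ->]] <-]; rewrite setTI.
  (* A slab in the coordinate i is the increasing union of boxes with the other sides ]-(k + 1), k +
     1[. *)
  rewrite (_ : _ @^-1` _ = \bigcup_k box (fun j => if j == i then c else - k.+1%:R)
      (fun j => if j == i then e else k.+1%:R)).
    apply: bigcupT_measurable => k; apply: sub_sigma_algebra; by eexists; eexists.
  apply/seteqP; split => x.
    rewrite /= in_itv/= => /andP[x1 x2]; have [k hk] := rbox_cover x.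
    by exists k => // j; case: eqVneq => [->|_]; [|exact: hk].
  by move=> [k _ h] /=; rewrite in_itv/=; have := h i; rewrite eqxx => -[-> ->].
by have := mi measurableT B mB; rewrite setTI.
Qed.

Lemma boxI n (a b c d : 'I_n -> R) : box a b `&` box c d =
  box (fun i => Num.max (a i) (c i)) (fun i => Num.min (b i) (d i)).
Proof.
apply/seteqP; split => x /=.
  by move=> [h1 h2] i; rewrite gt_max lt_min; have [-> ->] := h1 i; have [-> ->] := h2 i.
by move=> h; split => i; have := h i; rewrite gt_max lt_min => -[/andP[? ?] /andP[? ?]].
Qed.

Lemma boxes_setI n : setI_closed (@boxes n).
Proof. by move=> _ _ [a [b ->]] [c [d ->]]; rewrite boxI; eexists; eexists. Qed.

Lemma integral_rV_cons n (f : 'rV[R]_n.+1 -> \bar R) : measurable_fun [set: 'rV[R]_n.+1] f ->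
  (forall x, 0 <= f x)%E ->
  (\int[leb n.+1]_x f x = \int[lebesgue_measure]_t \int[leb n]_x f (rV_cons (t, x)))%E.
Proof.
move=> mf f0.
rewrite -[LHS]/(\int[pushforward (@lebesgue_measure R \x leb n)%E (@rV_cons R n)]_x f x)%E.
have h := @ge0_integral_pushforward _ _ (measurableTypeR R * 'rV[R]_n)%type _ _ _ (@measurable_rV_cons R n)
  (@lebesgue_measure R \x leb n)%E setT f measurableT mf (fun y _ => f0 y).
etransitivity; [exact: h|rewrite preimage_setT].
apply: (@fubini_tonelli1 _ _ (measurableTypeR R) _ _ (@lebesgue_measure R) (leb n) (f \o (@rV_cons R n))) => [|z]; last exact: f0.
by apply: measurableT_comp => //; exact: measurable_rV_cons.
Qed.

(** The image measure under the translation agrees with Lebesgue measure on half-open intervals,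
    hence everywhere by uniqueness. *)
Lemma lebesgue_translation (a : R) (f : measurableTypeR R -> \bar R) : measurable_fun setT f ->
  (forall x, 0 <= f x)%E ->
  (\int[@lebesgue_measure R]_t f (t + a)%R = \int[@lebesgue_measure R]_t f t)%E.
Proof.
move=> mf f0.
have mt : measurable_fun (setT : set (measurableTypeR R)) (fun t : measurableTypeR R => (t + a)%R : measurableTypeR R).
  by apply: measurable_funD.
have := @ge0_integral_pushforward _ _ _ _ _ _ mt (@lebesgue_measure R) setT f measurableT mf (fun y _ => f0 y).
rewrite preimage_setT => <-.
apply: eq_measure_integral => A mA _; apply/esym/(@lebesgue_measure_unique _ (pushforward (@lebesgue_measure R) _)) => // X [[x y] _ <-].
transitivity (@lebesgue_measure R ((fun t : R => t + a) @^-1` `]x, y])); last by [].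
have -> : (fun t : R => t + a) @^-1` `]x, y] = `]x - a, y - a]%classic.
  by apply/seteqP; split => t /=; rewrite !in_itv/= ltrBlDr lerBrDr.
rewrite !lebesgue_measure_itv/= !lte_fin ltrD2r; case: ifP => // _.
by rewrite -!EFinD; congr EFin; ring.
Qed.

Lemma rV_consE0 n (z : R * 'rV[R]_n) : rV_cons z ord0 ord0 = z.1.
Proof.
by case: z => t x; have := rV_consK (t, x); rewrite /rV_uncons => -[-> _].
Qed.

Lemma rV_consES n (z : R * 'rV[R]_n) (j : 'I_n) : rV_cons z ord0 (lift ord0 j) = z.2 ord0 j.
Proof.
have -> : lift ord0 j = rshift 1 j by exact/val_inj.
exact: row_mxEr.
Qed.

Lemma rV_cons_add n (t : R) (x : 'rV[R]_n) (v : 'rV[R]_n.+1) :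
  rV_cons (t, x) + v = rV_cons (t + v ord0 ord0, x + rsubmx (v : 'rV[R]_(1 + n))).
Proof.
apply/matrixP => i j; rewrite (ord1 i) mxE; case: (unliftP ord0 j) => [k ->|->].
  rewrite !rV_consES/= !mxE; congr (_ + v _ _); exact/val_inj.
by rewrite !rV_consE0.
Qed.

(** Induction on the dimension through Tonelli: the last n coordinates by the induction hypothesis,
    then the first one by [lebesgue_translation]. *)
Lemma ge0_translation n (v : 'rV[R]_n) (f : 'rV[R]_n -> \bar R) :
  measurable_fun [set: 'rV[R]_n] f -> (forall x, 0 <= f x)%E ->
  (\int[leb n]_x f (x + v)%R = \int[leb n]_x f x)%E.
Proof.
elim: n v f => [|n ih] v f mf f0.
  by apply: eq_integral => x _; congr f; apply/matrixP => i [].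
have maddv : measurable_fun [set: 'rV[R]_n.+1] (fun x => x + v).
  apply: measurable_fun_rVP => i; under eq_fun do rewrite mxE.
  by apply: measurable_funD => //; exact: measurable_rV_coord.
rewrite integral_rV_cons//; last exact: measurableT_comp.
rewrite [RHS]integral_rV_cons//.
pose F t := (\int[leb n]_x f (rV_cons (t, x)))%E.
have mF : measurable_fun [set: R] F.
  apply: (@measurable_fun_fubini_tonelli_F _ _ _ _ _ (leb n) (f \o (@rV_cons R n))) => //.
    by apply: measurableT_comp => //; exact: measurable_rV_cons.
  by move=> z; exact: f0.
transitivity (\int[lebesgue_measure]_t F (t + v ord0 ord0)%R)%E.
  apply: eq_integral => t _; rewrite /F.
  under eq_integral do rewrite rV_cons_add.
  apply: (ih _ (fun x => f (rV_cons (t + v ord0 ord0, x)))) => //.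
  apply: measurableT_comp => //.
  by apply: (measurableT_comp (@measurable_rV_cons R n)); exact: measurable_pair1.
by apply: lebesgue_translation => // t; exact: integral_ge0.
Qed.

Lemma box_measure n (a b : 'I_n -> R) : (forall i, a i <= b i) ->
  leb n (box a b) = (\prod_i (b i - a i))%:E.
Proof.
elim: n a b => [|n ih] a b ab.
  rewrite big_ord0 (_ : box a b = setT) /=; first by rewrite diracT.
  by apply/seteqP; split => // x _ [].
have E : @rV_cons R n @^-1` (box a b) = `]a ord0, b ord0[%classic `*` box (a \o lift ord0) (b \o lift ord0).
  apply/seteqP; split => -[t x] /=.
    move=> h; split; first by have := h ord0; rewrite rV_consE0 in_itv/= => -[-> ->].
    by move=> j; have := h (lift ord0 j); rewrite rV_consES.
  rewrite in_itv/= => -[/andP[t1 t2] h] i; case: (unliftP ord0 i) => [k ->|->].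
    by rewrite rV_consES; exact: h.
  by rewrite rV_consE0.
rewrite -[LHS]/((@lebesgue_measure R \x leb n)%E (@rV_cons R n @^-1` (box a b))) E.
rewrite product_measure1E//; last exact: measurable_box.
rewrite (ih (a \o lift ord0) (b \o lift ord0)); last by move=> i; exact: ab.
rewrite [X in (X * _)%E](lebesgue_measure_itv `]a ord0, b ord0[)/= lte_fin; case: ltP => [_|h].
  by rewrite -EFinD -EFinM big_ord_recl.
rewrite mul0e big_ord_recl (_ : b ord0 - a ord0 = 0) ?mul0r//.
by apply/eqP; rewrite subr_eq0 eq_le h ab.
Qed.

End box_measure.

(** * Translations and difference quotients *)

Section calculus.
Context {R : realType} {n : nat}.
Local Notation T := 'rV[R]_n.
Local Notation mu := (rV_lebesgue R n).
Local Notation I f := (\int[mu]_(x in setT) f x).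
Local Notation intT := (intg mu setT).
Implicit Types (f g : T -> R) (K U : set T) (v x : T) (r : R).

Definition cube r : set T := cbox (fun=> - r) (fun=> r).

Lemma cubeP r x : cube r x <-> forall i, `|x ord0 i| <= r.
Proof.
split => h i; first by rewrite ler_norml; apply/andP; exact: h.
by have := h i; rewrite ler_norml => /andP.
Qed.

Lemma bounded_cube (A : set T) : bounded_set A -> exists2 r, 0 < r & A `<=` cube r.
Proof.
move=> [M [Mr hM]]; exists (`|M| + 2); first by rewrite ltr_wpDl.
move=> x Ax; have h : `|x| <= `|M| + 1 by apply: hM => //; rewrite ltr_pwDr// ler_norm.
have r0 : 0 < `|M| + 2 by rewrite ltr_wpDl.
have : ball (0 : T) (`|M| + 2) x by rewrite -ball_normE /ball_/= sub0r normrN (le_lt_trans h)// ltrD2l ltr1n.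
rewrite (ball_box _ r0) => hb i; have := hb i; rewrite mxE sub0r add0r => -[? ?]; by rewrite !ltW.
Qed.

Lemma compact_cube K : compact K -> exists2 r, 0 < r & K `<=` cube r.
Proof. by move=> /compact_bounded/bounded_cube. Qed.

Lemma measurable_cube r : measurable (cube r). Proof. exact: measurable_cbox. Qed.

Lemma cube_finite r : (mu (cube r) < +oo)%E.
Proof.
apply: (@le_lt_trans _ _ (mu (box (fun=> - (`|r| + 1)) (fun=> `|r| + 1)))).
  apply: le_measure; rewrite ?inE; [exact: measurable_cube|exact: measurable_box|].
  move=> x h i; have [h1 h2] := h i; have := ler_norm r; have := ler_norm (- r); rewrite normrN => *; split; lra.
rewrite box_measure ?ltry// => i; have := normr_ge0 r => ?; lra.
Qed.

Lemma compact_measurable_rV K : compact K -> measurable K.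
Proof.
move=> cK; rewrite -(setCK K); apply: measurableC; apply: open_measurable_rV.
by apply: closed_openC; apply: compact_closed => //; exact: norm_hausdorff.
Qed.

Lemma bounded_finite (A : set T) : measurable A -> bounded_set A -> (mu A < +oo)%E.
Proof.
move=> mA /bounded_cube[r r0 Ar]; apply: le_lt_trans (cube_finite r).
by apply: le_measure; rewrite ?inE//; exact: measurable_cube.
Qed.

Lemma compact_finite K : compact K -> (mu K < +oo)%E.
Proof. by move=> cK; apply: bounded_finite; [exact: compact_measurable_rV|exact: compact_bounded]. Qed.

Definition supp K f := forall x, ~ K x -> f x = 0.

Lemma restrict_supp K f : supp K f -> f \_ K = f.
Proof.
move=> h; apply/funext => x; rewrite patchE; case: ifPn => // /negP; rewrite inE => nK.
by rewrite h.
Qed.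

Lemma intg_restrict K f : measurable K -> intg mu K f <-> intT (f \_ K).
Proof.
move=> mK; rewrite /intg (integrable_mkcond (EFin \o f) mK) restrict_EFin; by split.
Qed.

Lemma intg_supp K f : measurable K -> supp K f -> intg mu K f -> intT f.
Proof. by move=> mK sf /(intg_restrict _ mK); rewrite restrict_supp. Qed.

Lemma RI_supp K f : supp K f -> \int[mu]_(x in K) f x = I f.
Proof. by move=> sf; rewrite Rintegral_mkcond restrict_supp. Qed.

Lemma intg_bnd_supp K f (C : R) : measurable K -> (mu K < +oo)%E -> measurable_fun setT f ->
  (forall x, `|f x| <= C) -> supp K f -> intT f.
Proof.
move=> mK fK mf hf sf; apply: (intg_supp mK sf); apply: (@intg_bnd _ _ _ _ _ mK fK _ C).
  exact: measurable_funTS.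
exact: aeW.
Qed.

Lemma cont_meas f : continuous f -> measurable_fun setT f.
Proof. by move=> cf; apply: (continuous_measurable_rV openT) => x _; exact: cf. Qed.

Lemma cont_bnd_compact K f : compact K -> continuous f -> exists2 C : R, 0 < C & forall x, K x -> `|f x| <= C.
Proof.
move=> cK cf; have := @continuous_compact _ _ f K (continuous_subspaceT cf) cK.
move=> /compact_bounded[M [Mr hM]]; exists (`|M| + 1); first by rewrite ltr_wpDl.
by move=> x Kx; apply: (hM (`|M| + 1)); [rewrite ltr_pwDr// ler_norm|exists x].
Qed.

Lemma cont_bnd K f : compact K -> continuous f -> supp K f -> exists2 C : R, 0 < C & forall x, `|f x| <= C.
Proof.
move=> cK cf sf; have [C C0 hC] := cont_bnd_compact cK cf; exists C => // x.
by have [/hC//|/sf->] := pselect (K x); rewrite normr0 (ltW C0).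
Qed.

Lemma cont_intg K f : compact K -> continuous f -> supp K f -> intT f.
Proof.
move=> cK cf sf; have [C _ hC] := cont_bnd cK cf sf.
apply: (intg_bnd_supp (compact_measurable_rV cK) (compact_finite cK) (cont_meas cf) hC sf).
Qed.

Lemma deriv_supp K f v : compact K -> supp K f -> supp K ('D_v f).
Proof.
move=> cK sf x nK; have oK : open (~` K).
  by apply: closed_openC; apply: compact_closed => //; exact: norm_hausdorff.
rewrite (@near_eq_derive _ _ _ f (cst 0) x v) ?derive_cst//.
by have := open_nbhs_nbhs (conj oK nK); apply: filterS => y /sf.
Qed.

Lemma measurable_add v : measurable_fun (setT : set T) (fun x : T => x + v).
Proof.
apply: measurable_fun_rVP => i; under eq_fun do rewrite mxE.
by apply: measurable_funD => //; exact: measurable_rV_coord.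
Qed.

Lemma RI_translation v f : measurable_fun setT f -> I (fun x => f (x + v)) = I f.
Proof.
move=> mf; rewrite /Rintegral; congr fine.
have mE : measurable_fun setT (EFin \o f) by exact/measurable_EFinP.
rewrite integralE [RHS]integralE; congr (_ - _)%E.
  have h := @ge0_translation _ _ v ((EFin \o f)^\+)%E (measurable_funepos mE) (fun x => funepos_ge0 _ x).
  by etransitivity; [|exact: h]; apply: eq_integral => x _; rewrite ?funeposE ?funenegE.
have h := @ge0_translation _ _ v ((EFin \o f)^\-)%E (measurable_funeneg mE) (fun x => funeneg_ge0 _ x).
by etransitivity; [|exact: h]; apply: eq_integral => x _; rewrite ?funeposE ?funenegE.
Qed.

Lemma intg_translation v f : intT f -> intT (fun x => f (x + v)).
Proof.
move=> /integrableP[mf h]; apply/integrableP; split.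
  by apply: (measurableT_comp mf); exact: measurable_add.
have e := @ge0_translation _ _ v (fun x => `|(EFin \o f) x|)%E (measurableT_comp (@abse_measurable _ _) mf) (fun x => abse_ge0 _).
by rewrite -e in h.
Qed.

Definition inat (m : nat) : R := m.+1%:R^-1.

Lemma inat_gt0 m : 0 < inat m. Proof. by rewrite invr_gt0 ltr0n. Qed.
Lemma inat_le1 m : inat m <= 1. Proof. by rewrite invf_le1 ?ltr0n// ler1n. Qed.

Lemma quot_cvg f x v l : is_derive x v f l ->
  (m.+1%:R * (f (x + inat m *: v) - f x)) @[m --> \oo] --> l.
Proof.
move=> [df <-].
have h : (h^-1 *: (f (h *: v + x) - f x)) @[h --> 0^'] --> 'D_v f x := df.
have h0 : inat m @[m --> \oo] --> 0^'.
  move=> A hA; change (\forall m \near \oo, A (inat m)).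
  have h2 : \forall m \near \oo, harmonic m != 0 :> R -> A (harmonic m) := @cvg_harmonic R _ hA.
  by apply: filterS h2 => m; apply; rewrite /= invr_eq0 pnatr_eq0.
have h1 := cvg_comp _ _ h0 h.
rewrite (_ : (fun m => _) = (fun h : R => h^-1 *: (f (h *: v + x) - f x)) \o inat)//.
by apply/funext => m /=; rewrite /inat invrK [x + _]addrC.
Qed.

Section quotients.
Variables (K : set T) (f : T -> R) (v : T).
Hypotheses (cK : compact K) (sf : supp K f) (cf : continuous f).
Hypotheses (df : forall x, derivable f x v) (cdf : continuous ('D_v f)).

Let q m x := m.+1%:R * (f (x + inat m *: v) - f x).

Let q_cont m : continuous (q m).
Proof.
move=> x.
have h1 : (fun y : T => f (y + inat m *: v)) y @[y --> x] --> f (x + inat m *: v).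
  apply: (@continuous_comp _ _ _ (fun y : T => y + inat m *: v) f); last exact: cf.
  exact: (cvgD (@cvg_id _ (nbhs x)) (cvg_cst (inat m *: v))).
have h2 : f y @[y --> x] --> f x := @cf x.
have h3 : (fun _ : T => m.+1%:R : R) y @[y --> x] --> (m.+1%:R : R) := @cst_continuous T R m.+1%:R x.
exact: (cvgM h3 (cvgB h1 h2)).
Qed.

(** The mean value theorem bounds the quotients by the supremum of the derivative, and steps of
    length at most 1 keep all supports in one cube: dominated convergence applies. *)
Let dom : exists C r : R, [/\ forall m x, `|q m x| <= C & forall m, supp (cube r) (q m)].
Proof.
have [r r0 Kr] := compact_cube cK.
have [s s0 vs] := compact_cube (@compact_set1 T v).
have [C C0 hC] := cont_bnd cK cdf (deriv_supp v cK sf).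
exists C, (r + s); split => m x.
  rewrite /q normrM gtr0_norm ?ltr0n//.
  have := lip_line df hC x (inat m); rewrite addrC (gtr0_norm (inat_gt0 m)) => h.
  by rewrite mulrC -ler_pdivlMr ?ltr0n// addrC [x + _]addrC.
move=> nK; have nx : ~ K x.
  by move=> /Kr/cubeP Kx; apply: nK; apply/cubeP => i; apply: le_trans (Kx i) _; rewrite lerDl ltW.
rewrite /q (sf nx) sf ?subrr ?mulr0// => /Kr/cubeP Kx; apply: nK; apply/cubeP => i.
have := Kx i; rewrite !mxE => h.
have hv : `|inat m * v ord0 i| <= s.
  rewrite normrM (gtr0_norm (inat_gt0 m)); have /cubeP/(_ i) hs := vs v erefl.
  by apply: le_trans _ hs; rewrite ler_piMl// inat_le1.
rewrite -[x ord0 i](addrK (inat m * v ord0 i)).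
by apply: le_trans (ler_normB _ _) _; exact: lerD.
Qed.

(** By translation invariance every difference quotient has integral 0, and the quotients converge
    to the derivative. *)
Lemma RI_deriv0 : I ('D_v f) = 0.
Proof.
have [C [r [hC sr]]] := dom.
have dct : I (q m) @[m --> \oo] --> I ('D_v f).
  apply: (@RI_dct _ _ _ _ _ measurableT q ('D_v f) (fun x => C * \1_(cube r) x)).
  - by move=> m; apply: cont_meas; exact: q_cont.
  - exact: cont_meas.
  - apply: (intg_bnd_supp (measurable_cube r) (cube_finite r) (C := `|C|)).
    + by apply: measurable_funM => //; apply: measurable_indic; exact: measurable_cube.
    + by move=> x; rewrite normrM ler_piMr// indicE; case: (_ \in _); rewrite ?normr1 ?normr0.
    + by move=> x nx; rewrite indicE memNset// mulr0.
  - by apply: aeW => x _; apply: quot_cvg; exact: derivableP.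
  - move=> m x _; rewrite indicE; case: (boolP (x \in cube r)) => [_|/negP]; first by rewrite mulr1.
    by rewrite inE => /sr->; rewrite normr0 mulr0.
have q0 m : I (q m) = 0.
  have fi : intT f by exact: cont_intg cf sf.
  rewrite /q RIZ//; last by apply: intgB => //; exact: intg_translation.
  rewrite RIB//; last exact: intg_translation.
  by rewrite RI_translation ?subrr ?mulr0//; exact: cont_meas.
have h : I (q m) @[m --> \oo] --> (0 : R) by apply: cvg_near_cst; apply: nearW => m; rewrite q0.
exact: cvg_unique dct h.
Qed.

(** Splitting the shift by v into m + 1 shifts by v / (m + 1) bounds the left side by the L1 norm of
    the quotient [q m]; then m tends to infinity. *)
Lemma RI_shift_le : I (fun x => `|f (x + v) - f x|) <= I (fun x => `|'D_v f x|).
Proof.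
have [C [r [hC sr]]] := dom.
have fi : intT f by exact: cont_intg cf sf.
have dct : I (fun x => `|q m x|) @[m --> \oo] --> I (fun x => `|'D_v f x|).
  apply: (@RI_dct _ _ _ _ _ measurableT (fun m x => `|q m x|) _ (fun x => C * \1_(cube r) x)).
  - by move=> m; apply: measurableT_comp => //; apply: cont_meas; exact: q_cont.
  - by apply: measurableT_comp => //; exact: cont_meas.
  - apply: (intg_bnd_supp (measurable_cube r) (cube_finite r) (C := `|C|)).
    + by apply: measurable_funM => //; apply: measurable_indic; exact: measurable_cube.
    + by move=> x; rewrite normrM ler_piMr// indicE; case: (_ \in _); rewrite ?normr1 ?normr0.
    + by move=> x nx; rewrite indicE memNset// mulr0.
  - by apply: aeW => x _; apply: cvg_norm; apply: quot_cvg; exact: derivableP.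
  - move=> m x _; rewrite normr_id indicE; case: (boolP (x \in cube r)) => [_|/negP]; first by rewrite mulr1.
    by rewrite inE => /sr->; rewrite normr0 mulr0.
have isub w : intT (fun x => `|f (x + w) - f x|).
  by apply: intg_norm => //; apply: intgB => //; exact: intg_translation.
have step w k : I (fun x => `|f (x + k%:R *: w) - f x|) <= k%:R * I (fun x => `|f (x + w) - f x|).
  elim: k => [|k ih].
    rewrite mul0r (_ : (fun x => _) = cst 0) ?Rintegral_cst ?mul0r//.
    by apply/funext => x; rewrite scale0r addr0 subrr normr0.
  apply: (@le_trans _ _ (I (fun x => `|f (x + w) - f x| + `|f (x + w + k%:R *: w) - f (x + w)|))).
    apply: RI_le => //; first by apply: intgD => //; apply: (intg_translation w (isub (k%:R *: w))).
    move=> x _; rewrite -natr1 scalerDl scale1r [k%:R *: w + w]addrC addrA addrC.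
    by rewrite [leRHS]addrC -{1}(subrKA (f (x + w))) ler_normD.
  rewrite RID//; last by apply: (intg_translation w (isub (k%:R *: w))).
  rewrite -natr1 mulrDl mul1r addrC lerD2r.
  by rewrite (RI_translation w (f := fun x => `|f (x + k%:R *: w) - f x|))//; exact: (intg_meas (isub _)).
have stepq m : I (fun x => `|f (x + v) - f x|) <= I (fun x => `|q m x|).
  have := step (inat m *: v) m.+1; rewrite scalerA divff ?pnatr_eq0// scale1r => h.
  apply: le_trans h _; rewrite -RIZ//; apply: RI_le => //.
  - by apply: intgZ.
  - by apply: intg_norm => //; apply: intgZ => //; apply: intgB => //; exact: intg_translation.
  - by move=> x _; rewrite /q normrM gtr0_norm ?ltr0n.
by apply: (ler_cvg_to (cvg_cst _) dct); apply: nearW.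
Qed.

End quotients.

End calculus.

(** * Test functions and weak derivatives *)

Section test_functions.
Context {R : realType} {n : nat}.
Local Notation T := 'rV[R]_n.
Local Notation mu := (rV_lebesgue R n).
Local Notation I f := (\int[mu]_(x in setT) f x).
Implicit Types (f g phi psi : T -> R) (U : set T) (v x : T) (i : 'I_n).

Lemma test_cont U phi : test_function U phi -> continuous phi.
Proof. by move=> [/(_ 0%N)[]]. Qed.

Lemma test_deriv U phi i : test_function U phi -> test_function U ('D_(evec i) phi).
Proof.
move=> [hk [K [cK KU sK]]]; split; first by move=> k; exact: CkSD (hk k.+1).
by exists K; split => //; exact: deriv_supp.
Qed.

Lemma test_is_derive U phi i x : test_function U phi -> is_derive x (evec i) phi ('D_(evec i) phi x).
Proof. by move=> [h _]; exact: (CkS_is_derive i x (h 1%N)). Qed.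

Lemma test_supp U phi : test_function U phi -> supp U phi.
Proof. by move=> [_ [K [_ KU sK]]] x nU; apply: sK => /KU. Qed.

Lemma test_bnd U phi : test_function U phi -> exists2 C : R, 0 < C & forall x, `|phi x| <= C.
Proof. by move=> h; have [_ [K [cK _ sK]]] := h; exact: (cont_bnd cK (test_cont h) sK). Qed.

Lemma test_intg U phi : test_function U phi -> intg mu setT phi.
Proof. by move=> h; have [_ [K [cK _ sK]]] := h; exact: (cont_intg cK (test_cont h) sK). Qed.

Lemma RI_test U f phi : test_function U phi ->
  \int[mu]_(x in U) (f x * phi x) = I (fun x => f x * phi x).
Proof. by move=> h; apply: RI_supp => x /(test_supp h)->; rewrite mulr0. Qed.

(** [RI_deriv0] for the product; compact support of one factor is enough. *)
Lemma by_parts (K : set T) phi psi i : compact K -> supp K psi ->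
  Ck 1 phi -> Ck 1 psi ->
  I (fun x => phi x * 'D_(evec i) psi x) = - I (fun x => 'D_(evec i) phi x * psi x).
Proof.
move=> cK sK h1 h2.
have e : 'D_(evec i) (fun x => phi x * psi x) =
    (fun x => 'D_(evec i) phi x * psi x + phi x * 'D_(evec i) psi x).
  apply/funext => x; have := is_derive_prod (CkS_is_derive i x h1) (CkS_is_derive i x h2).
  by case.
have h3 : Ck 1 (fun x => phi x * psi x) by exact: Ck_mul.
have s3 : supp K (fun x => phi x * psi x) by move=> x /sK->; rewrite mulr0.
have h0 := RI_deriv0 cK s3 (Ck_continuous h3) (CkS_derivable (i := i) h3) (Ck_continuous (CkSD i h3)).
rewrite e RID// in h0; first by apply/eqP; rewrite -addr_eq0 addrC h0.
- apply: (@cont_intg _ _ K) => //; last by move=> x /sK->; rewrite mulr0.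
  by apply: (@Ck_continuous _ _ 0); apply: Ck_mul; [exact: CkSD|exact: CkS_le].
- apply: (@cont_intg _ _ K) => //; last by move=> x /(deriv_supp (evec i) cK sK)->; rewrite mulr0.
  by apply: (@Ck_continuous _ _ 0); apply: Ck_mul; [exact: CkS_le|exact: CkSD].
Qed.

Lemma open_not_null U : open U -> U !=set0 -> ~ (mu.-negligible U).
Proof.
move=> oU [x Ux] neg; have [e /= e0 he] := (nbhs_ballP x U).1 (open_nbhs_nbhs (conj oU Ux)).
have : mu.-negligible (ball x e) by apply: negligibleS neg.
rewrite (ball_box _ e0) => h; have h0 := (negligibleP mu (measurable_box _ _)).1 h.
have := @box_measure R n (fun i => x ord0 i - e) (fun i => x ord0 i + e).
rewrite h0 => h1; have /(@EFin_inj R 0)/esym/eqP := h1 (fun i => ltac:(lra)).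
apply/negP; rewrite gt_eqF//; apply: prodr_gt0 => i _; lra.
Qed.

(** The points of U where g < f form an open null set, and a nonempty open set contains a box of
    positive measure. *)
Lemma cont_ae_le U f g : open U -> {in U, continuous f} -> {in U, continuous g} ->
  {ae mu, forall x, U x -> f x <= g x} -> forall x, U x -> f x <= g x.
Proof.
move=> oU cf cg h x0 Ux0; rewrite leNgt; apply/negP => lt0.
have oV : open [set x | U x /\ g x < f x].
  rewrite openE => x [Ux ltx]; apply: filterI; first exact: open_nbhs_nbhs.
  have h1 : (f y - g y) @[y --> x] --> f x - g x.
    have h2 : f y @[y --> x] --> f x := cf x (mem_set Ux).
    have h3 : g y @[y --> x] --> g x := cg x (mem_set Ux).
    exact: (cvgB h2 h3).
  have : \forall y \near x, 0 < f y - g y by apply: (cvgr_gt _ h1); rewrite subr_gt0.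
  by apply: filterS => y; rewrite subr_gt0.
apply: (open_not_null oV); first by exists x0.
apply: negligibleS h => x [Ux ltx] /= /(_ Ux); by rewrite leNgt ltx.
Qed.

Section box_bump.
Variables c d : 'I_n -> R.

Definition bump x : R := \prod_i (flat1 (x ord0 i - c i) * flat1 (d i - x ord0 i)).

Lemma Ck_bump k : Ck k bump.
Proof.
apply: (@Ck_prod _ _ _ _ _ _ (fun i (x : T) => flat1 (x ord0 i - c i) * flat1 (d i - x ord0 i))) => i.
apply: Ck_mul; apply: Ck_flat; apply: Ck_sub; try exact: Ck_coord; exact: Ck_cst.
Qed.

Lemma bump_gt0 x : box c d x -> 0 < bump x.
Proof.
by move=> h; apply: prodr_gt0 => i _; have [h1 h2] := h i; rewrite mulr_gt0// flat1_gt0// subr_gt0.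
Qed.

Lemma bump_ge0 x : 0 <= bump x.
Proof. by apply: prodr_ge0 => i _; rewrite mulr_ge0// flat1_ge0. Qed.

Lemma bump_supp : supp (box c d) bump.
Proof.
move=> x nb; have [i hi] : exists i, ~ (c i < x ord0 i /\ x ord0 i < d i).
  by apply: contrapT => /forallNP h; apply: nb => i; have /contrapT := h i.
rewrite /bump (bigD1 i)//=; have [h1|h1] := leP (x ord0 i) (c i).
  by rewrite flat1_0 ?subr_le0// !mul0r.
by rewrite (@flat1_0 _ (d i - _)) ?mulr0 ?mul0r// subr_le0 leNgt; apply/negP => h2; apply: hi.
Qed.

Definition box_test k x : R := 1 - expR (- (k%:R * bump x)).

Lemma box_test_test U k : cbox c d `<=` U -> test_function U (box_test k).
Proof.
move=> cU; split.
  move=> m; apply: Ck_sub; first exact: Ck_cst.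
  by apply: Ck_exp; apply: Ck_opp; apply: Ck_mul; [exact: Ck_cst|exact: Ck_bump].
exists (cbox c d); split => //; first exact: compact_cbox.
move=> x nx; rewrite /box_test bump_supp ?mulr0 ?oppr0 ?expR0 ?subrr//.
by move=> /box_cbox.
Qed.

Lemma box_test_supp k : supp (box c d) (box_test k).
Proof. by move=> x /bump_supp h; rewrite /box_test h mulr0 oppr0 expR0 subrr. Qed.

Lemma box_test_norm k x : `|box_test k x| <= 1.
Proof.
have h : expR (- (k%:R * bump x)) <= 1.
  by rewrite -expR0 ler_expR oppr_le0 mulr_ge0// ?ler0n ?bump_ge0.
have := expR_ge0 (- (k%:R * bump x)).
by rewrite /box_test ler_norml => *; apply/andP; split; lra.
Qed.

Lemma box_test_cvg x : box c d x -> box_test k x @[k --> \oo] --> (1 : R).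
Proof.
move=> hx; rewrite -[X in _ --> X]subr0; apply: cvgB; first exact: cvg_cst.
rewrite (_ : (fun k => _) = GRing.exp (expR (- bump x))).
  by apply: cvg_expr; rewrite ger0_norm ?expR_ge0// -expR0 ltr_expR oppr_lt0 bump_gt0.
by apply/funext => k; rewrite -expRM_natl mulrN.
Qed.

End box_bump.

Section fundamental_lemma.
Variables (U : set T) (g : T -> R).
Hypotheses (oU : open U) (Lg : loc_integrable U g).
Hypothesis hg : forall phi, test_function U phi -> \int[mu]_(x in U) (g x * phi x) = 0.

Let ibox c d : cbox c d `<=` U -> intg mu (box c d) g.
Proof.
move=> cU; have := Lg.2 _ (@compact_cbox _ _ c d) cU.
apply: integrableS; [exact: measurable_cbox|exact: measurable_box|exact: box_cbox].
Qed.

Let hbox c d : cbox c d `<=` U -> \int[mu]_(x in box c d) g x = 0.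
Proof.
move=> cU.
have dct : \int[mu]_(x in box c d) (g x * box_test c d k x) @[k --> \oo] --> \int[mu]_(x in box c d) g x.
  apply: (@RI_dct _ _ _ _ _ (measurable_box c d) (fun k x => g x * box_test c d k x) g (fun x => `|g x|)).
  - move=> k; apply: measurable_funM; first exact: intg_meas (ibox cU).
    by apply: measurable_funTS; apply: cont_meas; exact: test_cont (box_test_test k cU).
  - exact: intg_meas (ibox cU).
  - apply: intg_norm; [exact: measurable_box|exact: ibox].
  - apply: aeW => x hx; rewrite -[X in _ --> X]mulr1.
    by apply: cvgM; [exact: cvg_cst|exact: box_test_cvg].
  - by move=> k x _; rewrite normrM ler_piMr// box_test_norm.
apply: (cvg_unique _ dct) => //; apply: cvg_near_cst; apply: nearW => k.
rewrite -(hg (box_test_test k cU)) (RI_test _ (box_test_test k cU)).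
by apply: RI_supp => x /box_test_supp->; rewrite mulr0.
Qed.

Let hmeas p A : rcbox p `<=` U -> measurable A -> \int[mu]_(x in rbox p `&` A) g x = 0.
Proof.
move=> pU; have mD : measurable (rbox p : set T) by exact: measurable_box.
have iA B : measurable B -> intg mu (rbox p `&` B) g.
  by move=> mB; apply: integrableS (ibox pU) => //; exact: measurableI.
rewrite (@measurable_boxes R n).
apply: (@dynkin_induction _ _ _ (fun A : set T => \int[mu]_(x in rbox p `&` A) g x = 0) (measurable_boxes n) (@boxes_setI R n)).
- by rewrite setIT; exact: hbox.
- move=> _ [a [b ->]]; rewrite boxI; apply: hbox => x h; apply: pU => i.
  by have := h i; rewrite ge_max le_min => -[/andP[? ?] /andP[? ?]].
- move=> S mS hS; have := hbox pU.
  have e : rbox p = (rbox p `&` S) `|` (rbox p `&` ~` S) by rewrite -setIUr setUCr setIT.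
  rewrite -/(rbox p) [X in \int[mu]_(x in X) _]e Rintegral_setU.
  + by rewrite hS add0r.
  + exact: measurableI.
  + by apply: measurableI => //; exact: measurableC.
  + by rewrite -e; exact: (ibox pU).
  + by apply/disj_setPS => x [[_ ?] [_]].
- move=> F mF tF hF; rewrite setI_bigcupr /Rintegral integral_bigcup//.
  + rewrite eseries0// => k _ _.
    have := EFin_RI (measurableI _ _ mD (mF k)) (iA _ (mF k)); rewrite hF => <-.
    by [].
  + by apply: trivIset_setIl.
  + by move=> k; exact: measurableI.
  + rewrite -setI_bigcupr; apply: iA; exact: bigcupT_measurable.
Qed.

(* The test functions 1 - exp(-k b), b a bump supported by a box, increase to
   the indicator function of the box; boxes generate the Borel sets. *)
Lemma fundamental_lemma : {ae mu, forall x, U x -> g x = 0}.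
Proof.
have hp p : rcbox p `<=` U -> {ae mu, forall x, rbox p x -> g x = 0}.
  move=> pU; have mD : measurable (rbox p : set T) by exact: measurable_box.
  have h : ae_eq mu (rbox p) (EFin \o g) (cst 0%E).
    apply: (integral_ae_eq mD) => //; first exact: (ibox pU).
    move=> E ED mE; rewrite integral0 -(setIidr ED).
    have mI : measurable (rbox p `&` E) by exact: measurableI.
    by rewrite -(EFin_RI mI) ?hmeas//; exact: integrableS (ibox pU).
  by apply: filterS h => x h /h/= [].
(* Enumerating the rational boxes by [unpickle] merges countably many a.e. statements into one. *)
have : {ae mu, forall x, forall m, if unpickle m is Some p then rcbox p `<=` U -> rbox p x -> g x = 0 else True}.
  apply: ae_foralln => m; case: (unpickle m) => [p|]; last exact: aeW.
  have [pU|npU] := pselect (rcbox p `<=` U); last exact: aeW.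
  by apply: filterS (hp p pU) => x h _.
apply: filterS => x h Ux; have [p px pU] := rbox_basis oU Ux.
by have := h (pickle p); rewrite pickleK; apply.
Qed.

End fundamental_lemma.

Lemma loc_intg_test U f phi : open U -> loc_integrable U f -> test_function U phi ->
  intg mu U (fun x => f x * phi x).
Proof.
move=> oU Lf tphi; have mU := open_measurable_rV oU.
have [_ [K [cK KU sK]]] := tphi; have mK := compact_measurable_rV cK.
have [C C0 hC] := test_bnd tphi.
apply/(intg_restrict _ mU); rewrite restrict_supp; last by move=> x /(test_supp tphi)->; rewrite mulr0.
apply: (@intg_supp _ _ K) => //; first by move=> x /sK->; rewrite mulr0.
have iK : intg mu K (fun x => C * `|f x|) by apply: intgZ => //; apply: intg_norm => //; exact: Lf.2.
apply: (intg_le mK _ iK); last by move=> x _; rewrite normrM mulrC ler_wpM2r.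
apply: measurable_funM; first by apply: measurable_funS Lf.1.
by apply: measurable_funTS; apply: cont_meas; exact: test_cont tphi.
Qed.

Lemma weak_partial_unique U i u g g' : open U ->
  is_weak_partial U i u g -> is_weak_partial U i u g' ->
  {ae mu, forall x, U x -> g x = g' x}.
Proof.
move=> oU [_ Lg hg] [_ Lg' hg']; have mU := open_measurable_rV oU.
have : {ae mu, forall x, U x -> (fun x => g x - g' x) x = 0}.
  apply: fundamental_lemma => //.
    split; first by apply: measurable_funB; [exact: Lg.1|exact: Lg'.1].
    move=> K cK KU; apply: (@intgB _ _ _ _ _ (compact_measurable_rV cK)).
      exact: Lg.2.
    exact: Lg'.2.
  move=> phi tphi.
  have ip h (Lh : loc_integrable U h) := loc_intg_test oU Lh tphi.
  transitivity (\int[mu]_(x in U) (g x * phi x - g' x * phi x)).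
    by apply: eq_Rintegral => x _; rewrite mulrBl.
  rewrite RIB//; [|exact: ip|exact: ip].
  by have := hg _ tphi; rewrite hg'// => /oppr_inj->; rewrite subrr.
by apply: filterS => x h /h/eqP; rewrite subr_eq0 => /eqP.
Qed.

End test_functions.

(** * Closure of the test functions in H1 *)

Section L2_convergence.
Context d (T : measurableType d) (R : realType).
Variables (mu : {measure set T -> \bar R}) (D : set T).
Hypotheses (mD : measurable D) (fD : (mu D < +oo)%E).
Local Notation I f := (\int[mu]_(x in D) f x).
Local Notation L2 := (L2 mu D).
Local Notation nm2 := (nm2 mu D).
Implicit Types (a : nat -> T -> R) (b : T -> R).

Definition cv2 a b := nm2 (fun x => a k x - b x) @[k --> \oo] --> (0 : R).

Lemma cv2P a b : cv2 a b <->
  forall e : R, 0 < e -> exists n, forall k, (n <= k)%N -> nm2 (fun x => a k x - b x) <= e.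
Proof.
split=> [h e e0|h].
  have /cvgrPdist_le/(_ _ e0)[n _ hn] := h; exists n => k nk; have := hn k nk.
  by rewrite sub0r normrN ger0_norm// nm2_ge0.
apply/cvgrPdist_le => e e0; have [n hn] := h e e0; exists n => // k /= nk.
by rewrite sub0r normrN ger0_norm ?nm2_ge0// hn.
Qed.

Lemma to2P (J : finType) (W : nat -> J -> T -> R) Z :
  to2 mu D W Z <-> forall j, cv2 (fun k => W k j) (Z j).
Proof.
split=> [h j|h e e0].
  by apply/cv2P => e e0; have [n hn] := h e e0; exists n => k nk; exact: hn.
have : \forall k \near \oo, forall j, nm2 (fun x => W k j x - Z j x) <= e.
  apply: (@filter_forall _ J (fun j k => nm2 (fun x => W k j x - Z j x) <= e)) => j.
  by have /cv2P/(_ e e0)[n hn] := h j; exists n.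
by move=> [n _ hn]; exists n => k nk j; exact: hn.
Qed.

Lemma cv2_le (C : R) a b a' b' :
  (forall k, nm2 (fun x => a k x - b x) <= C * nm2 (fun x => a' k x - b' x)) ->
  cv2 a' b' -> cv2 a b.
Proof.
move=> h c; apply: (@squeeze_cvgr _ _ _ _ (cst 0) (fun k => C * nm2 (fun x => a' k x - b' x))).
- by apply: nearW => k; rewrite h nm2_ge0.
- exact: cvg_cst.
- by rewrite -(mulr0 C); apply: cvgMr.
Qed.

Lemma cv2D a b a' b' : (forall k, L2 (a k)) -> L2 b -> (forall k, L2 (a' k)) -> L2 b' ->
  cv2 a b -> cv2 a' b' -> cv2 (fun k x => a k x + a' k x) (fun x => b x + b' x).
Proof.
move=> La Lb La' Lb' h h'.
apply: (@squeeze_cvgr _ _ _ _ (cst 0) (fun k => nm2 (fun x => a k x - b x) + nm2 (fun x => a' k x - b' x))).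
- apply: nearW => k; rewrite nm2_ge0/= (@eq_nm2 _ _ _ _ _ _ (fun x => (a k x - b x) + (a' k x - b' x))).
    by apply: nm2D => //; apply: L2B.
  by move=> x _; ring.
- exact: cvg_cst.
- by rewrite -(addr0 0); apply: cvgD.
Qed.

Lemma cv2_I a b a' b' : (forall k, L2 (a k)) -> L2 b -> (forall k, L2 (a' k)) -> L2 b' ->
  cv2 a b -> cv2 a' b' -> I (fun x => a k x * a' k x) @[k --> \oo] --> I (fun x => b x * b' x).
Proof.
move=> La Lb La' Lb' h h'.
pose n1 k := nm2 (fun x => a k x - b x); pose n2 k := nm2 (fun x => a' k x - b' x).
apply/cvgrPdist_le => e e0.
have : n1 k * n2 k + n1 k * nm2 b' + nm2 b * n2 k @[k --> \oo] --> (0 : R).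
  have -> : (0 : R) = 0 * 0 + 0 * nm2 b' + nm2 b * 0 by ring.
  by apply: cvgD; [apply: cvgD; [exact: cvgM|apply: cvgMl]|apply: cvgMr].
move=> /cvgrPdist_le/(_ _ e0); apply: filterS => k.
rewrite sub0r normrN ger0_norm; last by rewrite !addr_ge0 ?mulr_ge0 ?nm2_ge0.
apply: le_trans; rewrite distrC -RIB//; [|exact: L2mul|exact: L2mul].
have Ld : L2 (fun x => a k x - b x) by exact: L2B.
have Ld' : L2 (fun x => a' k x - b' x) by exact: L2B.
have -> : I (fun x => a k x * a' k x - b x * b' x) = I (fun x => (a k x - b x) * (a' k x - b' x)) +
    I (fun x => (a k x - b x) * b' x) + I (fun x => b x * (a' k x - b' x)).
  have i1 := L2mul mD Ld Ld'; have i2 := L2mul mD Ld Lb'; have i3 := L2mul mD Lb Ld'.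
  rewrite -(RID mD i1 i2) -(RID mD (intgD mD i1 i2) i3).
  by apply: eq_Rintegral => x _; ring.
apply: le_trans (ler_normD _ _) _; apply: lerD; last exact: cauchy_schwarz.
by apply: le_trans (ler_normD _ _) _; apply: lerD; exact: cauchy_schwarz.
Qed.

Lemma cv2_I1 a b g : (forall k, L2 (a k)) -> L2 b -> L2 g ->
  cv2 a b -> I (fun x => a k x * g x) @[k --> \oo] --> I (fun x => b x * g x).
Proof.
move=> La Lb Lg h; apply: cv2_I => //.
(* The zero difference is written 0 * 0 so that [nm2Z] computes its norm. *)
apply/cv2P => e e0; exists 0%N => k _; rewrite (@eq_nm2 _ _ _ _ _ _ (fun=> 0 * 0)).
  rewrite nm2Z ?normr0 ?mul0r ?(ltW e0)//.
  exact: L2_cst.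
by move=> x _; rewrite subrr mul0r.
Qed.

End L2_convergence.

(** * Membership in Lp in terms of integrals and a.e. bounds *)

Section Lp_spaces.
Context {R : realType} {n : nat}.
Local Notation mu := (rV_lebesgue R n).
Implicit Types (U : set 'rV[R]_n) (u v : 'rV[R]_n -> R).

Lemma restrict_measurable U u : measurable U ->
  measurable_fun U u <-> measurable_fun setT (u \_ U).
Proof. by move=> mU; exact: (measurable_restrictT u mU). Qed.

Lemma Lp2P U u : measurable U -> Lp 2%:E U u <-> L2 mu U u.
Proof.
move=> mU.
have e : (fun x => (u \_ U) x ^+ 2) = (fun x => u x ^+ 2) \_ U.
  by apply/funext => x; rewrite !patchE; case: ifP => // _; rewrite expr0n.
split=> [h|[mu_ iu]].
  split; first by apply/(restrict_measurable _ mU); have /andP[] := h; rewrite inE.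
  apply/(intg_restrict _ mU); rewrite -e.
  exact: (Lfun2_integrable_sqr h).
apply/andP; split; first by rewrite inE; apply/(restrict_measurable _ mU).
rewrite inE /= /finite_norm unlock /= poweR_lty//.
have /integrableP[_] := (intg_restrict _ mU).1 iu; rewrite -e.
congr (_ < _)%E; apply: eq_integral => x _ /=.
by rewrite powR_mulrn ?normr_ge0// normrX.
Qed.

Lemma L2_distE U u v : measurable U -> L2 mu U (fun x => u x - v x) ->
  L2_dist U u v = (nm2 mu U (fun x => u x - v x))%:E.
Proof.
move=> mU Lw; rewrite /L2_dist unlock /=.
have e : (\int[mu]_x ((`|((u \- v) \_ U) x| `^ 2)%:E))%E = (\int[mu]_(x in U) ((u x - v x) ^+ 2)%:E)%E.
  rewrite [RHS]integral_mkcond; apply: eq_integral => x _.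
  rewrite powR_mulrn// real_normK ?num_real// !patchE/=; case: ifP => // _; by rewrite expr0n.
rewrite [X in (X `^ _)%E]e -EFin_RI//; last exact: L2_sqr.
by rewrite poweR_EFin powR12_sqrt// I2_ge0.
Qed.

Lemma LooP U u : measurable U -> Lp +oo%E U u ->
  measurable_fun U u /\ exists2 C : R, 0 < C & {ae mu, forall x, U x -> `|u x| <= C}.
Proof.
move=> mU h; split; first by apply/(restrict_measurable _ mU); have /andP[] := h; rewrite inE.
have /andP[_] := h; rewrite inE/= /finite_norm unlock /=; case: ifPn => [_ hs|].
  have [M hM] := @ess_sup_inf.ess_supr_bounded _ _ _ mu (fun x => `|(u \_ U) x|) hs.
  exists (`|M| + 1); first by rewrite ltr_wpDl.
  apply: filterS hM => x hM Ux; have := hM; rewrite patchE mem_set// => h1.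
  apply: le_trans h1 _; apply: le_trans (ler_norm _) _; by rewrite lerDl.
(* The remaining branch of the norm is that of a space of measure zero, where any constant is an
   a.e. bound. *)
rewrite -leNgt measure_le0 => /eqP m0 _; exists 1 => //.
by exists setT; split => //.
Qed.

End Lp_spaces.

Section H0.
Context {R : realType} {n : nat}.
Local Notation T := 'rV[R]_n.
Local Notation mu := (rV_lebesgue R n).
Variables (Om : set T) (oO : open Om) (bO : bounded_set Om).
Let mO : measurable Om := open_measurable_rV oO.
Let fO : (mu Om < +oo)%E := bounded_finite mO bO.
Local Notation I f := (\int[mu]_(x in Om) f x).
Local Notation L2 := (L2 mu Om).
Local Notation nm2 := (nm2 mu Om).
Local Notation J := (option 'I_n).
Implicit Types (phi psi : T -> R) (U V W Z : J -> T -> R).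

(* A function is handled together with its gradient, as a family indexed by
   option 'I_n: the component None is the function itself and Some i its i-th
   partial derivative. *)
Definition fam phi (j : J) : T -> R := if j is Some i then 'D_(evec i) phi else phi.

(** The gradient is part of the data, as an L2 limit of gradients of test functions, so sums and
    limits need no chosen weak derivative. [H10_H0] and [H0_weak_partial] relate it to [H10]. *)
Definition H0 W := (forall j, L2 (W j)) /\
  exists2 phi : nat -> T -> R, (forall k, test_function Om (phi k)) &
    forall j, cv2 mu Om (fun k => fam (phi k) j) (W j).

Lemma cont_bnd_L2 f (C : R) : continuous f -> (forall x, Om x -> `|f x| <= C) -> L2 f.
Proof.
move=> cf hC; apply: (@L2_bnd _ _ _ _ _ mO fO _ C).
  by apply: measurable_funTS; exact: cont_meas.
exact: aeW.
Qed.

Lemma test_L2 phi : test_function Om phi -> L2 phi.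
Proof.
by move=> h; have [C _ hC] := test_bnd h; apply: (@cont_bnd_L2 _ C) => //; exact: test_cont h.
Qed.

Lemma fam_test phi j : test_function Om phi -> test_function Om (fam phi j).
Proof. by case: j => //= i; exact: test_deriv. Qed.

Lemma fam_L2 phi j : test_function Om phi -> L2 (fam phi j).
Proof. by move=> h; apply: test_L2; exact: fam_test. Qed.

Lemma test_lin (a b : R) phi psi : test_function Om phi -> test_function Om psi ->
  test_function Om (fun x => a * phi x + b * psi x).
Proof.
move=> [hk [K [cK KU sK]]] [hk' [K' [cK' KU' sK']]]; split.
  by move=> k; apply: Ck_add; apply: Ck_mul => //; exact: Ck_cst.
exists (K `|` K'); split; first exact: compactU.
  by move=> x [/KU|/KU'].
move=> x nK; rewrite sK ?sK' ?mulr0 ?addr0// => h; apply: nK; by [left|right].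
Qed.

Lemma fam_lin (a b : R) phi psi j x : test_function Om phi -> test_function Om psi ->
  fam (fun x => a * phi x + b * psi x) j x = a * fam phi j x + b * fam psi j x.
Proof.
case: j => //= i h h'.
have d1 := is_derive_prod (is_derive_cst a x (evec i)) (test_is_derive i x h).
have d2 := is_derive_prod (is_derive_cst b x (evec i)) (test_is_derive i x h').
have [_ ->] := is_derive_add d1 d2.
by rewrite !mul0r !add0r.
Qed.

Lemma H0_lin (a b : R) U V : H0 U -> H0 V -> H0 (fun j x => a * U j x + b * V j x).
Proof.
move=> [LU [phi tphi cU]] [LV [psi tpsi cV]]; split.
  by move=> j; apply: L2D => //; exact: L2Z.
exists (fun k x => a * phi k x + b * psi k x); first by move=> k; exact: test_lin.
move=> j; have La k := fam_L2 j (tphi k); have Lb k := fam_L2 j (tpsi k).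
rewrite (_ : (fun k => _) = (fun k x => a * fam (phi k) j x + b * fam (psi k) j x)); last first.
  by apply/funext => k; apply/funext => x; rewrite fam_lin.
have cZ c f g : (forall k, L2 (f k)) -> L2 g -> cv2 mu Om f g ->
    cv2 mu Om (fun k x => c * f k x) (fun x => c * g x).
  move=> Lf Lg; apply: (@cv2_le _ _ _ _ _ `|c|) => k.
  rewrite -nm2Z//; last exact: L2B.
  have -> : nm2 (fun x => c * f k x - c * g x) = nm2 (fun x => c * (f k x - g x)).
    by apply: eq_nm2 => x _; rewrite mulrBr.
  by [].
apply: cv2D => //; try (by move=> *; exact: L2Z); exact: cZ.
Qed.

Lemma H0_ae W W' : H0 W -> (forall j, L2 (W' j)) ->
  (forall j, {ae mu, forall x, Om x -> W j x = W' j x}) -> H0 W'.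
Proof.
move=> [LW [phi tphi cW]] LW' h; split => //; exists phi => // j.
apply: (@cv2_le _ _ _ _ _ 1 _ _ (fun k => fam (phi k) j) (W j)) (cW j) => k; rewrite mul1r.
have Lf := fam_L2 j (tphi k).
apply: nm2_le_ae => //; [exact: L2B|exact: L2B|].
by apply: filterS (h j) => x h1 Ox; rewrite h1.
Qed.

(** Diagonal choice: at rank k, a test function within 1 / (k + 1) of a [W m] that is itself within
    1 / (k + 1) of [Z]. *)
Lemma H0_closed (W : nat -> J -> T -> R) Z : (forall k, H0 (W k)) -> (forall j, L2 (Z j)) ->
  to2 mu Om W Z -> H0 Z.
Proof.
move=> HW LZ h; split => //.
have hk (k : nat) : exists phi, test_function Om phi /\ forall j,
    nm2 (fun x => fam phi j x - Z j x) <= 2 * harmonic k.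
  have h0 : 0 < harmonic k :> R by rewrite invr_gt0 ltr0n.
  have [m hm] := h _ h0; have [LW [phi tphi /to2P/(_ _ h0)[p hp]]] := HW m.
  exists (phi p); split => // j; have Lf := fam_L2 j (tphi p).
  rewrite (@eq_nm2 _ _ _ _ _ _ (fun x => (fam (phi p) j x - W m j x) + (W m j x - Z j x))); last first.
    by move=> x _; ring.
  apply: le_trans (nm2D mO _ _) _; [exact: L2B|exact: L2B|].
  by rewrite mulr_natl mulr2n; apply: lerD; [exact: hp|exact: hm].
have [phi hphi] := choice hk; exists phi; first by move=> k; have [] := hphi k.
move=> j; apply: (@squeeze_cvgr _ _ _ _ (cst 0) (fun k => 2 * harmonic k)).
- by apply: nearW => k; have [_ ->] := hphi k; rewrite nm2_ge0.
- exact: cvg_cst.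
- by rewrite -(mulr0 2); apply: cvgMr; exact: cvg_harmonic.
Qed.

Lemma L2_loc f : L2 f -> loc_integrable Om f.
Proof.
move=> Lf; split; first exact: L2_meas Lf.
move=> K cK KO; apply: integrableS (L2_intg mO fO Lf) => //; exact: compact_measurable_rV.
Qed.

Lemma H0_weak W i : H0 W -> is_weak_partial Om i (W None) (W (Some i)).
Proof.
move=> [LW [phi tphi cW]]; split; [exact: L2_loc|exact: L2_loc|] => psi tpsi.
have h1 := cv2_I1 mO fO (fun k => fam_L2 None (tphi k)) (LW None) (test_L2 (test_deriv i tpsi)) (cW None).
have h2 := cv2_I1 mO fO (fun k => fam_L2 (Some i) (tphi k)) (LW (Some i)) (test_L2 tpsi) (cW (Some i)).
apply: (cvg_unique _ h1) => //.
rewrite (_ : (fun k => _) = (fun k => - I (fun x => fam (phi k) (Some i) x * psi x))); first exact: cvgN.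
apply/funext => k /=; have [Cp [K [cK KO sK]]] := tpsi.
rewrite (RI_test _ (test_deriv i tpsi)) (RI_test _ tpsi).
apply: (by_parts _ cK sK) => //; by have [] := tphi k.
Qed.

Lemma H0_weak_partial W i : H0 W ->
  weakly_derivable Om i (W None) /\ {ae mu, forall x, Om x -> weak_partial Om i (W None) x = W (Some i) x}.
Proof.
move=> HW; have h := H0_weak i HW; split; first by exists (W (Some i)).
apply: (weak_partial_unique oO _ h); exact: (@xgetI _ (fun=> 0) _ _ h).
Qed.

Lemma weak_partial_loc u i : weakly_derivable Om i u -> is_weak_partial Om i u (weak_partial Om i u).
Proof. by move=> [g hg]; exact: (@xgetI _ (fun=> 0) _ _ hg). Qed.

Definition wfam (u : T -> R) (j : J) : T -> R := if j is Some i then weak_partial Om i u else u.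

Lemma H10_H0 u : H10 Om u <-> H0 (wfam u) /\ forall i, weakly_derivable Om i u.
Proof.
split.
  move=> [Lu hi [phi [tphi c0 ci]]]; split; last by move=> i; have [] := hi i.
  have LW j : L2 (wfam u j) by case: j => [i|] /=; apply/(Lp2P _ mO) => //; have [] := hi i.
  split => //; exists phi => // j.
  have Ld k : L2 (fun x => wfam u j x - fam (phi k) j x) by apply: L2B => //; exact: fam_L2.
  have : L2_dist Om (wfam u j) (fam (phi k) j) @[k --> \oo] --> 0%E by case: j {Ld} => [i|] /=.
  rewrite /cv2 (_ : (fun k => L2_dist _ _ _) = (fun k => (nm2 (fun x => fam (phi k) j x - wfam u j x))%:E)).
    by move=> /fine_cvgP[].
  by apply/funext => k; rewrite L2_distE// nm2C.
move=> [[LW [phi tphi cW]] wd]; split.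
- by apply/(Lp2P _ mO); exact: (LW None).
- by move=> i; split => //; apply/(Lp2P _ mO); exact: (LW (Some i)).
- have hj j : L2_dist Om (wfam u j) (fam (phi k) j) @[k --> \oo] --> 0%E.
    have Ld k : L2 (fun x => wfam u j x - fam (phi k) j x) by apply: L2B => //; exact: fam_L2.
    rewrite (_ : (fun k => L2_dist _ _ _) = (fun k => (nm2 (fun x => fam (phi k) j x - wfam u j x))%:E)).
      by apply: cvg_EFin; [exact: nearW|exact: cW].
    by apply/funext => k; rewrite L2_distE// nm2C.
  exists phi; split => //; [exact: (hj None)|move=> i; exact: (hj (Some i))].
Qed.

End H0.

(** * Lipschitz bounds for tanh and the flat functions *)

Section lipschitz_functions.
Context {R : realType}.
Implicit Types (p : {poly R}) (s t e : R).

Lemma lip_of_derive (b b' : R -> R) (C : R) : (forall t, is_derive t 1 b (b' t)) ->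
  (forall t, `|b' t| <= C) -> forall s t, `|b s - b t| <= C * `|s - t|.
Proof.
move=> hd hC s t.
have h1 x : derivable b x 1 by have [] := hd x.
have h2 x : `|'D_1 b x| <= C by have [_ ->] := hd x.
by have := lip_line h1 h2 t (s - t); rewrite scaler1 subrK.
Qed.

Lemma derive_continuous (b b' : R -> R) : (forall t, is_derive t 1 b (b' t)) -> continuous b.
Proof.
move=> hd t; apply: differentiable_continuous; apply/derivable1_diffP.
by have [] := hd t.
Qed.

Lemma is_derive_tanh t : is_derive t 1 tanh (1 - tanh t ^+ 2).
Proof.
have h0 : is_derive t 1 (fun s : R => 2 * s) 2.
  have h := is_derive_prod (is_derive_cst (2 : R) t 1) (is_derive_id t 1).
  by apply: is_derive_congr h _ _ => //; rewrite mul0r add0r mulr1.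
have h1 := is_derive_comp h0 (is_derive_expR (2 * t)).
have h2 := is_derive_add h1 (is_derive_cst (1 : R) t 1).
have nz : expR (2 * t) + 1 != 0 by rewrite gt_eqF// addr_gt0// expR_gt0.
have h3 := is_derive_inv (f := fun s => (expR \o (fun s => 2 * s)) s + cst 1 s) nz h2.
have h4 := is_derive_prod (is_derive_cst (2 : R) t 1) h3.
have h5 := is_derive_sub (is_derive_cst (1 : R) t 1) h4.
apply: is_derive_congr h5 _ _ => //.
by rewrite /tanh /=; set a := expR (2 * t) in nz *; field.
Qed.

Lemma tanh_lip s t : `|tanh s - tanh t| <= `|s - t|.
Proof.
have := lip_of_derive is_derive_tanh (C := 1) _ s t; rewrite mul1r; apply => x.
by rewrite ger0_norm ?dtanh_le1// dtanh_ge0.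
Qed.

(** A smooth truncation at height e, with slope between 0 and 1. *)
Definition soft e s : R := e * tanh (s / e).

Lemma is_derive_soft e t : 0 < e -> is_derive t 1 (soft e) (1 - tanh (t / e) ^+ 2).
Proof.
move=> e0; have h0 := is_derive_prod (is_derive_id t 1) (is_derive_cst (e^-1 : R) t 1).
have h1 := is_derive_comp h0 (is_derive_tanh (t / e)).
have h2 := is_derive_prod (is_derive_cst (e : R) t 1) h1.
apply: is_derive_congr h2 _ _ => //=; rewrite mul0r add0r mulr0 addr0 mul1r.
by rewrite mulrCA divff ?mulr1// gt_eqF.
Qed.

Lemma soft_lip e s t : 0 < e -> `|soft e s - soft e t| <= `|s - t|.
Proof.
move=> e0; have := lip_of_derive (fun t => is_derive_soft t e0) (C := 1) _ s t.
by rewrite mul1r; apply => x; rewrite ger0_norm ?dtanh_le1// dtanh_ge0.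
Qed.

Lemma dsoft_lip e s t : 0 < e ->
  `|(1 - tanh (s / e) ^+ 2) - (1 - tanh (t / e) ^+ 2)| <= 2 / e * `|s - t|.
Proof.
move=> e0; set a := tanh (s / e); set b := tanh (t / e).
have -> : 1 - a ^+ 2 - (1 - b ^+ 2) = (b - a) * (a + b) by ring.
rewrite normrM mulrC (mulrAC 2) -mulrA; apply: ler_pM => //.
  by apply: le_trans (ler_normD _ _) _; have := tanh_norm (s / e); have := tanh_norm (t / e); rewrite -/a -/b => *; lra.
rewrite distrC; apply: le_trans (tanh_lip _ _) _.
by rewrite -mulrBl normrM (gtr0_norm (x := e^-1)) ?invr_gt0.
Qed.

Lemma flat_bnd p : exists2 C : R, 0 < C & forall t, `|flat p t| <= C.
Proof.
have [C C0 hC] := poly_le_exp p (a := 1) ltr01; exists C => // t.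
have [t0|t0] := ltP 0 t; last by rewrite flat_npos// normr0 ltW.
rewrite flat_pos// normrM (gtr0_norm (expR_gt0 _)) expRN ler_pdivrMr ?expR_gt0//.
by have := hC t^-1; rewrite mul1r; apply; rewrite invr_ge0 ltW.
Qed.

Lemma flat_lip p : exists2 C : R, 0 < C & forall s t, `|flat p s - flat p t| <= C * `|s - t|.
Proof.
have [C C0 hC] := flat_bnd ('X^2 * (p - p^`())); exists C => //.
exact: lip_of_derive (is_derive_flat p) hC.
Qed.

Lemma continuous_flat p : continuous (flat p).
Proof. exact: derive_continuous (is_derive_flat p). Qed.

End lipschitz_functions.

(** * Convergence in L2 by domination *)

Section domination.
Context d (T : measurableType d) (R : realType).
Variables (mu : {measure set T -> \bar R}) (D : set T).
Hypotheses (mD : measurable D) (fD : (mu D < +oo)%E).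
Local Notation L2 := (L2 mu D).
Local Notation nm2 := (nm2 mu D).
Implicit Types (a : nat -> T -> R) (b : T -> R).

Lemma L2_norm b : L2 b -> L2 (fun x => `|b x|).
Proof.
move=> [mb ib]; split; first exact: measurableT_comp.
by apply: eq_intg ib => // x _; rewrite real_normK ?num_real.
Qed.

Lemma nm2_norm b : nm2 (fun x => `|b x|) = nm2 b.
Proof. by congr Num.sqrt; apply: eq_Rintegral => x _; rewrite real_normK ?num_real. Qed.

Lemma cv2_dom (C1 C2 : R) a b a1 b1 a2 b2 : 0 <= C1 -> 0 <= C2 ->
  (forall k, L2 (fun x => a k x - b x)) -> (forall k, L2 (fun x => a1 k x - b1 x)) ->
  (forall k, L2 (fun x => a2 k x - b2 x)) ->
  (forall k, {ae mu, forall x, D x ->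
     `|a k x - b x| <= C1 * `|a1 k x - b1 x| + C2 * `|a2 k x - b2 x|}) ->
  cv2 mu D a1 b1 -> cv2 mu D a2 b2 -> cv2 mu D a b.
Proof.
move=> C10 C20 L L1' L2' h h1 h2.
apply: (@squeeze_cvgr _ _ _ _ (cst 0)
  (fun k => C1 * nm2 (fun x => a1 k x - b1 x) + C2 * nm2 (fun x => a2 k x - b2 x))).
- apply: nearW => k; rewrite nm2_ge0/=.
  have l1 := L2Z mD C1 (L2_norm (L1' k)); have l2 := L2Z mD C2 (L2_norm (L2' k)).
  apply: (@le_trans _ _ (nm2 (fun x => C1 * `|a1 k x - b1 x| + C2 * `|a2 k x - b2 x|))).
    apply: nm2_le_ae => //; first exact: L2D.
    by apply: filterS (h k) => x hx Dx; apply: le_trans (hx Dx) _; exact: ler_norm.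
  apply: le_trans (nm2D mD l1 l2) _; rewrite !nm2Z//; [|exact: L2_norm|exact: L2_norm].
  by rewrite !nm2_norm !ger0_norm.
- exact: cvg_cst.
- have -> : (0 : R) = C1 * 0 + C2 * 0 by ring.
  by apply: cvgD; apply: cvgMr.
Qed.

Lemma cv2_lip (C : R) a b a1 b1 : 0 <= C ->
  (forall k, L2 (fun x => a k x - b x)) -> (forall k, L2 (fun x => a1 k x - b1 x)) ->
  (forall k, {ae mu, forall x, D x -> `|a k x - b x| <= C * `|a1 k x - b1 x|}) ->
  cv2 mu D a1 b1 -> cv2 mu D a b.
Proof.
move=> C0 L L' h h1; apply: (cv2_dom C0 (lexx 0) L L' L' _ h1 h1) => k.
by apply: filterS (h k) => x; rewrite mul0r addr0.
Qed.

End domination.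

(** * Truncation and sup bounds in the closure of the test functions *)

Section H0_calculus.
Context {R : realType} {n : nat}.
Local Notation T := 'rV[R]_n.
Local Notation mu := (rV_lebesgue R n).
Variables (Om : set T) (oO : open Om) (bO : bounded_set Om).
Let mO : measurable Om := open_measurable_rV oO.
Let fO : (mu Om < +oo)%E := bounded_finite mO bO.
Local Notation I f := (\int[mu]_(x in Om) f x).
Local Notation L2 := (L2 mu Om).
Local Notation J := (option 'I_n).
Local Notation H0 := (H0 Om).

Let mcomp (b : R -> R) (f : T -> R) : continuous b -> measurable_fun Om f ->
  measurable_fun Om (fun x => b (f x)).
Proof.
by move=> cb mf; apply: (measurableT_comp (f := b)) => //; exact: continuous_measurable_fun.
Qed.

Lemma continuous_dsoft (e : R) : continuous (fun s : R => 1 - tanh (s / e) ^+ 2).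
Proof.
move=> s; have h : tanh (t / e) @[t --> s] --> tanh (s / e).
  apply: (@continuous_comp _ _ _ (fun t : R => t / e) tanh); last exact: continuous_tanh.
  exact: (cvgMl (cvg_id)).
by apply: cvgB; [exact: cvg_cst|exact: (cvgM h h)].
Qed.

Lemma continuous_soft (e : R) : 0 < e -> continuous (soft e).
Proof. by move=> e0; apply: (derive_continuous (fun t => is_derive_soft t e0)). Qed.

Lemma soft0 (e : R) : soft e 0 = 0. Proof. by rewrite /soft mul0r tanh0 mulr0. Qed.

(** The approximations are [soft e] of those of [W]. In the gradient, the difference of the two
    slopes multiplies W (Some i); it is Lipschitz in the function, so an a.e. bound on W (Some i)
    keeps the product small in L2. *)
Lemma H0_soft (W : J -> T -> R) (e B : R) : 0 < e -> 0 < B -> H0 W ->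
  (forall i, {ae mu, forall x, Om x -> `|W (Some i) x| <= B}) ->
  H0 (fun j x => if j is Some i then (1 - tanh (W None x / e) ^+ 2) * W (Some i) x
                 else soft e (W None x)).
Proof.
move=> e0 B0 [LW [phi tphi cW]] hB.
have Lb (b : R -> R) (C : R) f : continuous b -> (forall t, `|b t| <= C) -> measurable_fun Om f ->
    L2 (fun x => b (f x)).
  move=> cb hb mf; apply: (L2_bnd mO fO (C := C)); first exact: mcomp.
  exact: aeW.
have soft_bnd t : `|soft e t| <= e.
  by rewrite /soft normrM (gtr0_norm e0) ler_piMr ?(ltW e0)// tanh_norm.
have ds_bnd t : `|1 - tanh (t / e) ^+ 2| <= 1 by rewrite ger0_norm ?dtanh_le1// dtanh_ge0.
have mW j := L2_meas (LW j).
have LZ (i : R) (f g : T -> R) : measurable_fun Om f -> {ae mu, forall x, Om x -> `|g x| <= i} -> measurable_fun Om g ->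
    L2 (fun x => (1 - tanh (f x / e) ^+ 2) * g x).
  move=> mf hg mg; apply: (L2_bnd mO fO (C := i)).
    by apply: measurable_funM => //; exact: (mcomp (@continuous_dsoft e) mf).
  apply: filterS hg => x h Ox; rewrite normrM; apply: le_trans (h Ox).
  by rewrite ler_piMl.
split.
  case=> [i|]; last by apply: (Lb _ e) => //; exact: continuous_soft.
  by apply: LZ (hB i) _.
pose psi k x := soft e (phi k x).
have dpsi k i x : is_derive x (evec i) (psi k) ((1 - tanh (phi k x / e) ^+ 2) * 'D_(evec i) (phi k) x).
  exact: (is_derive_comp (test_is_derive i x (tphi k)) (is_derive_soft _ e0)).
exists psi.
  move=> k; have [hk [K [cK KO sK]]] := tphi k; split.
    move=> m; apply: Ck_mul; first exact: Ck_cst.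
    by apply: Ck_tanh; apply: Ck_mul => //; exact: Ck_cst.
  by exists K; split => // x nK; rewrite /psi sK// soft0.
have Lphi k j := fam_L2 oO bO j (tphi k).
have mphi k j := L2_meas (Lphi k j).
have Ls k : L2 (psi k) := Lb _ _ _ (continuous_soft e0) soft_bnd (mphi k None).
have LsW : L2 (fun x => soft e (W None x)) := Lb _ _ _ (continuous_soft e0) soft_bnd (mW None).
case=> [i|] /=; last first.
  apply: (@cv2_lip _ _ _ _ _ mO 1) (cW None) => //.
  - by move=> k; exact: L2B.
  - by move=> k; apply: L2B => //; exact: (Lphi k None).
  - by move=> k; apply: aeW => x _; rewrite mul1r; exact: soft_lip.
rewrite (_ : (fun k => _) = (fun k x => (1 - tanh (phi k x / e) ^+ 2) * 'D_(evec i) (phi k) x)); last first.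
  by apply/funext => k; apply/funext => x; have [_ ->] := dpsi k i x.
have LA k : L2 (fun x => (1 - tanh (phi k x / e) ^+ 2) * 'D_(evec i) (phi k) x).
  have [C _ hC] := test_bnd (test_deriv i (tphi k)).
  apply: (LZ C) => //; [exact: (mphi k None)|exact: aeW|exact: (mphi k (Some i))].
have LB : L2 (fun x => (1 - tanh (W None x / e) ^+ 2) * W (Some i) x) by apply: LZ (hB i) _.
apply: (@cv2_dom _ _ _ _ _ mO 1 (2 / e * B)) (cW (Some i)) (cW None) => //.
- by rewrite mulr_ge0 ?divr_ge0 ?ltW.
- by move=> k; exact: L2B.
- by move=> k; apply: L2B => //; exact: (Lphi k (Some i)).
- by move=> k; apply: L2B => //; exact: (Lphi k None).
move=> k; apply: filterS (hB i) => x h Ox /=.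
set s := phi k x; set t := W None x; set Ds := 'D_(evec i) (phi k) x; set Wi := W (Some i) x.
have -> : (1 - tanh (s / e) ^+ 2) * Ds - (1 - tanh (t / e) ^+ 2) * Wi =
  (1 - tanh (s / e) ^+ 2) * (Ds - Wi) + ((1 - tanh (s / e) ^+ 2) - (1 - tanh (t / e) ^+ 2)) * Wi by ring.
apply: le_trans (ler_normD _ _) _; apply: lerD.
  by rewrite normrM; apply: ler_pM.
rewrite normrM (mulrAC (2 / e)); apply: ler_pM => //; first exact: dsoft_lip.
exact: h.
Qed.

(* Testing D_i (q beta(p u - 1)) with q = exp(-x_i), p = exp(-x_i - c) and a
   nondecreasing beta vanishing on the negative half line gives
   int q beta(pu - 1) = int q beta'(pu - 1) p (D_i u - u), and p D_i u <= 1. *)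
Lemma sup_bound (W : J -> T -> R) (i : 'I_n) (r L : R) : 0 <= L -> Om `<=` cube r -> H0 W ->
  {ae mu, forall x, Om x -> W (Some i) x <= L} ->
  {ae mu, forall x, Om x -> W None x <= expR (2 * r + L)}.
Proof.
move=> L0 Or [LW [phi tphi cW]] hL.
pose q (x : T) := expR (- x ord0 i).
(* The shift r + L gives p <= exp(- L) on the cube, hence both p <= 1 and p L <= 1. *)
pose p (x : T) := expR (- x ord0 i - (r + L)).
(* The derivative of [flat1], which plays the part of beta. *)
pose b := flat ('X^2 : {poly R}).
have q0 x : 0 < q x by exact: expR_gt0.
have p0 x : 0 < p x by exact: expR_gt0.
have ci : forall k, Ck k (fun x : T => x ord0 i) by move=> k; exact: Ck_coord.
have Cq k : Ck k q by apply: Ck_exp; exact: Ck_opp.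
have Cp k : Ck k p by apply: Ck_exp; apply: Ck_sub; [exact: Ck_opp|exact: Ck_cst].
have Ok x : Om x -> - r <= x ord0 i /\ x ord0 i <= r by move=> /Or/(_ i).
have pL x : Om x -> p x * L <= 1.
  move=> /Ok[h _]; apply: (@le_trans _ _ (expR (- L) * L)).
    by rewrite ler_wpM2r// ler_expR; lra.
  have := expR_ge1Dx L; rewrite expRN mulrC ler_pdivrMr ?expR_gt0// mul1r => h2; lra.
have p1 x : Om x -> p x <= 1.
  by move=> /Ok[h _]; rewrite -[X in _ <= X]expR0 ler_expR; lra.
have qb x : Om x -> q x <= expR r by move=> /Ok[h _]; rewrite ler_expR; lra.
have mp : measurable_fun Om p by apply: measurable_funTS; apply: cont_meas; exact: Ck_continuous (Cp 0%N).
have mq : measurable_fun Om q by apply: measurable_funTS; apply: cont_meas; exact: Ck_continuous (Cq 0%N).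
have dq x : is_derive x (evec i) q (- q x).
  have h := is_derive_sub (is_derive_cst (0 : R) x (evec i)) (is_derive_coord i i x).
  have h2 := is_derive_comp h (is_derive_expR _).
  apply: is_derive_congr h2 _ _; first by apply/funext => y; rewrite /q /= sub0r.
  by rewrite eqxx /= /q /cst !sub0r mulrN mulr1.
have dp x : is_derive x (evec i) p (- p x).
  have h := is_derive_sub (is_derive_cst (- (r + L) : R) x (evec i)) (is_derive_coord i i x).
  have h2 := is_derive_comp h (is_derive_expR _).
  apply: is_derive_congr h2 _ _; first by apply/funext => y; rewrite /p /= addrC.
  by rewrite eqxx /= /p /cst sub0r mulrN mulr1 [- (r + L) - _]addrC.
pose a k x := q x * flat1 (p x * phi k x - 1).
pose a' k x := b (p x * phi k x - 1).
pose d k x := q x * (p x * ('D_(evec i) (phi k) x - phi k x)).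
(* The integral of D_i (a k) vanishes, and D_i q = - q makes [a k] itself appear in that
   derivative. *)
have id k : I (a k) = I (fun x => a' k x * d k x).
  have [hk [K [cK KO sK]]] := tphi k.
  have C1 m : Ck m (a k).
    by apply: Ck_mul => //; apply: Ck_flat; apply: Ck_sub; [exact: Ck_mul|exact: Ck_cst].
  have sa : supp K (a k) by move=> x /sK h; rewrite /a h mulr0 flat1_0 ?mulr0//; lra.
  have da x : 'D_(evec i) (a k) x = a' k x * d k x - a k x.
    have h1 := is_derive_prod (dp x) (test_is_derive i x (tphi k)).
    have h2 := is_derive_sub h1 (is_derive_cst (1 : R) x (evec i)).
    have h3 := is_derive_comp h2 (is_derive_flat1 _).
    have [_ ->] := is_derive_prod (dq x) h3.
    by rewrite /a /a' /d /= /b; ring.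
  have h0 := RI_deriv0 cK sa (Ck_continuous (C1 0%N)) (CkS_derivable (i := i) (C1 1%N)) (Ck_continuous (CkSD i (C1 1%N))).
  have sOa : supp Om (a k) by move=> x nO; apply: sa => /KO.
  have sOd : supp Om ('D_(evec i) (a k)) by move=> x nO; apply: (deriv_supp (evec i) cK sa) => /KO.
  rewrite -(RI_supp sOd) in h0.
  have ia : intg mu Om (a k).
    have [C _ hC] := cont_bnd cK (Ck_continuous (C1 0%N)) sa.
    by apply: L2_intg => //; apply: (cont_bnd_L2 oO bO (C := C)) => //; exact: Ck_continuous (C1 0%N).
  have ida : intg mu Om ('D_(evec i) (a k)).
    have c1 := Ck_continuous (CkSD i (C1 1%N)).
    have [C _ hC] := cont_bnd cK c1 (deriv_supp (evec i) cK sa).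
    by apply: L2_intg => //; apply: (cont_bnd_L2 oO bO (C := C)).
  rewrite -[LHS](addr0 _) -h0 -RID//; apply: eq_Rintegral => x _.
  by rewrite da addrC subrK.
have Lphi k j := fam_L2 oO bO j (tphi k).
have mphi k j := L2_meas (Lphi k j).
have mW j := L2_meas (LW j).
have [C1 C10 hC1] := flat_bnd (1 : {poly R}).
have [C2 C20 hC2] := flat_lip (1 : {poly R}).
have [C3 C30 hC3] := flat_bnd ('X^2 : {poly R}).
have [C4 C40 hC4] := flat_lip ('X^2 : {poly R}).
have mlin (f : T -> R) : measurable_fun Om f -> measurable_fun Om (fun x => p x * f x - 1).
  by move=> mf; apply: measurable_funB => //; exact: measurable_funM.
have mfl P (f : T -> R) : measurable_fun Om f -> measurable_fun Om (fun x => flat P (p x * f x - 1)).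
  by move=> mf; apply: (mcomp (@continuous_flat _ P)); exact: mlin.
have La (f : T -> R) : measurable_fun Om f -> L2 (fun x => q x * flat1 (p x * f x - 1)).
  move=> mf; apply: (L2_bnd mO fO (C := expR r * C1)).
    by apply: measurable_funM => //; exact: mfl.
  apply: aeW => x Ox; rewrite normrM (gtr0_norm (q0 x)); apply: ler_pM => //; [exact: ltW|exact: qb|exact: hC1].
have La' (f : T -> R) : measurable_fun Om f -> L2 (fun x => b (p x * f x - 1)).
  move=> mf; apply: (L2_bnd mO fO (C := C3)); first exact: mfl.
  by apply: aeW => x Ox; exact: hC3.
have Lqp (f : T -> R) : L2 f -> L2 (fun x => q x * (p x * f x)).
  move=> Lf; have [mf if2] := Lf; split.
    by apply: measurable_funM => //; exact: measurable_funM.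
  apply: (intg_le mO _ (intgZ mO (expR r ^+ 2) if2)).
    by apply: measurable_funX; apply: measurable_funM => //; exact: measurable_funM.
  move=> x Ox; rewrite ger0_norm ?sqr_ge0// exprMn; apply: ler_pM; rewrite ?sqr_ge0//.
    by rewrite ler_sqr ?nnegrE ?(ltW (q0 x)) ?expR_ge0//; exact: qb.
  rewrite exprMn ler_piMl ?sqr_ge0//; have h1 := p1 x Ox; have h2 := p0 x; nra.
have n1 k : L2 (fun x => phi k x - W None x) by apply: L2B => //; exact: (Lphi k None).
have n2 k : L2 (fun x => 'D_(evec i) (phi k) x - W (Some i) x) by apply: L2B => //; exact: (Lphi k (Some i)).
have dlin k x : Om x -> `|(p x * phi k x - 1) - (p x * W None x - 1)| <= `|phi k x - W None x|.
  move=> Ox; have -> : (p x * phi k x - 1) - (p x * W None x - 1) = p x * (phi k x - W None x) by ring.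
  by rewrite normrM (gtr0_norm (p0 x)) ler_piMl// p1.
have ca : cv2 mu Om a (fun x => q x * flat1 (p x * W None x - 1)).
  apply: (@cv2_lip _ _ _ _ _ mO (expR r * C2)) (cW None) => //.
  - by rewrite mulr_ge0 ?expR_ge0 ?(ltW C20).
  - by move=> k; apply: L2B => //; apply: La => //; exact: (mphi k None).
  move=> k; apply: aeW => x Ox; rewrite -mulrBr normrM (gtr0_norm (q0 x)) -mulrA.
  apply: ler_pM => //; [exact: ltW|exact: qb|].
  by apply: le_trans (hC2 _ _) _; rewrite ler_pM2l//; exact: dlin.
have ca' : cv2 mu Om a' (fun x => b (p x * W None x - 1)).
  apply: (@cv2_lip _ _ _ _ _ mO C4) (cW None) => //; first exact: ltW.
  - by move=> k; apply: L2B => //; apply: La' => //; exact: (mphi k None).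
  move=> k; apply: aeW => x Ox.
  by apply: le_trans (hC4 _ _) _; rewrite ler_pM2l//; exact: dlin.
have Ld (f g : T -> R) : L2 f -> L2 g -> L2 (fun x => q x * (p x * (f x - g x))).
  by move=> Lf Lg; apply: Lqp; exact: L2B.
have cd : cv2 mu Om d (fun x => q x * (p x * (W (Some i) x - W None x))).
  apply: (@cv2_dom _ _ _ _ _ mO (expR r) (expR r)) (cW (Some i)) (cW None) => //; rewrite ?expR_ge0//.
  - by move=> k; apply: L2B => //; apply: Ld => //; [exact: (Lphi k (Some i))|exact: (Lphi k None)].
  move=> k; apply: aeW => x Ox; rewrite /d -mulrBr -mulrBr normrM (gtr0_norm (q0 x)) -mulrDr.
  apply: ler_pM => //; [exact: ltW|exact: qb|rewrite normrM (gtr0_norm (p0 x))].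
  apply: (@le_trans _ _ (1 * (`|'D_(evec i) (phi k) x - W (Some i) x| + `|phi k x - W None x|))); last by rewrite mul1r.
  apply: ler_pM => //; [exact: ltW|exact: p1|].
  rewrite (_ : _ - _ - _ = ('D_(evec i) (phi k) x - W (Some i) x) - (phi k x - W None x)); last by ring.
  exact: ler_normB.
have l1 := cv2_I1 mO fO (fun k => La _ (mphi k None)) (La _ (mW None)) (L2_cst mO fO 1) ca.
have l2 := cv2_I mO (fun k => La' _ (mphi k None)) (La' _ (mW None))
  (fun k => Ld _ _ (Lphi k (Some i)) (Lphi k None)) (Ld _ _ (LW (Some i)) (LW None)) ca' cd.
have le0 : I (fun x => q x * flat1 (p x * W None x - 1)) <= 0.
  have e : I (fun x => q x * flat1 (p x * W None x - 1) * 1) =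
      I (fun x => b (p x * W None x - 1) * (q x * (p x * (W (Some i) x - W None x)))).
    apply: (cvg_unique _ l1) => //; apply: cvg_trans l2; apply: near_eq_cvg; apply: nearW => k.
    rewrite -id; apply: eq_Rintegral => x _; by rewrite mulr1.
  have e1 : I (fun x => q x * flat1 (p x * W None x - 1)) = I (fun x => q x * flat1 (p x * W None x - 1) * 1).
    by apply: eq_Rintegral => x _; rewrite mulr1.
  have z : I (fun=> 0) = 0 by rewrite Rintegral_cst// mul0r.
  rewrite e1 e -z; apply: RI_le_ae => //.
  - by apply: L2mul; [|exact: La'|exact: Ld].
  - exact: intg_cst.
  apply: filterS hL => x hL Ox.
  (* Where p u > 1 one has p D_i u <= p L <= 1 < p u, so the integrand is nonpositive; elsewhere it
     is 0. *)
  have [h|h] := leP (p x * W None x) 1; first by rewrite /b flat_npos ?mul0r// subr_le0.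
  rewrite mulr_ge0_le0 ?flatX2_ge0// mulr_ge0_le0 ?(ltW (q0 x))// mulrBr subr_le0.
  apply: le_trans (ltW h); apply: le_trans (pL x Ox); rewrite ler_pM2l//; exact: hL.
have nn : {ae mu, forall x, Om x -> 0 <= q x * flat1 (p x * W None x - 1)}.
  by apply: aeW => x _; rewrite mulr_ge0 ?(ltW (q0 x))// flat1_ge0.
have hz := RI_eq0 mO (L2_intg mO fO (La _ (mW None))) nn le0.
apply: filterS hz => x h Ox; have h1 := h Ox.
have h2 : p x * W None x <= 1.
  rewrite leNgt; apply/negP => h2.
  have : 0 < q x * flat1 (p x * W None x - 1) by rewrite mulr_gt0// flat1_gt0// subr_gt0.
  by rewrite h1 ltxx.
have h3 : W None x <= (p x)^-1 by rewrite -[leRHS]mul1r ler_pdivlMr// mulrC.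
apply: le_trans h3 _; rewrite /p -expRN ler_expR; have [_ h4] := Ok x Ox; lra.
Qed.

End H0_calculus.

(** * The gradient constraint *)

Section euclidean_norm.
Context {R : realType} {n : nat}.
Implicit Types (u v w : 'rV[R]_n).

Lemma dot_ge0 u : 0 <= dot u u.
Proof. by apply: sumr_ge0 => i _; rewrite -expr2 sqr_ge0. Qed.

Lemma enorm_leP u (c : R) : 0 <= c -> (enorm u <= c) = (dot u u <= c ^+ 2).
Proof. by move=> c0; rewrite /enorm -ler_sqr ?nnegrE ?sqrtr_ge0// sqr_sqrtr// dot_ge0. Qed.

Lemma coord_enorm u i : `|u ord0 i| <= enorm u.
Proof.
rewrite -[leLHS]ger0_norm// -sqrtr_sqr ler_wsqrtr// /dot (bigD1 i)//= real_normK ?num_real// expr2 lerDl.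
by apply: sumr_ge0 => j _; rewrite -expr2 sqr_ge0.
Qed.

Lemma enorm_convex u v w (t c : R) : 0 <= t -> t <= 1 ->
  (forall i, w ord0 i = (1 - t) * u ord0 i + t * v ord0 i) ->
  enorm u <= c -> enorm v <= c -> enorm w <= c.
Proof.
move=> t0 t1 hw hu hv; have c0 : 0 <= c by apply: le_trans hu; exact: sqrtr_ge0.
move: hu hv; rewrite !enorm_leP// => hu hv.
apply: (@le_trans _ _ ((1 - t) * dot u u + t * dot v v)).
  rewrite /dot !mulr_sumr -big_split/=; apply: ler_sum => i _; rewrite hw.
  set a := u _ _; set b := v _ _; rewrite -subr_ge0.
  rewrite (_ : _ - _ = t * (1 - t) * (a - b) ^+ 2); last by ring.
  by rewrite mulr_ge0 ?sqr_ge0// mulr_ge0// subr_ge0.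
rewrite [leRHS](_ : _ = (1 - t) * c ^+ 2 + t * c ^+ 2); last by ring.
by apply: lerD; rewrite ler_wpM2l// subr_ge0.
Qed.

End euclidean_norm.

Lemma cvg_fsum {R : realType} (J : Type) (s : seq J) (a : J -> nat -> R) (l : J -> R) :
  (forall j, a j k @[k --> \oo] --> l j) ->
  \sum_(j <- s) a j k @[k --> \oo] --> \sum_(j <- s) l j.
Proof.
move=> h; elim: s => [|j s ih].
  rewrite big_nil (_ : (fun k => _) = cst 0); first exact: cvg_cst.
  by apply/funext => k; rewrite big_nil.
rewrite big_cons (_ : (fun k => _) = (fun k => a j k + \sum_(j <- s) a j k)); first exact: cvgD.
by apply/funext => k; rewrite big_cons.
Qed.

Section constraint_set.
Context {R : realType} {n : nat}.
Local Notation T := 'rV[R]_n.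
Local Notation mu := (rV_lebesgue R n).
Variables (Om : set T) (oO : open Om) (bO : bounded_set Om).
Let mO : measurable Om := open_measurable_rV oO.
Let fO : (mu Om < +oo)%E := bounded_finite mO bO.
Local Notation I f := (\int[mu]_(x in Om) f x).
Local Notation L2 := (L2 mu Om).
Local Notation nm2 := (nm2 mu Om).
Local Notation J := (option 'I_n).
Local Notation H0 := (H0 Om).
Implicit Types (U V W Z : J -> T -> R).

Variables (G : T -> R) (L : R).
Hypothesis L0 : 0 <= L.
Hypothesis mG : measurable_fun Om G.
Hypothesis hG : {ae mu, forall x, Om x -> 0 <= G x <= L}.

Definition grad W (x : T) : T := \row_i W (Some i) x.

Definition KH W := H0 W /\ {ae mu, forall x, Om x -> enorm (grad W x) <= G x}.

Lemma gradE W x i : grad W x ord0 i = W (Some i) x. Proof. by rewrite mxE. Qed.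

Lemma KH_meas U : KH U -> forall j, measurable_fun Om (U j).
Proof. by move=> [[LU _] _] j; exact: L2_meas (LU j). Qed.

Lemma H0_0 : H0 (fun _ _ => 0).
Proof.
split; first by move=> j; exact: L2_cst.
exists (fun _ _ => 0).
  move=> k; split; first by move=> m; exact: Ck_cst.
  by exists set0; split => //; exact: compact0.
move=> j; apply: cvg_near_cst; apply: nearW => k.
rewrite (@eq_nm2 _ _ _ _ _ _ (fun=> 0 * 0)).
  by rewrite nm2Z ?normr0 ?mul0r//; exact: L2_cst.
move=> x _; case: j => [i|] /=; last by rewrite subrr mul0r.
have -> : 'D_(evec i) (fun=> 0) x = 0 :> R by exact: derive_cst.
by rewrite subrr mul0r.
Qed.

Lemma KH_neq0 : exists U, KH U.
Proof.
exists (fun _ _ => 0); split; first exact: H0_0.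
apply: filterS hG => x h Ox; have /andP[G0 _] := h Ox.
by rewrite enorm_leP// /dot big1 ?sqr_ge0// => i _; rewrite gradE mul0r.
Qed.

Lemma KH_grad W : KH W -> forall i, {ae mu, forall x, Om x -> `|W (Some i) x| <= L}.
Proof.
move=> [_ h] i; apply: filterS (filterI hG h) => x [h1 h2] Ox.
have /andP[_ h3] := h1 Ox; apply: le_trans h3; apply: le_trans (h2 Ox).
by rewrite -gradE coord_enorm.
Qed.

Lemma KH_sup W (i : 'I_n) (r : R) : Om `<=` cube r -> KH W ->
  {ae mu, forall x, Om x -> `|W None x| <= expR (2 * r + L)}.
Proof.
move=> Or KW; have [HW _] := KW.
have h1 : {ae mu, forall x, Om x -> W None x <= expR (2 * r + L)}.
  apply: (sup_bound oO bO (i := i)) => //; apply: filterS (KH_grad KW i) => x h Ox.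
  exact: le_trans (ler_norm _) (h Ox).
(* The same bound for the opposite function, written as a linear combination so that [H0_lin]
   applies. *)
have h2 : {ae mu, forall x, Om x -> -1 * W None x + 0 * W None x <= expR (2 * r + L)}.
  apply: (@sup_bound R n Om oO bO (fun j x => -1 * W j x + 0 * W j x) i) => //.
    exact: H0_lin.
  apply: filterS (KH_grad KW i) => x h Ox; rewrite mul0r addr0 mulN1r.
  apply: le_trans (ler_norm _) _; rewrite normrN; exact: h.
apply: filterS (filterI h1 h2) => x [h3 h4] Ox; rewrite ler_norml h3// andbT.
by have := h4 Ox; rewrite mul0r addr0 mulN1r lerNl.
Qed.

Lemma KH_conv U V t : KH U -> KH V -> 0 <= t -> t <= 1 ->
  KH (fun j x => (1 - t) * U j x + t * V j x).
Proof.
move=> [HU hU] [HV hV] t0 t1; split; first exact: H0_lin.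
apply: filterS (filterI hU hV) => x [h1 h2] Ox.
by apply: (enorm_convex t0 t1 _ (h1 Ox) (h2 Ox)) => i; rewrite !gradE.
Qed.

Lemma KH_trunc U V e j0 : j0 = None -> KH U -> KH V -> 0 < e -> exists2 Z, KH Z &
  {ae mu, forall x, Om x -> Z j0 x = U j0 x - e * tanh ((U j0 x - V j0 x) / e) /\
    forall j, j != j0 -> Z j x =
      U j x - (1 - tanh ((U j0 x - V j0 x) / e) ^+ 2) * (U j x - V j x)}.
Proof.
move=> -> KU KV e0; have [HU hU] := KU; have [HV hV] := KV.
pose W j x := 1 * U j x + (-1) * V j x.
have HW : H0 W by exact: H0_lin.
(* The + 1 makes the bound positive when L = 0, as [H0_soft] requires. *)
have bW i : {ae mu, forall x, Om x -> `|W (Some i) x| <= 2 * L + 1}.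
  apply: filterS (filterI (KH_grad KU i) (KH_grad KV i)) => x [h1 h2] Ox.
  rewrite /W mul1r mulN1r; apply: le_trans (ler_normB _ _) _.
  by have := h1 Ox; have := h2 Ox => *; lra.
have L1 : 0 < 2 * L + 1 by rewrite ltr_wpDl// mulr_ge0.
have HS := H0_soft oO bO e0 L1 HW bW.
pose Z j x := 1 * U j x + (-1) * (if j is Some i then (1 - tanh (W None x / e) ^+ 2) * W (Some i) x
                 else soft e (W None x)).
have ZN x : Z None x = U None x - e * tanh ((U None x - V None x) / e).
  by rewrite /Z /soft /W !mul1r !mulN1r.
have ZS i x : Z (Some i) x = U (Some i) x - (1 - tanh ((U None x - V None x) / e) ^+ 2) * (U (Some i) x - V (Some i) x).
  by rewrite /Z /W !mul1r !mulN1r.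
exists Z; last first.
  by apply: aeW => x _; split => // -[i|] // _.
split; first exact: (H0_lin oO bO 1 (-1) HU HS).
apply: filterS (filterI hU hV) => x [h1 h2] Ox.
(* The gradient of [Z] is the convex combination of those of [U] and [V] with weight 1 - tanh^2 on
   [V]. *)
apply: (enorm_convex (dtanh_ge0 ((U None x - V None x) / e)) (dtanh_le1 _) _ (h1 Ox) (h2 Ox)) => i.
by rewrite !gradE ZS; ring.
Qed.

(** The positive part of |grad Z|^2 - G^2 has integral 0: since |grad W_k| <= G it is at most |grad
    Z|^2 - |grad W_k|^2 where it is positive, and the integral of the resulting bound tends to 0
    with the L2 distance of the gradients. *)
Lemma KH_closed (W : nat -> J -> T -> R) Z : (forall k, KH (W k)) -> (forall j, L2 (Z j)) ->
  to2 mu Om W Z -> KH Z.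
Proof.
move=> KW LZ h; have HZ : H0 Z by apply: (H0_closed oO bO _ LZ h) => k; have [] := KW k.
split => //.
pose g x := dot (grad Z x) (grad Z x) - G x ^+ 2.
pose f x := Num.max (g x) 0.
have mdot : measurable_fun Om (fun x => dot (grad Z x) (grad Z x)).
  have e i : (fun x => grad Z x ord0 i) = Z (Some i) by apply/funext => x; rewrite gradE.
  by apply: measurable_sum => i; apply: measurable_funM; rewrite e; exact: L2_meas (LZ _).
have mf : measurable_fun Om f.
  apply: measurable_maxr => //; apply: measurable_funB => //.
  exact: measurable_funX.
have idot : intg mu Om (fun x => dot (grad Z x) (grad Z x)).
  have h1 : intg mu Om (fun x => \sum_i Z (Some i) x ^+ 2).
    by apply: intg_sum => // i; exact: L2_sqr (LZ _).
  by apply: (eq_intg mO _ h1) => x _; apply: eq_bigr => i _; rewrite gradE expr2.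
have f0 x : 0 <= f x by rewrite /f le_max lexx orbT.
have if_ : intg mu Om f.
  apply: (intg_le mO mf idot) => x _; rewrite ger0_norm// /f ge_max dot_ge0 andbT.
  by rewrite gerBl sqr_ge0.
have LW k j : L2 (W k j) by have [[] ] := KW k.
pose d k i x := Z (Some i) x - W k (Some i) x.
have Ld k i : L2 (d k i) by exact: L2B.
pose c k := \sum_i (2 * L * (nm2 (d k i) * nm2 (fun=> 1)) + nm2 (d k i) ^+ 2).
have fc k : I f <= c k.
  have hk : {ae mu, forall x, Om x -> f x <= \sum_i (2 * L * `|d k i x| + d k i x ^+ 2)}.
    have [_ hW] := KW k; apply: filterS (filterI hG hW) => x [h1 h2] Ox.
    have /andP[G0 GL] := h1 Ox; have := h2 Ox; rewrite enorm_leP// => h3.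
    rewrite /f ge_max; apply/andP; split; last first.
      by apply: sumr_ge0 => i _; rewrite addr_ge0 ?sqr_ge0// mulr_ge0// mulr_ge0.
    rewrite /g lerBlDr; apply: le_trans (lerD (lexx _) h3).
    rewrite /dot -big_split/=; apply: ler_sum => i _; rewrite !gradE /d.
    have h4 : `|W k (Some i) x| <= L.
      by rewrite -gradE; apply: le_trans (coord_enorm _ _) _; exact: le_trans (h2 Ox) GL.
    set a := W _ _ _ in h4 *; set b := Z _ _.
    have h5 : a * (b - a) <= L * `|b - a|.
      by apply: le_trans (ler_norm _) _; rewrite normrM ler_wpM2r.
    nra.
  have iA k' i : intg mu Om (fun x => `|d k' i x|).
    by apply: intg_norm => //; exact: L2_intg.
  have iB k' i : intg mu Om (fun x => d k' i x ^+ 2) by exact: L2_sqr.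
  apply: (@le_trans _ _ (I (fun x => \sum_i (2 * L * `|d k i x| + d k i x ^+ 2)))).
    apply: RI_le_ae => //; apply: intg_sum => // i; apply: intgD => //; exact: intgZ.
  rewrite RIsum//; last by move=> i; apply: intgD => //; exact: intgZ.
  apply: ler_sum => i _; rewrite RID// ?RIZ ?nm2K//; last exact: intgZ.
  by rewrite lerD2r ler_wpM2l ?mulr_ge0// L1_nm2.
have c0 : c k @[k --> \oo] --> (0 : R).
  rewrite (_ : (0 : R) = \sum_(i < n) (2 * L * (0 * nm2 (fun=> 1)) + 0 * 0)); last first.
    by rewrite big1// => i _; rewrite !mul0r mulr0 addr0.
  apply: cvg_fsum => i.
  have hi : nm2 (d k i) @[k --> \oo] --> (0 : R).
    rewrite (_ : (fun k => _) = (fun k => nm2 (fun x => W k (Some i) x - Z (Some i) x))); first by have /to2P := h; exact.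
    by apply/funext => k; rewrite nm2C.
  apply: cvgD; first by apply: cvgMr; apply: cvgMl.
  by under eq_fun do rewrite expr2; exact: cvgM.
have If0 : I f <= 0 by apply: (ler_cvg_to (cvg_cst _) c0); exact: nearW.
have f00 := RI_eq0 mO if_ (aeW _ (fun x _ => f0 x)) If0.
apply: filterS (filterI hG f00) => x [h1 h2] Ox; have /andP[G0 _] := h1 Ox.
rewrite enorm_leP// -subr_le0; have := h2 Ox; rewrite /f => <-.
by rewrite le_max lexx.
Qed.

End constraint_set.

(** * Compactness in L1 *)

Section compactness.
Context {R : realType} {n : nat}.
Local Notation T := 'rV[R]_n.
Local Notation mu := (rV_lebesgue R n).
Local Notation IT f := (\int[mu]_(x in setT) f x).
Local Notation intT := (intg mu setT).

Lemma is_derive_scale (f : T -> R) (x v : T) (a l : R) :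
  is_derive x v f l -> is_derive x (a *: v) f (l * a).
Proof.
move=> h; apply: is_derive_line0.
have h1 : is_derive (0 * a : R) 1 (fun s : R => f (s *: v + x)) l.
  by rewrite mul0r; apply: is_derive_line; rewrite scale0r add0r.
have h0 := is_derive_prod (is_derive_id (0 : R) 1) (is_derive_cst (a : R) (0 : R) 1).
have h2 := is_derive_comp h0 h1.
apply: is_derive_congr h2 _ _.
  by apply/funext => s /=; rewrite scalerA.
by rewrite mul1r mulr0 addr0 mulrC.
Qed.

Definition shift_norm (w : T -> R) (v : T) := IT (fun x => `|w (x + v) - w x|).

Lemma intT_shift w v : intT w -> intT (fun x => `|w (x + v) - w x|).
Proof. by move=> iw; apply: intg_norm => //; apply: intgB => //; exact: intg_translation. Qed.

Lemma shift_norm_add w u v : intT w -> shift_norm w (u + v) <= shift_norm w u + shift_norm w v.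
Proof.
move=> iw; have iu := intT_shift u iw; have iv := intT_shift v iw.
have iuv := intg_translation v iu.
have -> : shift_norm w u = IT (fun x => `|w (x + v + u) - w (x + v)|).
  rewrite /shift_norm -(RI_translation v (f := fun x => `|w (x + u) - w x|))//.
  exact: intg_meas iu.
rewrite /shift_norm -RID//; apply: RI_le => //; first exact: intT_shift.
  exact: intgD.
move=> x _; rewrite (_ : x + (u + v) = x + v + u); last by rewrite -addrA [v + u]addrC.
by rewrite -{1}(subrKA (w (x + v))) ler_normD.
Qed.

Lemma shift_norm0 w : shift_norm w 0 = 0.
Proof.
rewrite /shift_norm (_ : (fun x => _) = cst 0) ?Rintegral_cst ?mul0r//.
by apply/funext => x; rewrite addr0 subrr normr0.
Qed.

Variables (Om : set T) (oO : open Om) (bO : bounded_set Om).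
Let mO : measurable Om := open_measurable_rV oO.
Let fO : (mu Om < +oo)%E := bounded_finite mO bO.
Local Notation I f := (\int[mu]_(x in Om) f x).
Local Notation J := (option 'I_n).
Local Notation H0 := (H0 Om).
Implicit Types (W : J -> T -> R).

(** A shift by h is a succession of shifts along the axes, each estimated by [RI_shift_le]. *)
Lemma shift_norm_test phi (h : T) : test_function Om phi ->
  shift_norm phi h <= \sum_i `|h ord0 i| * I (fun x => `|'D_(evec i) phi x|).
Proof.
move=> tphi; have iphi := test_intg tphi; have [hk [K [cK KO sK]]] := tphi.
have step i : shift_norm phi (h ord0 i *: evec i) <= `|h ord0 i| * I (fun x => `|'D_(evec i) phi x|).
  have dh x := is_derive_scale (h ord0 i) (test_is_derive i x tphi).
  have dEx x : 'D_(h ord0 i *: evec i) phi x = 'D_(evec i) phi x * h ord0 i by have [_ ->] := dh x.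
  have dE : 'D_(h ord0 i *: evec i) phi = (fun x => 'D_(evec i) phi x * h ord0 i) by apply/funext.
  have le1 := RI_shift_le cK sK (v := h ord0 i *: evec i) (test_cont tphi).
  apply: le_trans (le1 _ _) _.
  - by move=> x; have [] := dh x.
  - rewrite dE; apply: (@Ck_continuous _ _ 0).
    by apply: Ck_mul; [exact: CkSD (hk 1%N)|exact: Ck_cst].
  rewrite -RIZ//; last first.
    by apply: intg_norm => //; apply: L2_intg => //; apply: (test_L2 oO bO); exact: test_deriv.
  rewrite -(@RI_supp _ _ Om); last first.
    by move=> x nO; rewrite dEx (test_supp (test_deriv i tphi))// mul0r normr0.
  rewrite le_eqVlt; apply/orP; left; apply/eqP.
  by apply: eq_Rintegral => x _; rewrite dEx normrM mulrC.
have hsum (s : seq 'I_n) : shift_norm phi (\sum_(i <- s) h ord0 i *: evec i) <=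
    \sum_(i <- s) `|h ord0 i| * I (fun x => `|'D_(evec i) phi x|).
  elim: s => [|i s ih]; first by rewrite !big_nil shift_norm0.
  by rewrite !big_cons; apply: le_trans (shift_norm_add _ _ iphi) _; exact: lerD.
by rewrite {1}[h]row_sum_delta; exact: hsum.
Qed.

Definition ext W := W None \_ Om.

Lemma ext_intg W : H0 W -> intT (ext W).
Proof. by move=> [LW _]; apply/(intg_restrict _ mO); exact: L2_intg (LW None). Qed.

(** The estimate for test functions passes to the limit. Test functions vanish off [Om], so
    extending the limit by zero creates no boundary term, whatever the boundary. *)
Lemma shift_norm_H0 W (h : T) : H0 W ->
  shift_norm (ext W) h <= \sum_i `|h ord0 i| * I (fun x => `|W (Some i) x|).
Proof.
move=> HW; have iw := ext_intg HW; have [LW [phi tphi cW]] := HW.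
have Lphi k j := fam_L2 oO bO j (tphi k).
pose N0 k := nm2 mu Om (fun x => phi k x - W None x).
pose Ni i k := nm2 mu Om (fun x => 'D_(evec i) (phi k) x - W (Some i) x).
pose m1 := nm2 mu Om (fun=> 1).
have bnd k : shift_norm (ext W) h <= \sum_i `|h ord0 i| * (I (fun x => `|W (Some i) x|) + Ni i k * m1) + 2 * (N0 k * m1).
  have iphi := test_intg (tphi k).
  pose e x := `|phi k x - ext W x|.
  have ie : intT e by apply: intg_norm => //; exact: intgB.
  have Ie : IT e <= N0 k * m1.
    have := L1_nm2 mO fO (L2B mO (Lphi k None) (LW None)); apply: le_trans.
    rewrite -(@RI_supp _ _ Om); last first.
      by move=> x nO; rewrite /e (test_supp (tphi k))// /ext patchE memNset// subrr normr0.
    rewrite le_eqVlt; apply/orP; left; apply/eqP; apply: eq_Rintegral => x; rewrite inE => Ox; by rewrite /e /ext patchE mem_set.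
  have i1 := intT_shift h iphi; have ieh := intg_translation h ie.
  apply: (@le_trans _ _ (shift_norm (phi k) h + (IT e + IT e))).
    rewrite -[X in _ + (X + _)](RI_translation h (f := e)); last exact: intg_meas ie.
    rewrite /shift_norm -!RID//; last exact: intgD.
    apply: RI_le => //; [exact: intT_shift|apply: intgD => //; exact: intgD|].
    move=> x _; rewrite /e; set a := phi k _; set b := phi k x; set c := ext W _; set d := ext W x.
    rewrite (_ : c - d = (a - b) - (a - c) + (b - d)); last by ring.
    apply: le_trans (ler_normD _ _) _; rewrite addrA lerD2r.
    by apply: le_trans (ler_normB _ _) _.
  apply: lerD; last by rewrite mulr_natl mulr2n; exact: lerD.
  apply: le_trans (shift_norm_test h (tphi k)) _; apply: ler_sum => i _; apply: ler_wpM2l => //.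
  have Ld := L2B mO (Lphi k (Some i)) (LW (Some i)).
  apply: le_trans (_ : I (fun x => `|W (Some i) x|) + I (fun x => `|'D_(evec i) (phi k) x - W (Some i) x|) <= _); last first.
    by rewrite lerD2l; exact: L1_nm2.
  have i2 : intg mu Om (fun x => `|W (Some i) x|) by apply: intg_norm => //; exact: L2_intg.
  have i3 := intg_norm mO (L2_intg mO fO Ld).
  rewrite -RID//; apply: RI_le => //; [|exact: intgD|].
    by apply: intg_norm => //; apply: L2_intg => //; exact: (Lphi k (Some i)).
  by move=> x _; rewrite -[X in `|X| <= _](subrKC (W (Some i) x)) ler_normD.
have lim : \sum_i `|h ord0 i| * (I (fun x => `|W (Some i) x|) + Ni i k * m1) + 2 * (N0 k * m1) @[k --> \oo] -->
    \sum_i `|h ord0 i| * (I (fun x => `|W (Some i) x|) + 0 * m1) + 2 * (0 * m1).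
  apply: cvgD; last by apply: cvgMr; apply: cvgMl; exact: (cW None).
  apply: cvg_fsum => i; apply: cvgMr; apply: cvgD; first exact: cvg_cst.
  by apply: cvgMl; exact: (cW (Some i)).
have hle : shift_norm (ext W) h <= \sum_i `|h ord0 i| * (I (fun x => `|W (Some i) x|) + 0 * m1) + 2 * (0 * m1).
  by apply: (ler_cvg_to (cvg_cst _) lim); exact: nearW.
apply: le_trans hle _; rewrite mul0r mulr0 addr0; rewrite le_eqVlt; apply/orP; left; apply/eqP.
by apply: eq_bigr => i _; rewrite addr0.
Qed.

Lemma mu_ball (c : T) (s : R) : 0 < s -> mu (ball c s) = ((2 * s) ^+ n)%:E.
Proof.
move=> s0; rewrite (ball_box _ s0) box_measure; last by move=> i; lra.
congr EFin; rewrite -[X in _ ^+ X]card_ord -prodr_const; apply: eq_bigr => i _; lra.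
Qed.

Lemma measurable_ball (c : T) (s : R) : measurable (ball c s).
Proof. by apply: open_measurable_rV; exact: ball_open. Qed.

Definition avg (w : T -> R) (c : T) (s : R) := \int[mu]_(y in ball c s) w y.

(* Integrate |ball| |w x| <= |avg of w| + avg of |w(x + h) - w x| over x *)
Lemma L1_local (w : T -> R) (s M : R) (cs : seq T) : 0 < s -> 0 <= M -> intT w ->
  supp Om w -> (forall x, Om x -> exists2 c, c \in cs & ball c s x) ->
  (forall h, ball 0 (2 * s) h -> shift_norm w h <= M) ->
  (2 * s) ^+ n * I (fun x => `|w x|) <=
    I (fun=> 1) * \sum_(c <- cs) `|avg w c s| + (4 * s) ^+ n * M.
Proof.
move=> s0 M0 iw sw cov hM.
(* Two points of one ball of radius s differ by an element of [B]. Balls are cubes here, so [B] has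
   measure (4 s)^n. *)
pose B : set T := ball 0 (2 * s).
have s2 : 0 < 2 * s by rewrite mulr_gt0.
have mB : measurable B by exact: measurable_ball.
pose S := \sum_(c <- cs) `|avg w c s|.
have S0 : 0 <= S by exact: sumr_ge0.
pose k (z : T * T) : R := \1_B z.2 * `|w (z.2 + z.1) - w z.1|.
have k0 z : 0 <= k z by rewrite mulr_ge0// indicE ler0n.
have mw := intg_meas iw.
have madd : measurable_fun (setT : set (T * T)) (fun z : T * T => z.2 + z.1).
  apply: measurable_fun_rVP => i; under eq_fun do rewrite mxE.
  by apply: measurable_funD; apply: (measurableT_comp (measurable_rV_coord i)).
have mk : measurable_fun (setT : set (T * T)) (EFin \o k).
  apply/measurable_EFinP; apply: measurable_funM.
    by apply: (measurableT_comp (f := \1_B : T -> R)) => //; exact: measurable_indic.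
  apply: measurableT_comp => //; apply: measurable_funB; first exact: (measurableT_comp mw madd).
  exact: (measurableT_comp mw).
pose Jx x := IT (fun h => k (x, h)).
have iB : intT (\1_B : T -> R).
  apply: (intg_bnd_supp mB (C := 1)).
  - by rewrite mu_ball// ltry.
  - exact: measurable_indic.
  - by move=> x; rewrite indicE; case: (_ \in _); rewrite ?normr1 ?normr0.
  - by move=> x nB; rewrite indicE memNset.
have mkx x : measurable_fun setT (fun h => k (x, h)).
  change (measurable_fun setT (fun h : T => \1_B h * `|w (h + x) - w x|)).
  apply: measurable_funM; first exact: measurable_indic.
  apply: measurableT_comp => //; apply: measurable_funB; last exact: measurable_cst.
  by apply: (measurableT_comp mw); exact: measurable_add.
have ikx x : intT (fun h => k (x, h)).
  have ig : intT (fun h => `|w (h + x)| + `|w x| * \1_B h).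
    by apply: intgD => //; [apply: intg_norm => //; exact: intg_translation|exact: intgZ].
  apply: (intg_le measurableT (mkx x) ig) => h _.
  rewrite ger0_norm// /k /= indicE; case: (_ \in _).
    by rewrite mul1r mulr1; exact: ler_normB.
  by rewrite mul0r mulr0 addr0.
have claim x : Om x -> (2 * s) ^+ n * `|w x| <= S + Jx x.
  move=> /cov[c ccs cx]; pose Q := ball c s; have mQ : measurable Q by exact: measurable_ball.
  have fQ : (mu Q < +oo)%E by rewrite mu_ball// ltry.
  have iQ f : intT f -> intg mu Q f by move=> h; apply: integrableS h.
  have iwx : intg mu Q (fun y => w y - w x) by apply: intgB => //; [exact: iQ|exact: intg_cst].
  have e : (2 * s) ^+ n * w x = \int[mu]_(y in Q) w y - \int[mu]_(y in Q) (w y - w x).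
    rewrite RIB//; [|exact: iQ|exact: intg_cst].
    have hc : \int[mu]_(_ in Q) w x = w x * (2 * s) ^+ n.
      by rewrite Rintegral_cst//; congr (_ * _); exact: (congr1 fine (mu_ball c s0)).
    by rewrite hc; ring.
  rewrite -(ger0_norm (exprn_ge0 n (ltW s2))) -normrM e; apply: le_trans (ler_normB _ _) _; apply: lerD.
    have : {in cs, forall c, `|avg w c s| <= S}; last exact.
    move=> c' c'cs; rewrite /S (big_rem c')//= lerDl; exact: sumr_ge0.
  apply: le_trans (RI_norm_le mQ (intg_meas iwx) (intg_norm mQ iwx) (aeW _ (fun _ _ => lexx _))) _.
  rewrite Rintegral_mkcond -(RI_translation x); last first.
    apply/(restrict_measurable _ mQ); exact: intg_meas (intg_norm mQ iwx).
  apply: RI_le => //.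
    by apply: intg_translation; apply/(intg_restrict _ mQ); exact: intg_norm.
  move=> h _; rewrite patchE /k /=; case: ifPn => [|_]; last by rewrite mulr_ge0// indicE ler0n.
  rewrite inE => Qh; rewrite indicE mem_set ?mul1r//.
  have : ball x (s + s) (h + x) by apply: (ball_triangle (ball_sym cx)).
  by rewrite /B -!ball_normE /ball_ /= opprD addrCA subrr addr0 sub0r -mulr2n mulr_natl.
have JE x : (Jx x)%:E = (\int[mu]_h (EFin \o k) (x, h))%E by rewrite EFin_RI.
have mJ : measurable_fun setT (fun x => (Jx x)%:E).
  under eq_fun do rewrite JE.
  exact: (@measurable_fun_fubini_tonelli_F _ _ _ _ _ mu (EFin \o k) mk (fun z => k0 z)).
have J0 x : 0 <= Jx x by apply: RI_ge0_ae => //; apply: aeW => h _; exact: k0.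
(* With the order of integration exchanged, the inner integral is the shift norm of w at h in [B],
   at most M. *)
have tonelli : (\int[mu]_x (Jx x)%:E <= ((4 * s) ^+ n * M)%:E)%E.
  under eq_integral do rewrite JE.
  rewrite (@fubini_tonelli _ _ _ _ _ mu mu (EFin \o k) mk (fun z => k0 z)).
  apply: (@le_trans _ _ (\int[mu]_h (M * \1_B h)%:E)%E).
    apply: ge0_le_integral => //.
    - by move=> h _; apply: integral_ge0 => x _; rewrite lee_fin.
    - exact: (@measurable_fun_fubini_tonelli_G _ _ _ _ _ mu (EFin \o k) mk (fun z => k0 z)).
    - by apply/measurable_EFinP; apply: measurable_funM => //; exact: measurable_indic.
    - move=> h _; rewrite /k /=.
      have ish := intT_shift h iw.
      have e : (fun x => (\1_B h * `|w (h + x) - w x|)%:E) = (fun x => (\1_B h * `|w (x + h) - w x|)%:E).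
        by apply/funext => x; rewrite [h + x]addrC.
      rewrite e -(EFin_RI measurableT (intgZ measurableT (\1_B h) ish)) RIZ// lee_fin mulrC indicE.
      case: (boolP (h \in B)) => [|_]; last by rewrite !mulr0.
      by rewrite inE !mulr1; exact: hM.
  rewrite -(EFin_RI measurableT (intgZ measurableT M iB)) RIZ// lee_fin mulrC ler_wpM2r//.
  have -> : IT (\1_B : T -> R) = fine (mu B) by rewrite /Rintegral integral_indic// setIT.
  by rewrite (mu_ball 0 s2) (_ : 2 * (2 * s) = 4 * s) //; ring.
have iW : intg mu Om (fun x => `|w x|) by apply: integrableS (intg_norm measurableT iw).
have lhs : (((2 * s) ^+ n * I (fun x => `|w x|))%:E <= (I (fun=> 1) * S)%:E + \int[mu]_(x in Om) (Jx x)%:E)%E.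
  rewrite -RIZ// EFin_RI//; last exact: intgZ.
  have -> : (I (fun=> 1) * S)%:E = (\int[mu]_(x in Om) S%:E)%E.
    by rewrite mulrC -RIZ//; [rewrite mulr1 EFin_RI//; exact: intg_cst|exact: intg_cst].
  rewrite -ge0_integralD//; last first.
  - exact: measurable_funTS.
  - by move=> x _; rewrite lee_fin.
  apply: ge0_le_integral => //.
  - by move=> x _; rewrite lee_fin mulr_ge0// exprn_ge0// ltW.
  - by apply/measurable_EFinP; apply: measurable_funM => //; exact: intg_meas iW.
  - by apply: emeasurable_funD => //; exact: measurable_funTS.
rewrite -lee_fin; apply: le_trans lhs _; rewrite EFinD leeD2l//.
apply: le_trans tonelli; apply: ge0_subset_integral => // x _; by rewrite lee_fin.
Qed.

Lemma finite_ball_cover (s : R) : 0 < s -> exists cs : seq T,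
  forall x, Om x -> exists2 c, c \in cs & ball c s x.
Proof.
move=> s0; have [r r0 Or] := bounded_cube bO.
have : cover_compact (cube r : set T) by rewrite -compact_cover; exact: compact_cbox.
move=> /(_ T setT (fun c => ball c s))[].
- by move=> c _; exact: ball_open.
- by move=> x _; exists x => //; exact: ballxx.
move=> D' _ hD; exists (finmap.enum_fset D') => x /Or/hD[c cD cx]; by exists c.
Qed.

End compactness.

(** * Extraction along an ultrafilter *)

Section ultrafilter.
Context {R : realType}.
Variables (F : set_system nat) (FU : UltraFilter F).

Lemma ultra_fibre (J : finType) (c : nat -> J) : exists v, F (c @^-1` [set v]).
Proof.
apply: contrapT => /forallNP h.
have h1 v : F (~` (c @^-1` [set v])) by have [/h|] := in_ultra_setVsetC (c @^-1` [set v]) FU.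
have : F [set k | forall v, (~` (c @^-1` [set v])) k].
  by apply: (@filter_forall _ J (fun v k => (~` (c @^-1` [set v])) k)).
rewrite (_ : [set k | _] = set0); first exact: filter_not_empty.
by apply/seteqP; split => // k /(_ (c k)); apply.
Qed.

(** The range is cut into finitely many cells of length d, and the indices falling into one of them
    form a set of the ultrafilter. *)
Lemma ultra_close (a : nat -> R) (M d : R) : (forall k, `|a k| <= M) -> 0 < d ->
  exists2 S, F S & forall p q, S p -> S q -> `|a p - a q| <= d.
Proof.
move=> hM d0; pose y k := (a k + M) / d.
have y0 k : 0 <= y k.
  by rewrite divr_ge0 ?(ltW d0)//; have := hM k; rewrite ler_norml => /andP[? _]; lra.
have yM k : y k <= (2 * M) / d.
  by rewrite ler_pM2r ?invr_gt0//; have := hM k; rewrite ler_norml => /andP[_ ?]; lra.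
pose K := Num.truncn (2 * M / d).
have cK k : (Num.truncn (y k) < K.+1)%N by rewrite ltnS; exact: le_truncn.
have [v hv] := ultra_fibre (fun k => Ordinal (cK k)).
exists ((fun k => Ordinal (cK k)) @^-1` [set v]) => // p q /= pv qv.
have e : Num.truncn (y p) = Num.truncn (y q) by have := congr1 val (etrans pv (esym qv)).
have /andP[p1 p2] := truncn_itv (y0 p); have /andP[q1 q2] := truncn_itv (y0 q).
rewrite e in p1 p2; rewrite -natr1 in p2 q2.
have h : `|y p - y q| <= 1 by rewrite ler_norml; apply/andP; split; lra.
have -> : a p - a q = (y p - y q) * d by rewrite /y -mulrBl divfK ?gt_eqF//; ring.
by rewrite normrM (gtr0_norm d0) ler_piMl// ltW.
Qed.

Lemma ultra_close_seq (C : eqType) (cs : seq C) (a : C -> nat -> R) (M d : R) :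
  (forall c k, `|a c k| <= M) -> 0 < d ->
  exists2 S, F S & forall c p q, c \in cs -> S p -> S q -> `|a c p - a c q| <= d.
Proof.
move=> hM d0; elim: cs => [|c cs [S FS hS]]; first by exists setT => //; exact: filterT.
have [S' FS' hS'] := ultra_close (hM c) d0.
exists (S `&` S'); first exact: filterI.
by move=> c' p q; rewrite in_cons => /orP[/eqP->|h] [? ?] [? ?]; [exact: hS'|exact: hS].
Qed.

End ultrafilter.

(** * Rellich compactness *)

Section rellich.
Context {R : realType} {n : nat}.
Local Notation T := 'rV[R]_n.
Local Notation mu := (rV_lebesgue R n).
Local Notation IT f := (\int[mu]_(x in setT) f x).
Variables (Om : set T) (oO : open Om) (bO : bounded_set Om).
Let mO : measurable Om := open_measurable_rV oO.
Let fO : (mu Om < +oo)%E := bounded_finite mO bO.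
Local Notation I f := (\int[mu]_(x in Om) f x).
Local Notation J := (option 'I_n).
Local Notation H0 := (H0 Om).
Variables (L B : R) (U : nat -> J -> T -> R).
Hypotheses (L0 : 0 <= L) (B0 : 0 <= B).
Hypothesis HU : forall k, H0 (U k).
Hypothesis UL : forall k i, {ae mu, forall x, Om x -> `|U k (Some i) x| <= L}.
Hypothesis UB : forall k, {ae mu, forall x, Om x -> `|U k None x| <= B}.

Let m := I (fun=> 1).
Let m0 : 0 <= m. Proof. by apply: RI_ge0_ae => //; apply: aeW. Qed.

Let avg_bnd c (s : R) k : 0 < s -> `|avg (ext Om (U k)) c s| <= B * m.
Proof.
move=> s0; have iw := ext_intg oO bO (HU k); have mQ := @measurable_ball R n c s.
have iQ : intg mu (ball c s) (ext Om (U k)) by apply: integrableS iw.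
apply: le_trans (RI_norm_le mQ (intg_meas iQ) (intg_norm mQ iQ) (aeW _ (fun _ _ => lexx _))) _.
apply: (@le_trans _ _ (IT (fun x => `|ext Om (U k) x|))).
  rewrite Rintegral_mkcond; apply: RI_le => //.
  - by apply/(intg_restrict _ mQ); exact: intg_norm.
  - exact: intg_norm.
  - by move=> x _; rewrite patchE; case: ifP => // _; exact: normr_ge0.
rewrite -(@RI_supp _ _ Om); last by move=> x nO; rewrite /ext patchE memNset// normr0.
have [LU _] := HU k; rewrite /m -RIZ//; last exact: intg_cst.
have -> : I (fun x => `|ext Om (U k) x|) = I (fun x => `|U k None x|).
  by apply: eq_Rintegral => x Ox; rewrite /ext patchE Ox.
apply: RI_le_ae => //.
- by apply: intg_norm => //; exact: L2_intg (LU None).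
- by apply: intgZ => //; exact: intg_cst.
- by apply: filterS (UB k) => x h Ox; rewrite mulr1 h.
Qed.

Let diff p q (j : J) x := 1 * U p j x + (-1) * U q j x.

Let diff_H0 p q : H0 (diff p q). Proof. exact: H0_lin. Qed.

Let avg_diff p q c (s : R) : avg (ext Om (diff p q)) c s = avg (ext Om (U p)) c s - avg (ext Om (U q)) c s.
Proof.
have mQ := @measurable_ball R n c s; have iw k := ext_intg oO bO (HU k).
rewrite /avg -RIB//; try by apply: integrableS (iw _).
by apply: eq_Rintegral => x _; rewrite /ext !patchE; case: ifP => _; rewrite /diff ?mul1r ?mulN1r ?subrr.
Qed.

Let C := \sum_(i < n) (2 * L * m).

Let shift_diff p q (s : R) (h : T) : 0 < s -> ball 0 (2 * s) h ->
  shift_norm (ext Om (diff p q)) h <= 2 * s * C.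
Proof.
move=> s0 hb; apply: le_trans (shift_norm_H0 oO bO h (diff_H0 p q)) _.
rewrite /C mulr_sumr; apply: ler_sum => i _; have [LD _] := diff_H0 p q; apply: ler_pM => //.
- by apply: RI_ge0_ae => //; [apply: measurableT_comp => //; exact: L2_meas (LD _)|exact: aeW].
- move: hb; rewrite ball_box ?mulr_gt0// => /(_ i); rewrite !mxE sub0r add0r => -[h1 h2].
  by rewrite ler_norml (ltW h1) (ltW h2).
- rewrite /m -RIZ//; last exact: intg_cst.
  apply: RI_le_ae => //.
  + by apply: intg_norm => //; exact: L2_intg (LD _).
  + by apply: intgZ => //; exact: intg_cst.
  + apply: filterS (filterI (UL p i) (UL q i)) => x [h1 h2] Ox; rewrite /diff mul1r mulN1r mulr1.
    by apply: le_trans (ler_normB _ _) _; have := h1 Ox; have := h2 Ox => *; lra.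
Qed.

Let C0 : 0 <= C. Proof. by apply: sumr_ge0 => i _; rewrite !mulr_ge0. Qed.

(** [L1_local] reduces the L1 distance to finitely many averages, close along the ultrafilter, plus
    a shift term that is small with the radius of the balls. *)
Lemma rellich_ultra (F : set_system nat) (FU : UltraFilter F) (e : R) : 0 < e ->
  exists2 S, F S & forall p q, S p -> S q -> I (fun x => `|U p None x - U q None x|) <= e.
Proof.
move=> e0; pose A : R := 2 ^+ n * 4 * C; have A0 : 0 <= A by rewrite !mulr_ge0 ?exprn_ge0.
(* As (4 s)^n = 2^n b, the shift term equals b A s / 2, at most b e / 2; [d] below keeps the
   averages within the other half. *)
pose s := e / (A + 1); have s0 : 0 < s by rewrite divr_gt0// ltr_wpDl.
have [cs hcs] := finite_ball_cover bO s0.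
pose b := (2 * s) ^+ n; have b0 : 0 < b by rewrite exprn_gt0// mulr_gt0.
pose k : R := m * (size cs)%:R; have k0 : 0 <= k by rewrite mulr_ge0.
pose d := b * (e / 2) / (k + 1); have d0 : 0 < d by rewrite divr_gt0 ?ltr_wpDl// mulr_gt0// divr_gt0.
have [S FS hS] := ultra_close_seq FU cs (a := fun c k => avg (ext Om (U k)) c s)
  (fun c k => avg_bnd c k s0) d0.
exists S => // p q Sp Sq; have iw := ext_intg oO bO (diff_H0 p q).
have sw : supp Om (ext Om (diff p q)) by move=> x nO; rewrite /ext patchE memNset.
have M0 : 0 <= 2 * s * C by rewrite mulr_ge0// mulr_ge0// (ltW s0).
have := L1_local oO bO s0 M0 iw sw hcs (fun h => @shift_diff p q s h s0).
have -> : I (fun x => `|ext Om (diff p q) x|) = I (fun x => `|U p None x - U q None x|).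
  by apply: eq_Rintegral => x Ox; rewrite /ext patchE Ox /diff mul1r mulN1r.
rewrite -/b -/m => h.
have h1 : \sum_(c <- cs) `|avg (ext Om (diff p q)) c s| <= (size cs)%:R * d.
  rewrite -sum1_size natr_sum mulr_suml big_seq [leRHS]big_seq; apply: ler_sum => c ccs.
  by rewrite mul1r avg_diff; exact: hS.
have h2 : m * \sum_(c <- cs) `|avg (ext Om (diff p q)) c s| <= b * (e / 2).
  apply: (@le_trans _ _ (k * d)); first by rewrite /k -mulrA ler_wpM2l.
  rewrite /d mulrCA; rewrite -[leRHS]mulr1 ler_wpM2l ?mulr_ge0 ?(ltW b0) ?divr_ge0 ?(ltW e0)//.
  by rewrite ler_pdivrMr ?mul1r ?ltr_wpDl// lerDl.
have h3 : (4 * s) ^+ n * (2 * s * C) <= b * (e / 2).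
  have -> : (4 * s) ^+ n = 2 ^+ n * b by rewrite /b -exprMn; congr (_ ^+ n); ring.
  rewrite [leLHS](_ : _ = b * (2 * s * C * 2 ^+ n)); last by ring.
  rewrite ler_wpM2l ?(ltW b0)//.
  have -> : 2 * s * C * 2 ^+ n = A * s / 2 by rewrite /A; field.
  rewrite ler_wpM2r ?invr_ge0// /s mulrCA -[leRHS]mulr1 ler_wpM2l ?(ltW e0)//.
  by rewrite ler_pdivrMr ?mul1r ?ltr_wpDl// lerDl.
rewrite -(ler_pM2l b0); apply: le_trans h _; apply: le_trans (lerD h2 h3) _.
by rewrite -mulrDr -splitr.
Qed.

(** One ultrafilter finer than the filter at infinity serves all tolerances: s k is picked beyond k
    in the intersection of the first k + 1 sets, which belongs to it. No nested subsequences are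
    needed. *)
Lemma rellich : exists2 s : nat -> nat, (forall k, (k <= s k)%N) &
  forall e : R, 0 < e -> exists n, forall p q, (n <= p)%N -> (n <= q)%N ->
    I (fun x => `|U (s p) None x - U (s q) None x|) <= e.
Proof.
have [F [FU sF]] := @ultraFilterLemma nat \oo _.
have hk (k : nat) : exists S, F S /\
    forall p q, S p -> S q -> I (fun x => `|U p None x - U q None x|) <= inat k.
  by have [S ? ?] := rellich_ultra FU (@inat_gt0 R k); exists S.
have [S hS] := choice hk.
have hs (k : nat) : exists p, (k <= p)%N /\ forall i, (i <= k)%N -> S i p.
  have FI : F [set p | forall i : 'I_k.+1, S i p].
    by apply: (@filter_forall _ 'I_k.+1 (fun i p => S i p)) => i; have [] := hS i.
  have Fk : F [set p | (k <= p)%N] by apply: sF; exists k.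
  have [p [h1 h2]] := @filter_ex _ F _ _ (filterI FI Fk).
  exists p; split => // i ik; have := h1 (Ordinal (ik : (i < k.+1)%N)); exact.
have [s hs'] := choice hs; exists s; first by move=> k; have [] := hs' k.
move=> e e0; have [N hN] : exists N, inat N <= e.
  have := @cvg_harmonic R; move=> /cvgrPdist_le/(_ _ e0)[N _ hN]; exists N.
  have := hN N (leqnn N); rewrite sub0r normrN ger0_norm//; exact: ltW (inat_gt0 N).
exists N => p q Np Nq; apply: le_trans hN; have [_ h] := hS N; apply: h.
  by have [_] := hs' p; apply.
by have [_] := hs' q; apply.
Qed.

End rellich.

(** * Slopes of the coefficients *)

Section smooth_step_more.
Context {R : realType}.
Implicit Types t : R.

Lemma smooth_step_le s t : s <= t -> smooth_step s <= smooth_step t :> R.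
Proof.
rewrite le_eqVlt => /predU1P[->//|st].
have hd (x : R) : is_derive x 1 smooth_step (dstep x) := is_derive_step x.
have [|c _] := @MVT R smooth_step dstep s t st (fun x _ => hd x).
  by apply: derivable_within_continuous => x _; case: (hd x).
by move=> e; rewrite -subr_ge0 e mulr_ge0 ?dstep_ge0// subr_ge0 ltW.
Qed.

Lemma dstep0 t : t <= 0 \/ 1 <= t -> dstep t = 0.
Proof.
move=> [h|h]; rewrite /dstep.
  by rewrite flat_npos// (flat1_0 h) !mul0r addr0 mul0r.
have h' : 1 - t <= 0 by lra.
by rewrite (flat1_0 h') (flat_npos _ h') !mulr0 addr0 mul0r.
Qed.

Lemma dstep_gt0 t : 0 < t -> t < 1 -> 0 < dstep t.
Proof.
move=> t0 t1; have t1' : 0 < 1 - t by lra.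
apply: divr_gt0; last by rewrite exprn_gt0// step_den_gt0.
rewrite ltr_pwDl//; last by rewrite mulr_ge0 ?flat1_ge0 ?flatX2_ge0.
by rewrite mulr_gt0 ?flat1_gt0// flat_pos// hornerXn mulr_gt0 ?expR_gt0// exprn_gt0// invr_gt0.
Qed.

Lemma continuous_dstep : continuous (dstep : R -> R).
Proof.
have c1 : continuous (fun t : R => 1 - t).
  by move=> t; apply: cvgB; [exact: cvg_cst|exact: cvg_id].
have cf p (t : R) : flat p s @[s --> t] --> flat p t by exact: continuous_flat.
have cf1 p (t : R) : flat p (1 - s) @[s --> t] --> flat p (1 - t).
  by apply: (@continuous_comp _ _ _ (fun s : R => 1 - s) (flat p)); [exact: c1|exact: continuous_flat].
move=> t; apply: (@cvgM R).
  by apply: cvgD; apply: cvgM; [exact: cf|exact: cf1|exact: cf|exact: cf1].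
apply: cvgV; first by rewrite expf_neq0// gt_eqF// step_den_gt0.
have h : flat1 s + flat1 (1 - s) @[s --> t] --> flat1 t + flat1 (1 - t).
  by apply: cvgD; [exact: cf|exact: cf1].
exact: (cvgM h h).
Qed.

End smooth_step_more.

(** * From bounds on a weak derivative to slopes *)

Section slope.
Context {R : realType} {n : nat}.
Local Notation T := 'rV[R]_n.
Local Notation mu := (rV_lebesgue R n).
Local Notation IT f := (\int[mu]_(x in setT) f x).
Implicit Types (U : set T) (h g : T -> R) (i : 'I_n).

Lemma addeE (x : T) (t : R) i j : (x + t *: evec i) ord0 j = x ord0 j + t * (j == i)%:R.
Proof. by rewrite !mxE eqxx. Qed.

Lemma is_weak_partialN U i h g : open U -> is_weak_partial U i h g ->
  is_weak_partial U i (fun x => - h x) (fun x => - g x).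
Proof.
move=> oU [Lh Lg hw]; have mU := open_measurable_rV oU.
have RIN f phi : loc_integrable U f -> test_function U phi ->
    \int[mu]_(x in U) (- f x * phi x) = - \int[mu]_(x in U) (f x * phi x).
  move=> Lf tphi; rewrite -mulN1r -RIZ//; last exact: loc_intg_test.
  by apply: eq_Rintegral => x _; rewrite mulN1r mulNr.
have LN f : loc_integrable U f -> loc_integrable U (fun x => - f x).
  move=> [mf hf]; split; first exact: (measurableT_comp (f := -%R : R -> R)).
  move=> K cK KU; have mK := compact_measurable_rV cK.
  have h1 := intgZ mK (-1) (hf K cK KU).
  by apply: (eq_intg mK _ h1) => x _; rewrite mulN1r.
split; [exact: LN|exact: LN|] => phi tphi.
by rewrite !RIN ?hw//; exact: test_deriv.
Qed.

(** Corners of a thin box around a segment: half-width d across, but along the direction i it starts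
    exactly at x0. *)
Definition seg_lo i (d : R) (x0 : T) j := if j == i then x0 ord0 i else x0 ord0 j - d.
Definition seg_hi i (d s : R) (x0 : T) j := if j == i then x0 ord0 i + s else x0 ord0 j + d.

Lemma segP i (d s : R) (x0 y : T) : cbox (seg_lo i d x0) (seg_hi i d s x0) y <->
  [/\ (forall j, j != i -> `|y ord0 j - x0 ord0 j| <= d),
    x0 ord0 i <= y ord0 i & y ord0 i <= x0 ord0 i + s].
Proof.
split=> [h|[h1 h2 h3] j]; last first.
  rewrite /seg_lo /seg_hi; case: (eqVneq j i) => [->//|ji].
  by have := h1 j ji; rewrite ler_norml => /andP[? ?]; split; lra.
split.
- move=> j ji; have := h j; rewrite /seg_lo /seg_hi (negbTE ji) => -[? ?].
  by rewrite ler_norml; apply/andP; split; lra.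
- by have := h i; rewrite /seg_lo eqxx => -[].
- by have := h i; rewrite /seg_hi eqxx => -[].
Qed.

(* zeta is the difference Z - Z(. - tau e_i), where Z is the product of a bump
   in the other variables and of a smooth step in the variable i *)
Lemma segment_bump i (x0 : T) (tau d : R) : 0 <= tau -> 0 < d -> exists zeta eta : T -> R,
  [/\ (forall k, Ck k zeta) /\ supp (cbox (seg_lo i d x0) (seg_hi i d (tau + d) x0)) zeta,
      continuous eta /\ supp (cbox (seg_lo i d x0) (seg_hi i d d x0)) eta,
      forall x, 0 <= zeta x /\ 0 <= eta x,
      forall x, 'D_(evec i) zeta x = eta x - eta (x - tau *: evec i) &
      forall x, box (seg_lo i d x0) (seg_hi i d d x0) x -> 0 < eta x].
Proof.
move=> tau0 d_gt0; pose v : T := tau *: evec i.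
pose P (x : T) : R := \prod_(j | j != i) (flat1 (x ord0 j - (x0 ord0 j - d)) * flat1 ((x0 ord0 j + d) - x ord0 j)).
have CP k : Ck k P.
  apply: (@Ck_prod _ _ _ _ _ _ (fun j (x : T) => flat1 (x ord0 j - (x0 ord0 j - d)) * flat1 ((x0 ord0 j + d) - x ord0 j))) => j.
  apply: Ck_mul; apply: Ck_flat; apply: Ck_sub; try exact: Ck_coord; exact: Ck_cst.
have P0 x : 0 <= P x by apply: prodr_ge0 => j _; rewrite mulr_ge0 ?flat1_ge0.
have Pshift (x : T) t : P (x + t *: evec i) = P x.
  by apply: eq_bigr => j ji; rewrite addeE (negbTE ji) mulr0 addr0.
have Pgt0 (x : T) : (forall j, j != i -> `|x ord0 j - x0 ord0 j| < d) -> 0 < P x.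
  move=> hx; apply: prodr_gt0 => j ji; have := hx j ji; rewrite ltr_norml => /andP[? ?].
  by rewrite mulr_gt0// flat1_gt0//; lra.
have Psupp (x : T) : ~ (forall j, j != i -> `|x ord0 j - x0 ord0 j| <= d) -> P x = 0.
  move=> nx; have [j [ji hj]] : exists j, j != i /\ d < `|x ord0 j - x0 ord0 j|.
    apply: contrapT => /forallNP hx; apply: nx => j ji; rewrite leNgt; apply/negP => hj.
    by apply: (hx j).
  rewrite /P (bigD1 j)//=; move: hj; rewrite ltr_normr => /orP[hj|hj].
    by rewrite (@flat1_0 _ (_ + _ - _)) ?mulr0 ?mul0r//; lra.
  by rewrite flat1_0 ?mul0r//; lra.
(* Rescaled so that the smooth step rises from 0 to 1 within the distance d after x0. *)
pose a (x : T) : R := (x ord0 i - x0 ord0 i) / d.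
have Ca k : Ck k a.
  by apply: Ck_mul; [apply: Ck_sub; [exact: Ck_coord|exact: Ck_cst]|exact: Ck_cst].
have aE (x : T) : a (x - v) = (x ord0 i - tau - x0 ord0 i) / d.
  by rewrite /a /v -scaleNr addeE eqxx mulr1.
pose eta x := P x * (dstep (a x) / d).
pose zeta x := P x * (smooth_step (a x) - smooth_step ((x ord0 i - tau - x0 ord0 i) / d)).
have da (x : T) : is_derive x (evec i) a d^-1.
  have h1 := is_derive_sub (is_derive_coord i i x) (is_derive_cst (x0 ord0 i : R) x (evec i)).
  have h2 := is_derive_prod h1 (is_derive_cst (d^-1 : R) x (evec i)).
  apply: is_derive_congr h2 _ _ => //; by rewrite eqxx subr0 mul1r mulr0 addr0.
have da' (x : T) : is_derive x (evec i) (fun x : T => (x ord0 i - tau - x0 ord0 i) / d) d^-1.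
  have h0 := is_derive_sub (is_derive_coord i i x) (is_derive_cst (tau : R) x (evec i)).
  have h1 := is_derive_sub h0 (is_derive_cst (x0 ord0 i : R) x (evec i)).
  have h2 := is_derive_prod h1 (is_derive_cst (d^-1 : R) x (evec i)).
  apply: is_derive_congr h2 _ _ => //; by rewrite eqxx !subr0 mul1r mulr0 addr0.
have dP (x : T) : is_derive x (evec i) P 0.
  apply: is_derive_line0; have h1 := is_derive_cst (P x : R) (0 : R) 1.
  by apply: is_derive_congr h1 _ _ => //; apply/funext => s /=; rewrite addrC Pshift.
have dz (x : T) : 'D_(evec i) zeta x = eta x - eta (x - v).
  have h1 := is_derive_comp (da x) (is_derive_step _).
  have h2 := is_derive_comp (da' x) (is_derive_step _).
  have [_ ->] := is_derive_prod (dP x) (is_derive_sub h1 h2).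
  have Pv : P (x - v) = P x by rewrite /v -scaleNr Pshift.
  by rewrite mul0r add0r /eta aE Pv mulrBr.
have Cz k : Ck k zeta.
  apply: Ck_mul => //; apply: Ck_sub; apply: Ck_step => //.
  by apply: Ck_mul; [do 2 (apply: Ck_sub; last exact: Ck_cst); exact: Ck_coord|exact: Ck_cst].
have zsupp : supp (cbox (seg_lo i d x0) (seg_hi i d (tau + d) x0)) zeta.
  move=> y nK; rewrite /zeta.
  have [hP|/Psupp->] := pselect (forall j, j != i -> `|y ord0 j - x0 ord0 j| <= d); last by rewrite mul0r.
  have [h1|h1] := ltP (y ord0 i) (x0 ord0 i).
    rewrite !smooth_step0 ?subrr ?mulr0//; apply: mulr_le0_ge0; rewrite ?invr_ge0 ?(ltW d_gt0)//; lra.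
  have [h2|h2] := leP (y ord0 i) (x0 ord0 i + (tau + d)); first by case: nK; apply/segP.
  rewrite !smooth_step1 ?subrr ?mulr0// ler_pdivlMr//; lra.
have esupp : supp (cbox (seg_lo i d x0) (seg_hi i d d x0)) eta.
  move=> y nK; rewrite /eta.
  have [hP|/Psupp->] := pselect (forall j, j != i -> `|y ord0 j - x0 ord0 j| <= d); last by rewrite mul0r.
  rewrite dstep0 ?mul0r ?mulr0//.
  have [h1|h1] := ltP (y ord0 i) (x0 ord0 i).
    left; apply: mulr_le0_ge0; rewrite ?invr_ge0 ?(ltW d_gt0)//; lra.
  have [h2|h2] := leP (y ord0 i) (x0 ord0 i + d); first by case: nK; apply/segP.
  by right; rewrite ler_pdivlMr//; lra.
have z0 x : 0 <= zeta x.
  rewrite mulr_ge0// subr_ge0; apply: smooth_step_le; rewrite /a ler_pM2r ?invr_gt0//; lra.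
have eta0 x : 0 <= eta x by rewrite mulr_ge0// divr_ge0 ?dstep_ge0// ltW.
have ceta : continuous eta.
  have h1 (x : T) : dstep (a y) @[y --> x] --> dstep (a x).
    apply: (@continuous_comp _ _ _ a dstep); last exact: continuous_dstep.
    exact: (Ck_continuous (Ca 0%N)).
  have h2 (x : T) : P y @[y --> x] --> P x by exact: (Ck_continuous (CP 0%N)).
  by move=> x; exact: (cvgM (h2 x) (cvgMl (h1 x))).
exists zeta, eta; split => // x Vx; rewrite /eta mulr_gt0//.
  apply: Pgt0 => j ji; have := Vx j; rewrite /seg_lo /seg_hi (negbTE ji) => -[? ?].
  by rewrite ltr_norml; apply/andP; split; lra.
have := Vx i; rewrite /seg_lo /seg_hi eqxx => -[? ?].
by rewrite divr_gt0// dstep_gt0// /a; [rewrite divr_gt0//; lra|rewrite ltr_pdivrMr//; lra].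
Qed.

(** An increment larger than c tau at x0 persists near x0 by continuity. Testing with zeta moves the
    difference onto h: the integral of (h(x + v) - h(x)) eta equals that of g zeta, at most c times
    that of zeta, which is c tau times that of eta. This contradicts the excess on the support of
    eta. *)
Lemma slope_le U i h g (c C tau d0 : R) (x0 : T) : open U ->
  (forall x, U x -> {for x, continuous h}) -> (forall x, U x -> `|h x| <= C) ->
  is_weak_partial U i h g -> {ae mu, forall x, U x -> g x <= c} ->
  0 <= tau -> 0 < d0 ->
  (forall y : T, (forall j, j != i -> `|y ord0 j - x0 ord0 j| <= d0) ->
     x0 ord0 i - d0 <= y ord0 i -> y ord0 i <= x0 ord0 i + tau + d0 -> U y) ->
  h (x0 + tau *: evec i) - h x0 <= c * tau.
Proof.
move=> oU ch hC [Lh Lg hw] hg tau0 d00 tube; rewrite leNgt; apply/negP => lt0.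
have mU := open_measurable_rV oU.
pose v : T := tau *: evec i.
have vE (x : T) j : (x + v) ord0 j = x ord0 j + tau * (j == i)%:R by exact: addeE.
have vE' (x : T) j : (x - v) ord0 j = x ord0 j - tau * (j == i)%:R.
  by rewrite /v -scaleNr addeE mulNr.
have Ux0 : U x0.
  apply: tube => [j _||]; [by rewrite subrr normr0 ltW|lra|lra].
have Ux0v : U (x0 + v).
  apply: tube => [j ji||]; rewrite vE.
  - by rewrite (negbTE ji) mulr0 addr0 subrr normr0 ltW.
  - by rewrite eqxx mulr1; lra.
  - by rewrite eqxx mulr1; lra.
have near0 : \forall y \near x0, c * tau < h (y + v) - h y.
  have h1 : h y @[y --> x0] --> h x0 := ch _ Ux0.
  have h2 : h (y + v) @[y --> x0] --> h (x0 + v).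
    apply: (@continuous_comp _ _ _ (fun y : T => y + v) h); last exact: ch.
    exact: (cvgD (@cvg_id _ (nbhs x0)) (cvg_cst v)).
  exact: (cvgr_gt _ (cvgB h2 h1)).
have [e /= e0 he] := (nbhs_ballP x0 _).1 near0.
pose d := Num.min (d0 / 2) (e / 2).
have d_gt0 : 0 < d by rewrite lt_min !divr_gt0.
have dd0 : d <= d0 by rewrite ge_min; apply/orP; left; lra.
have de : d < e by rewrite gt_min; apply/orP; right; lra.
have hclose (y : T) : (forall j, `|y ord0 j - x0 ord0 j| <= d) -> [/\ U y, U (y + v) & c * tau < h (y + v) - h y].
  move=> hy; have hi := hy i; rewrite ler_norml in hi; move/andP : hi => [hi1 hi2].
  split.
  - apply: tube => [j _||]; [by apply: le_trans (hy j) _|lra|lra].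
  - apply: tube => [j ji||]; rewrite vE.
    + by rewrite (negbTE ji) mulr0 addr0; exact: le_trans (hy j) dd0.
    + by rewrite eqxx mulr1; lra.
    + by rewrite eqxx mulr1; lra.
  - apply: he; rewrite (ball_box _ e0) => j; have := hy j; rewrite ler_norml => /andP[? ?]; split; lra.
have [zeta [eta [[Cz zsupp] [ceta esupp] ze0 dz eta_gt0]]] := segment_bump i x0 tau0 d_gt0.
have z0 x : 0 <= zeta x by have [] := ze0 x.
have eta0 x : 0 <= eta x by have [] := ze0 x.
pose K (s : R) : set T := cbox (seg_lo i d x0) (seg_hi i d s x0).
have cK s : compact (K s) by exact: compact_cbox.
have tz : test_function U zeta.
  split => //; exists (K (tau + d)); split => // y /segP[h1 h2 h3]; apply: tube; [|lra|lra].
  by move=> j ji; apply: le_trans (h1 j ji) dd0.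
have meta := cont_meas ceta.
have ieta : intg mu setT eta := cont_intg (cK d) ceta esupp.
have [E E0 hE] := cont_bnd (cK d) ceta esupp.
(* Extension by zero allows translations of the whole space; the values off [U] never meet the
   supports. *)
pose H := h \_ U.
have mH : measurable_fun setT H by apply/(restrict_measurable _ mU); exact: Lh.1.
have C0 : 0 <= C by apply: le_trans (hC _ Ux0).
have HC x : `|H x| <= C.
  by rewrite /H patchE; case: ifPn => [|_]; [rewrite inE; exact: hC|rewrite normr0].
have HU x : U x -> H x = h x by move=> Ux; rewrite /H patchE mem_set.
have iHe (w : T) : intg mu setT (fun x => H (x + w) * eta x).
  apply: (intg_bnd_supp (compact_measurable_rV (cK d)) (compact_finite (cK d)) (C := C * E)).
  - by apply: measurable_funM => //; apply: (measurableT_comp mH); exact: measurable_add.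
  - by move=> x; rewrite normrM; exact: ler_pM.
  - by move=> x /esupp->; rewrite mulr0.
have iH0 : intg mu setT (fun x => H x * eta x).
  by apply: (eq_intg measurableT _ (iHe 0)) => x _; rewrite addr0.
have iHs : intg mu setT (fun x => H x * eta (x - v)).
  by apply: (eq_intg measurableT _ (intg_translation (- v) (iHe v))) => x _; rewrite subrK.
have zint : intg mu setT zeta by exact: test_intg tz.
have E1 : IT (fun x => (H (x + v) - H x) * eta x) <= c * IT zeta.
  have e1 : \int[mu]_(x in U) (h x * 'D_(evec i) zeta x) =
      IT (fun x => H x * eta x) - IT (fun x => H (x + v) * eta x).
    rewrite (RI_test _ (test_deriv i tz)).
    have -> : IT (fun x => h x * 'D_(evec i) zeta x) = IT (fun x => H x * eta x - H x * eta (x - v)).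
      apply: eq_Rintegral => x _; rewrite -mulrBr -dz.
      have [Ux|nU] := pselect (U x); first by rewrite HU.
      by rewrite (test_supp (test_deriv i tz))// !mulr0.
    rewrite (RIB measurableT iH0 iHs); congr (_ - _).
    rewrite -(RI_translation v (f := fun x => H x * eta (x - v)))//; last exact: intg_meas iHs.
    by apply: eq_Rintegral => x _; rewrite addrK.
  have e2 : IT (fun x => (H (x + v) - H x) * eta x) = \int[mu]_(x in U) (g x * zeta x).
    apply: oppr_inj; rewrite -(hw _ tz) e1 -opprB; congr (- _).
    by rewrite -(RIB measurableT (iHe v) iH0); apply: eq_Rintegral => x _; rewrite mulrBl.
  rewrite e2 -(RIZ measurableT c zint).
  have -> : IT (fun x => c * zeta x) = \int[mu]_(x in U) (c * zeta x).
    by apply/esym/RI_supp => x /(test_supp tz)->; rewrite mulr0.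
  apply: RI_le_ae => //.
  - exact: loc_intg_test.
  - by apply: intgZ => //; apply: integrableS zint.
  - by apply: filterS hg => x hx Ux; apply: ler_wpM2r => //; exact: hx.
(* Integration by parts against the coordinate x_i, whose derivative is 1 and whose increment along
   v is tau. *)
have E2 : IT zeta = tau * IT eta.
  have h1 := by_parts i (cK (tau + d)) zsupp (Ck_coord 1 i) (Cz 1%N).
  have ix (w : T) : intg mu setT (fun x => (x + w) ord0 i * eta x).
    apply: (cont_intg (cK d)); last by move=> x /esupp->; rewrite mulr0.
    have hx (x : T) : (y + w) ord0 i @[y --> x] --> (x + w) ord0 i.
      apply: (@continuous_comp _ _ _ (fun y : T => y + w) (fun y : T => y ord0 i)); last exact: continuous_coord.
      exact: (cvgD (@cvg_id _ (nbhs x)) (cvg_cst w)).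
    by move=> x; exact: (cvgM (hx x) (ceta x)).
  have ix0 : intg mu setT (fun x => x ord0 i * eta x).
    by apply: (eq_intg measurableT _ (ix 0)) => x _; rewrite addr0.
  have ixs : intg mu setT (fun x => x ord0 i * eta (x - v)).
    by apply: (eq_intg measurableT _ (intg_translation (- v) (ix v))) => x _; rewrite subrK.
  have h2 : IT (fun x : T => x ord0 i * 'D_(evec i) zeta x) =
      IT (fun x : T => x ord0 i * eta x) - IT (fun x : T => (x + v) ord0 i * eta x).
    under eq_Rintegral do rewrite dz mulrBr.
    rewrite (RIB measurableT ix0 ixs); congr (_ - _).
    rewrite -(RI_translation v (f := fun x : T => x ord0 i * eta (x - v)))//; last exact: intg_meas ixs.
    by apply: eq_Rintegral => x _; rewrite addrK.
  have h3 : IT (fun x => 'D_(evec i) (fun y : T => y ord0 i) x * zeta x) = IT zeta.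
    by apply: eq_Rintegral => x _; have [_ ->] := is_derive_coord i i x; rewrite eqxx mul1r.
  rewrite h3 h2 -(RIB measurableT ix0 (ix v)) in h1; apply: oppr_inj; rewrite -h1 -mulNr -(RIZ measurableT (- tau) ieta).
  by apply: eq_Rintegral => x _; rewrite vE eqxx mulr1; ring.
pose F x := (H (x + v) - H x - c * tau) * eta x.
have iF : intg mu setT F.
  have h1 := intgB measurableT (intgB measurableT (iHe v) iH0) (intgZ measurableT (c * tau) ieta).
  by apply: (eq_intg measurableT _ h1) => x _; rewrite /F; ring.
have F0 (x : T) : 0 <= F x.
  have [xK|/esupp h1] := pselect (K d x); last by rewrite /F h1 mulr0.
  have [h1 h2 h3] := (segP i d d x0 x).1 xK.
  have [|Ux Uxv hlt] := hclose x.
    move=> j; have [->|/h1//] := eqVneq j i; by rewrite ger0_norm ?subr_ge0// lerBlDl.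
  by rewrite /F !HU// mulr_ge0// subr_ge0 ltW.
have IF0 : IT F <= 0.
  have -> : IT F = IT (fun x => (H (x + v) - H x) * eta x - (c * tau) * eta x).
    by apply: eq_Rintegral => x _; rewrite /F; ring.
  have h1 : intg mu setT (fun x => (H (x + v) - H x) * eta x).
    by apply: (eq_intg measurableT _ (intgB measurableT (iHe v) iH0)) => x _; rewrite mulrBl.
  rewrite (RIB measurableT h1 (intgZ measurableT (c * tau) ieta)) (RIZ measurableT (c * tau) ieta).
  by rewrite subr_le0 -mulrA -E2.
(* [F] is nonnegative with nonpositive integral, hence null a.e., yet it is positive on a nonempty
   open box. *)
have F00 := RI_eq0 measurableT iF (aeW _ (fun x _ => F0 x)) IF0.
pose V : set T := box (seg_lo i d x0) (seg_hi i d d x0).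
have oV : open V by exact: open_box.
have neV : V !=set0.
  exists (\row_j if j == i then x0 ord0 i + d / 2 else x0 ord0 j) => j; rewrite mxE /seg_lo /seg_hi.
  by case: ifP => _; split; lra.
apply: (open_not_null oV neV); apply: negligibleS F00 => x Vx /= /(_ I); apply/eqP; rewrite gt_eqF//.
have xK : K d x by exact: box_cbox.
have [h1 h2 h3] := (segP i d d x0 x).1 xK.
have [|Ux Uxv hlt] := hclose x.
  move=> j; have [->|/h1//] := eqVneq j i; by rewrite ger0_norm ?subr_ge0// lerBlDl.
by rewrite /F !HU// mulr_gt0 ?subr_gt0//; exact: eta_gt0.
Qed.

End slope.

(** * The coefficients as functions of x and u *)

Section coefficients.
Context {R : realType} {N : nat}.
Variables (Om : set 'rV[R]_N) (oO : open Om) (h : 'rV[R]_N -> R -> R).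
Hypothesis ch : {in Om `*` [set: R], continuous (fun z : 'rV[R]_N * R => h z.1 z.2)}.
Local Notation mu := (rV_lebesgue R (N + 1)).

Lemma lsubmx_continuous : continuous (lsubmx : 'rV[R]_(N + 1) -> 'rV[R]_N).
Proof.
move=> z A /nbhs_ballP[e /= e0 he]; change (nbhs z (lsubmx @^-1` A)).
apply/nbhs_ballP; exists e => // y; rewrite (ball_box _ e0) => hz; apply: he.
by rewrite (ball_box _ e0) => j; have := hz (lshift 1 j); rewrite !mxE.
Qed.

Lemma last_continuous : continuous (fun z : 'rV[R]_(N + 1) => rsubmx z ord0 ord0).
Proof.
rewrite (_ : (fun z => _) = (fun z : 'rV[R]_(N + 1) => z ord0 (u_index))).
  exact: continuous_coord.
by apply/funext => z; rewrite mxE.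
Qed.

Lemma joint_continuous (z : 'rV[R]_(N + 1)) : Om (lsubmx z) -> {for z, continuous (joint h)}.
Proof.
move=> Oz.
have h1 : (fun y : 'rV[R]_(N + 1) => (lsubmx y, rsubmx y ord0 ord0)) y @[y --> z] -->
    (lsubmx z, rsubmx z ord0 ord0).
  have h2 : lsubmx y @[y --> z] --> lsubmx z := lsubmx_continuous (x := z).
  have h3 : rsubmx y ord0 ord0 @[y --> z] --> rsubmx z ord0 ord0 := last_continuous (x := z).
  exact: (cvg_pair h2 h3).
apply: (@continuous_comp _ _ _ (fun y : 'rV[R]_(N + 1) => (lsubmx y, rsubmx y ord0 ord0))
  (fun p : 'rV[R]_N * R => h p.1 p.2)); first exact: h1.
by apply: ch; rewrite inE.
Qed.

Lemma base_open : open [set z : 'rV[R]_(N + 1) | Om (lsubmx z)].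
Proof. by apply: (@open_comp _ _ lsubmx) => // z _; exact: lsubmx_continuous. Qed.

Lemma cylinder_open r : open (cylinder Om r).
Proof.
rewrite (_ : cylinder _ _ = [set z : 'rV[R]_(N + 1) | Om (lsubmx z)] `&`
    ((fun z : 'rV[R]_(N + 1) => rsubmx z ord0 ord0) @^-1` `]- r, r[)).
  apply: openI; first exact: base_open.
  by apply: open_comp; [move=> z _; exact: last_continuous|exact: itv_open].
by apply/seteqP; split => z /=; rewrite in_itv.
Qed.

Definition pt (x : 'rV[R]_N) (s : R) : 'rV[R]_(N + 1) := row_mx x (const_mx s).

Lemma pt_l x s : lsubmx (pt x s) = x. Proof. exact: row_mxKl. Qed.
Lemma pt_r x s : rsubmx (pt x s) ord0 ord0 = s. Proof. by rewrite row_mxKr mxE. Qed.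
Lemma pt_lE x s j : pt x s ord0 (lshift 1 j) = x ord0 j. Proof. exact: row_mxEl. Qed.
Lemma pt_u x s : pt x s ord0 u_index = s. Proof. exact: (etrans (row_mxEr _ _ _ _) (mxE _ _ _ _)). Qed.

Lemma joint_pt x s : joint h (pt x s) = h x s. Proof. by rewrite /joint pt_l pt_r. Qed.

Lemma pt_add x s t : pt x s + t *: evec u_index = pt x (s + t).
Proof.
apply/matrixP => i j; rewrite (ord1 i) addeE; case: (splitP j) => k jk.
  have -> : j = lshift 1 k by apply/val_inj.
  rewrite !pt_lE (_ : (lshift 1 k == u_index) = false) ?mulr0 ?addr0//.
  by apply/negP => /eqP/(congr1 val)/= e; have := ltn_ord k; rewrite e addn0 ltnn.
have -> : j = u_index by apply/val_inj; rewrite /= jk (ord1 k).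
by rewrite eqxx mulr1 !pt_u.
Qed.

Lemma cylinder_pt r x s : Om x -> - r < s < r -> cylinder Om r (pt x s).
Proof. by move=> Ox hs; split; rewrite ?pt_l ?pt_r. Qed.

(** [joint h] is Borel on the open set above [Om] by continuity and is composed with x -> (x, v x),
    where v is extended by zero to be measurable everywhere. *)
Lemma measurable_superposition (v : 'rV[R]_N -> R) : measurable_fun Om v ->
  measurable_fun Om (fun x => h x (v x)).
Proof.
move=> mv; have mO := open_measurable_rV oO.
pose p x := pt x ((v \_ Om) x).
have mvO : measurable_fun setT (v \_ Om) by apply/(restrict_measurable _ mO).
have mp : measurable_fun setT p.
  apply: measurable_fun_rVP => j; case: (splitP j) => k jk.
    have -> : j = lshift 1 k by apply/val_inj.
    under eq_fun do rewrite pt_lE.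
    exact: measurable_rV_coord.
  have -> : j = u_index by apply/val_inj; rewrite /= jk (ord1 k).
  by under eq_fun do rewrite pt_u.
have mj : measurable_fun [set z : 'rV[R]_(N + 1) | Om (lsubmx z)] (joint h).
  by apply: (continuous_measurable_rV base_open) => z Oz; exact: joint_continuous.
have : measurable_fun Om (joint h \o p).
  apply: (measurable_comp _ _ mj); first exact: open_measurable_rV base_open.
    by move=> _ [x Ox <-] /=; rewrite pt_l.
  exact: measurable_funTS.
by apply: eq_measurable_fun => x Ox; rewrite /= joint_pt patchE Ox.
Qed.

(** Continuity upgrades the essential bound to one at every point of the cylinder, as needed on
    graphs of functions of x. *)
Lemma coefficient_bnd r : Lp +oo%E (cylinder Om r) (joint h) ->
  exists2 C : R, 0 < C & forall x u, Om x -> - r < u < r -> `|h x u| <= C.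
Proof.
move=> hL; have oU := cylinder_open (r := r); have [_ [C C0 hC]] := LooP (open_measurable_rV oU) hL.
exists C => // x u Ox hu; have Uz := cylinder_pt Ox hu; rewrite -joint_pt.
have cj : {in cylinder Om r, continuous (fun z => `|joint h z|)}.
  move=> z; rewrite inE => -[Oz _]; have h1 : joint h y @[y --> z] --> joint h z := joint_continuous Oz.
  exact: (cvg_norm h1).
apply: (cont_ae_le oU cj _ hC Uz) => z _; exact: cst_continuous.
Qed.

Lemma slope_cylinder r c s t x (k g : 'rV[R]_(N + 1) -> R) (C : R) :
  (forall z, cylinder Om r z -> {for z, continuous k}) ->
  (forall z, cylinder Om r z -> `|k z| <= C) ->
  is_weak_partial (cylinder Om r) u_index k g ->
  {ae mu, forall z, cylinder Om r z -> g z <= c} ->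
  Om x -> - r < s -> s <= t -> t < r ->
  k (pt x t) - k (pt x s) <= c * (t - s).
Proof.
move=> ck kC hw hg Ox rs st tr.
have [e /= e0 he] := (nbhs_ballP x Om).1 (open_nbhs_nbhs (conj oO Ox)).
(* Half the room left in [Om] around x, above t and below s: the tube around the segment stays in
   the cylinder. *)
pose d := Num.min (e / 2) (Num.min ((r - t) / 2) ((s + r) / 2)).
have d0 : 0 < d by rewrite !lt_min !divr_gt0//; lra.
have d1 : d <= e / 2 by rewrite ge_min lexx.
have d2 : d <= (r - t) / 2 by rewrite /d !ge_min lexx orbT.
have d3 : d <= (s + r) / 2 by rewrite /d !ge_min lexx !orbT.
rewrite -[in k (pt x t)](subrKC s t) -pt_add.
apply: (@slope_le _ _ _ _ _ _ c C (t - s) d (pt x s) (cylinder_open (r := r)) ck kC hw hg _ d0).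
  by rewrite subr_ge0.
move=> y hy; rewrite pt_u => y1 y2; split.
  apply: he; rewrite (ball_box _ e0) => j; have ju : lshift 1 j != u_index.
    by apply/negP => /eqP/(congr1 val)/= f; have := ltn_ord j; rewrite f addn0 ltnn.
  have := hy _ ju; rewrite pt_lE mxE ler_norml => /andP[? ?]; split; lra.
have -> : rsubmx y ord0 ord0 = y ord0 u_index by rewrite mxE.
apply/andP; split; lra.
Qed.

Hypothesis hL : forall r, 0 < r -> Lp +oo%E (cylinder Om r) (joint h).
Hypothesis hd : forall r, 0 < r -> weakly_derivable (cylinder Om r) u_index (joint h).

Lemma coefficient_slope r c s t x : 0 < r ->
  {ae mu, forall z, cylinder Om r z -> weak_partial (cylinder Om r) u_index (joint h) z <= c} ->
  Om x -> - r < s -> s <= t -> t < r -> h x t - h x s <= c * (t - s).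
Proof.
move=> r0 hg Ox rs st tr; have [C C0 hC] := coefficient_bnd (hL r0).
rewrite -!joint_pt.
apply: (slope_cylinder (r := r) (C := C) _ _ (weak_partial_loc (hd r0)) hg Ox rs st tr).
  by move=> z [Oz _]; exact: joint_continuous.
by move=> z [Oz hz]; exact: hC.
Qed.

Lemma coefficient_lip r : 0 < r ->
  Lp +oo%E (cylinder Om r) (weak_partial (cylinder Om r) u_index (joint h)) ->
  exists2 L : R, 0 < L & forall x s t, Om x -> - r < s < r -> - r < t < r ->
    `|h x s - h x t| <= L * `|s - t|.
Proof.
move=> r0 hL'; have oU := cylinder_open (r := r); have [C C0 hC] := coefficient_bnd (hL r0).
have [_ [L L0 hgL]] := LooP (open_measurable_rV oU) hL'.
have hw := weak_partial_loc (hd r0).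
exists L => //.
have main x s t : Om x -> - r < s -> s <= t -> t < r -> `|h x t - h x s| <= L * (t - s).
  move=> Ox rs st tr; rewrite ler_norml; apply/andP; split.
    (* The lower bound is the upper bound on the slope of - h. *)
    have := @slope_cylinder r L s t x (fun z => - joint h z) _ C _ _ (is_weak_partialN oU hw) _ Ox rs st tr.
    rewrite !joint_pt => h1; rewrite lerNl opprB; apply: le_trans (h1 _ _ _); first by rewrite opprK addrC.
    - move=> z [Oz _]; have h2 : joint h y @[y --> z] --> joint h z := joint_continuous Oz.
      exact: (cvgN h2).
    - by move=> z [Oz hz]; rewrite normrN; exact: hC.
    - apply: filterS hgL => z hz Uz; apply: le_trans (ler_norm _) _; rewrite normrN; exact: hz.
  apply: (coefficient_slope r0 _ Ox rs st tr).
  by apply: filterS hgL => z hz Uz; apply: le_trans (ler_norm _) (hz Uz).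
move=> x s t Ox /andP[s1 s2] /andP[t1 t2]; have [st|ts] := leP s t.
  by rewrite distrC (distrC s) [X in _ <= _ * X]ger0_norm ?subr_ge0//; exact: main.
by rewrite [X in _ <= _ * X]ger0_norm ?subr_ge0 ?(ltW ts)//; exact: main Ox t1 (ltW ts) s2.
Qed.

End coefficients.

(** * The stationary problem *)

Section stationary_problem.
Context {R : realType} {N : nat}.
Local Notation T := 'rV[R]_N.
Local Notation mu := (rV_lebesgue R N).
Local Notation J := (option 'I_N).
Variables (Om : set T) (oO : open Om) (bO : bounded_set Om) (G : T -> R).
Let mO : measurable Om := open_measurable_rV oO.
Let fO : (mu Om < +oo)%E := bounded_finite mO bO.
Local Notation I f := (\int[mu]_(x in Om) f x).
Local Notation H0 := (H0 Om).
Local Notation KH := (KH Om G).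
Local Notation L2 := (L2 mu Om).

Lemma KG_KH u : KG Om G u -> KH (wfam Om u).
Proof. by move=> [/(H10_H0 oO bO)[Hu _] hu]. Qed.

Lemma KH_KG U : KH U -> KG Om G (U None).
Proof.
move=> [HU hU]; have [LU _] := HU.
have hw i := H0_weak_partial oO bO i HU.
have L2w i : L2 (weak_partial Om i (U None)).
  have [wd ae_eq] := hw i; have [_ [mw _] _] := weak_partial_loc wd.
  split => //; apply: (intg_le_ae mO _ (L2_sqr (LU (Some i)))); first exact: measurable_funX.
  by apply: filterS ae_eq => x h Ox; rewrite h// ger0_norm// sqr_ge0.
split.
  apply/(H10_H0 oO bO); split; last by move=> i; have [] := hw i.
  apply: (H0_ae oO bO HU) => -[i|] /=; [exact: L2w|exact: LU| |exact: aeW].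
  by have [_] := hw i; apply: filterS => x h /h.
have hall := ae_all (fun i => (hw i).2).
apply: filterS (filterI hU hall) => x [h1 h2] Ox; have := h1 Ox.
congr (enorm _ <= _); apply/matrixP => i j; rewrite !mxE; exact/esym/h2.
Qed.

Lemma sum_option (F : J -> R) : \sum_j F j = F None + \sum_i F (Some i).
Proof.
rewrite (bigD1 None)//=; congr (_ + _).
by rewrite (reindex_omap (@Some 'I_N) id)/=; [apply: eq_bigl => i; rewrite eqxx|case].
Qed.

(** The chosen weak gradient of a difference equals the difference of the gradients only a.e., so
    the two integrands are matched by uniqueness of weak derivatives. *)
Lemma VI_split (A U V : J -> T -> R) : (forall j, L2 (A j)) -> H0 U -> H0 V ->
  \sum_j I (fun x => A j x * (V j x - U j x)) =
  I (fun x => A None x * (V None x - U None x)) +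
  I (fun x => dot (\row_i A (Some i) x) (weak_grad Om (V None \- U None) x)).
Proof.
move=> LA HU HV; rewrite sum_option; congr (_ + _).
have HD := H0_lin oO bO 1 (-1) HV HU.
have e : (fun x => 1 * V None x + -1 * U None x) = V None \- U None.
  by apply/funext => x; rewrite mul1r mulN1r.
have hw i : {ae mu, forall x, Om x -> weak_partial Om i (V None \- U None) x = V (Some i) x - U (Some i) x}.
  have [_] := H0_weak_partial oO bO i HD; rewrite e; apply: filterS => x h Ox.
  by rewrite h// mul1r mulN1r.
have mw i : measurable_fun Om (weak_partial Om i (V None \- U None)).
  have [wd _] := H0_weak_partial oO bO i HD; rewrite e in wd.
  by have [_ [mw _] _] := weak_partial_loc wd.
have [LU _] := HU; have [LV _] := HV.
have LB i : L2 (fun x => V (Some i) x - U (Some i) x) by exact: L2B.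
rewrite -(RIsum mO fO); last by move=> i; exact: L2mul.
apply: RI_eq_ae => //.
- by apply: measurable_sum => i; apply: measurable_funM; [exact: L2_meas (LA _)|exact: L2_meas (LB i)].
- apply: measurable_sum => i; apply: measurable_funM.
    by under eq_fun do rewrite mxE; exact: L2_meas (LA _).
  by under eq_fun do rewrite mxE; exact: mw.
- apply: filterS (ae_all hw) => x h Ox; apply: eq_bigr => i _.
  by rewrite !mxE h.
Qed.

Variables (Phi : T -> R -> T) (f : T -> R -> R).

Definition coef (j : J) (x : T) (t : R) : R := if j is Some i then Phi x t ord0 i else - f x t.

Lemma stationary_VIE U V : (forall j, L2 (fun x => coef j x (U None x))) -> H0 U -> H0 V ->
  (0 <= \sum_j I (fun x => coef j x (U None x) * (V j x - U j x))) =
  (I (fun x => f x (U None x) * (V None x - U None x)) <=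
   I (fun x => dot (Phi x (U None x)) (weak_grad Om (V None \- U None) x))).
Proof.
move=> LA HU HV; have [LU _] := HU; have [LV _] := HV.
rewrite (VI_split LA HU HV) /=.
have -> : I (fun x => - f x (U None x) * (V None x - U None x)) =
    - I (fun x => f x (U None x) * (V None x - U None x)).
  have i1 := L2mul mO (LA None) (L2B mO (LV None) (LU None)).
  rewrite -mulN1r -RIZ//.
    by apply: eq_Rintegral => x _; rewrite mulN1r mulNr.
  by apply: (eq_intg mO _ (intgZ mO (-1) i1)) => x _; rewrite /= mulN1r mulNr opprK.
rewrite addrC subr_ge0; congr (_ <= _); apply: eq_Rintegral => x _.
congr dot; apply/matrixP => a b; by rewrite (ord1 a) mxE.
Qed.

End stationary_problem.

Theorem proposition2p5 (R : realType) (N : nat) (N_gt0 : (0 < N)%N)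
    (Omega : set 'rV[R]_N)
    (Omega_open : open Omega) (Omega_bounded : bounded_set Omega)
    (Omega_Lipschitz : Lipschitz_boundary Omega)
    (Phi : 'rV[R]_N -> R -> 'rV[R]_N) (f : 'rV[R]_N -> R -> R)
    (Phi_cont : {in Omega `*` [set: R],
      continuous (fun z : 'rV[R]_N * R => Phi z.1 z.2)})
    (f_cont : {in Omega `*` [set: R],
      continuous (fun z : 'rV[R]_N * R => f z.1 z.2)})
    (Phi_W2oo : forall r : R, 0 < r -> forall i : 'I_N,
      Woo 2 (cylinder Omega r) (joint (fun x u => Phi x u ord0 i)))
    (f_W1oo : forall r : R, 0 < r -> Woo 1 (cylinder Omega r) (joint f))
    (c1 c2 : R) (c1_gt0 : 0 < c1) (c2_gt0 : 0 < c2)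
    (growth : {ae rV_lebesgue R N, forall x, Omega x -> forall u : R,
      `|divx Phi x u + f x u| <= c1 * `|u| + c2})
    (mu : R) (mu_gt0 : 0 < mu)
    (f_decr : forall r : R, 0 < r ->
      {ae rV_lebesgue R (N + 1), forall z, cylinder Omega r z ->
        weak_partial (cylinder Omega r) u_index (joint f) z <= - mu})
    (G : 'rV[R]_N -> R) (G_Loo : Lp +oo%E Omega G)
    (lambda Lambda : R) (lambda_gt0 : 0 < lambda)
    (G_bounds : {ae rV_lebesgue R N, forall x, Omega x ->
      lambda <= G x <= Lambda}) :
  exists2 theta : 'rV[R]_N -> R,
    stationary_VI Omega Phi f G theta &
    forall theta' : 'rV[R]_N -> R, stationary_VI Omega Phi f G theta' ->
      {ae rV_lebesgue R N, forall x, Omega x -> theta' x = theta x}.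
Proof.
have mO := open_measurable_rV Omega_open; have fO := bounded_finite mO Omega_bounded.
have [r0 r0_gt0 Or] := bounded_cube Omega_bounded.
pose L := `|Lambda|; have L0 : 0 <= L by exact: normr_ge0.
have [mG _] := LooP mO G_Loo.
have hG : {ae rV_lebesgue R N, forall x, Omega x -> 0 <= G x <= L}.
  apply: filterS G_bounds => x h /h/andP[h1 h2]; rewrite (le_trans (ltW lambda_gt0) h1)/=.
  exact: le_trans h2 (ler_norm _).
(* The sup bound of [KH_sup]; it also dominates L because y + 1 <= exp y, so a single constant
   serves the function and its gradient. *)
pose Bd := expR (2 * r0 + L); have Bd_gt0 : 0 < Bd by exact: expR_gt0.
have LBd : L <= Bd.
  by apply: le_trans (expR_ge1Dx _); lra.
pose K := KH Omega G; pose F := coef Phi f.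
have Phii_cont i : {in Omega `*` [set: R], continuous (fun z : 'rV[R]_N * R => Phi z.1 z.2 ord0 i)}.
  move=> z Oz; apply: (@continuous_comp _ _ _ (fun z : 'rV[R]_N * R => Phi z.1 z.2) (fun y : 'rV[R]_N => y ord0 i)).
    exact: Phi_cont.
  exact: coord_continuous.
(* The cylinder is open in u, so its height must strictly exceed the attained values. *)
pose r := Bd + 1; have r_gt0 : 0 < r by rewrite addr_gt0.
have inr t : `|t| <= Bd -> - r < t < r by rewrite ler_norml => /andP[? ?]; apply/andP; split; rewrite /r; lra.
have K_bnd U : K U -> forall j, {ae rV_lebesgue R N, forall x, Omega x -> `|U j x| <= Bd}.
  move=> KU [i|]; last exact: (KH_sup Omega_open Omega_bounded L0 hG (Ordinal N_gt0) Or KU).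
  by apply: filterS (KH_grad hG KU i) => x h /h h'; exact: le_trans LBd.
have K_meas U : K U -> forall j, measurable_fun Omega (U j) := @KH_meas _ _ _ _ U.
have F_meas U : K U -> forall j, measurable_fun Omega (fun x => F j x (U None x)).
  move=> KU [i|].
    exact: (measurable_superposition Omega_open (Phii_cont i) (K_meas _ KU None)).
  apply: (measurableT_comp (f := -%R : R -> R)) => //.
  exact: (measurable_superposition Omega_open f_cont (K_meas _ KU None)).
have bnd j : exists C : R, 0 < C /\ forall x t, Omega x -> `|t| <= Bd -> `|F j x t| <= C.
  case: j => [i|].
    have [C C0 hC] := coefficient_bnd Omega_open (Phii_cont i) (Phi_W2oo r r_gt0 i).1.
    by exists C; split => // x t Ox /inr; exact: hC.
  have [C C0 hC] := coefficient_bnd Omega_open f_cont (f_W1oo r r_gt0).1.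
  by exists C; split => // x t Ox /inr ht; rewrite /F /= normrN; exact: hC.
(* One constant per component; their sum is a bound for all of them. *)
have [c hc] := choice bnd.
have lip j : exists L' : R, 0 < L' /\ forall x s t, Omega x -> `|s| <= Bd -> `|t| <= Bd ->
    `|F j x s - F j x t| <= L' * `|s - t|.
  case: j => [i|].
    have [L' L'0 hL] := coefficient_lip Omega_open (Phii_cont i)
      (fun r r0 => (Phi_W2oo r r0 i).1) (fun r r0 => ((Phi_W2oo r r0 i).2 u_index).1)
      r_gt0 ((Phi_W2oo r r_gt0 i).2 u_index).2.1.
    by exists L'; split => // x s t Ox /inr hs /inr ht; exact: hL.
  have [L' L'0 hL] := coefficient_lip Omega_open f_cont
    (fun r r0 => (f_W1oo r r0).1) (fun r r0 => ((f_W1oo r r0).2 u_index).1)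
    r_gt0 ((f_W1oo r r_gt0).2 u_index).2.1.
  by exists L'; split => // x s t Ox /inr hs /inr ht; rewrite /F /= -opprD normrN; exact: hL.
have [l hl] := choice lip.
have c_le (a : option 'I_N -> R) j : (forall j, 0 < a j) -> a j <= \sum_j a j.
  by move=> a0; rewrite (bigD1 j)//= lerDl sumr_ge0// => k _; exact: ltW.
have c0 j : 0 < c j by have [] := hc j.
have l0 j : 0 < l j by have [] := hl j.
have lsum : 0 < \sum_j l j by exact: lt_le_trans (l0 None) (c_le l None l0).
have F_bnd j x t : Omega x -> `|t| <= Bd -> `|F j x t| <= \sum_j c j.
  by move=> Ox ht; apply: le_trans (c_le c j c0); have [_] := hc j; apply.
have F_lip j x s t : Omega x -> `|s| <= Bd -> `|t| <= Bd ->
    `|F j x s - F j x t| <= (\sum_j l j) * `|s - t|.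
  move=> Ox hs ht; have [_ h] := hl j; apply: le_trans (h x s t Ox hs ht) _.
  by apply: ler_wpM2r => //; exact: c_le.
have F_mono x s t : Omega x -> `|s| <= Bd -> `|t| <= Bd ->
    mu * (s - t) ^+ 2 <= (F None x s - F None x t) * (s - t).
  move=> Ox hs ht.
  (* The a.e. bound - mu on the weak derivative holds as a slope at every x of [Omega]. *)
  have main a b : `|a| <= Bd -> `|b| <= Bd -> a <= b -> mu * (b - a) <= f x a - f x b.
    move=> /inr/andP[a1 _] /inr/andP[_ b2] ab.
    have := coefficient_slope Omega_open f_cont (fun r r0 => (f_W1oo r r0).1)
      (fun r r0 => ((f_W1oo r r0).2 u_index).1) r_gt0 (f_decr r r_gt0) Ox a1 ab b2.
    by move=> h; rewrite -lerN2 opprB -mulNr.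
  rewrite /F /=; have [st|/ltW ts] := leP s t.
    have := main s t hs ht st => h; have : 0 <= t - s by rewrite subr_ge0.
    by move=> h2; have := ler_wpM2r h2 h; move=> h3; rewrite expr2; lra.
  have := main t s ht hs ts => h; have : 0 <= s - t by rewrite subr_ge0.
  by move=> h2; have := ler_wpM2r h2 h; move=> h3; rewrite expr2; lra.
have K_trunc U V e := @KH_trunc R N Omega Omega_open Omega_bounded G L L0 hG U V e None erefl.
have FL2 U : K U -> forall j, L2 (rV_lebesgue R N) Omega (fun x => F j x (U None x)).
  move=> KU j; apply: (L2_bnd mO fO (C := \sum_j c j)); first exact: F_meas.
  by apply: filterS (K_bnd U KU None) => x h Ox; exact: F_bnd (h Ox).
have K_compact (U : nat -> option 'I_N -> 'rV[R]_N -> R) : (forall n, K (U n)) ->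
  exists2 s : nat -> nat, (forall k, (k <= s k)%N) &
    forall e : R, 0 < e -> exists n, forall p q, (n <= p)%N -> (n <= q)%N ->
      dL1 (rV_lebesgue R N) Omega None (U (s p)) (U (s q)) <= e.
  move=> KU; apply: (rellich Omega_open Omega_bounded L0 (B := Bd)).
  - by move=> k; have [] := KU k.
  - by move=> k; exact: (KH_grad hG (KU k)).
  - by move=> k; exact: (K_bnd _ (KU k) None).
have stat U : K U -> VI (rV_lebesgue R N) Omega K (fun j x => F j x (U None x)) U ->
    stationary_VI Omega Phi f G (U None).
  move=> KU hU; split; first exact: KH_KG.
  move=> v /(KG_KH Omega_open Omega_bounded) Kv.
  have := hU _ Kv; rewrite (stationary_VIE Omega_open Omega_bounded (FL2 U KU)) //.
    by have [] := KU.
  by have [] := Kv.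
(* Any solution, paired with its chosen weak gradient, is an element of [K] solving the abstract
   problem, so uniqueness covers all competitors. *)
have stat_inv u : stationary_VI Omega Phi f G u ->
    K (wfam Omega u) /\ VI (rV_lebesgue R N) Omega K (fun j x => F j x (wfam Omega u None x)) (wfam Omega u).
  move=> [Ku hu]; have KU := KG_KH Omega_open Omega_bounded Ku; split => // V KV.
  rewrite (stationary_VIE Omega_open Omega_bounded (FL2 _ KU)).
  - exact: hu (KH_KG Omega_open Omega_bounded KV).
  - by have [] := KU.
  - by have [] := KV.
have [U KU hU] := VI_exists mO fO Bd_gt0 (KH_neq0 Omega_open Omega_bounded hG) K_meas K_bnd
  (fun U V t => @KH_conv R N Omega Omega_open Omega_bounded G U V t)
  (fun W Z => @KH_closed R N Omega Omega_open Omega_bounded G L L0 mG hG W Z)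
  K_trunc lsum mu_gt0 F_meas F_bnd F_lip F_mono K_compact.
exists (U None); first exact: stat.
move=> theta' /stat_inv[KU' hU'].
exact: (VI_unique mO fO Bd_gt0 K_meas K_bnd K_trunc lsum mu_gt0 F_meas F_bnd F_lip F_mono KU' KU hU' hU).
Qed.
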